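(* For $u>0$ and $x\ge0$ let $$I(u,x)=\bigl(h(u)+pu\bigr)+\limsup_{T\to\infty}\frac1T E\Bigl(\int_0^T C\bigl(X_x^u(t)\bigr)\,dt\Bigr),$$ which does not depend on $x$ and equals $I(u):=h(u)+pu+E\bigl(C(Z_u)\bigr)$. Then: (i) There is an optimal control $u^*>0$ such that for all $x\ge 0$ we have $I(u^* )=\min_{u>0}I(u,x)$. In particular, $u^*$ is independent of $x$. (ii) In the case $p>0$, if $h$ and $C$ are convex functions, then $u^*$ is unique. (iii) In the case $p=0$, if $h$ is a strictly convex function and $C$ is a convex function, then $u^*$ is unique.
   Context: Let $H\in[\tfrac12,1)$ and let $W_H=(W_H(t))_{t\ge 0}$ be a fractional Brownian motion with Hurst parameter $H$: a continuous zero-mean Gaussian process with $W_H(0)=0$ and $\mathrm{Cov}(W_H(s),W_H(t))=\frac12\bigl[t^{2H}+s^{2H}-|t-s|^{2H}\bigr]$ for $s,t\ge 0$. For $x\ge 0$ and $u\ge 0$ define, for $t\ge 0$, $$L_x^u(t)=-\min\Bigl\{0,\min_{s\in[0,t]}\bigl(x-us+W_H(s)\bigr)\Bigr\},\qquad X_x^u(t)=x-ut+W_H(t)+L_x^u(t).$$ For $u>0$ put $Z_u=\max_{s\ge 0}\{W_H(s)-us\}$ (almost surely finite). Standing assumptions: $p\ge 0$ is a constant; $h:[0,\infty)\to[0,\infty)$ is continuous, non-decreasing, with $\lim_{u\to\infty}h(u)=+\infty$; $C:[0,\infty)\to[0,\infty)$ is continuous, non-decreasing, and satisfies $C(y)\le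 K(1+y^\gamma)$ for all $y\ge0$, for some constants $K>0$, $\gamma>0$.
   Formalization: In (i), existence of u* is stated only for unbounded C (C(y)→∞ as y→∞); as written it fails, e.g. for C=0, h(u)=u, p=0, where I(u)=u has no minimum over u>0. In (ii) and (iii), uniqueness means that any two optimal controls are equal. *)

(* Defs.v *)
From HB Require Import structures.
From mathcomp Require Import all_boot all_order all_algebra.
From mathcomp Require Import all_classical all_reals all_analysis.

Set Implicit Arguments.
Unset Strict Implicit.
Unset Printing Implicit Defensive.
Import Order.TTheory GRing.Theory Num.Theory.
Import numFieldNormedType.Exports.

Local Open Scope classical_set_scope.
Local Open Scope convex_scope.
Local Open Scope ring_scope.

(* normal_prob m s is N(m, s^2) only when s != 0. *)
Definition gaussian_law (R : realType) (m s : R) (A : set R) : \bar R :=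
  if s == 0 then \d_m A else normal_prob m s A.

Section fractional_brownian_motion.
Context {d : measure_display} {T : measurableType d} {R : realType}.
Variable P : probability T R.

(* Processes are indexed by R; only their restriction to [0, +oo[ is ever
   constrained or used. *)
Definition gaussian_process (W : R -> {RV P >-> R}) : Prop :=
  forall (n : nat) (t a : 'I_n -> R), (forall i, 0 <= t i) ->
  exists m s : R, forall A : set R, measurable A ->
    P ((fun w => \sum_(i < n) a i * W (t i) w) @^-1` A) = gaussian_law m s A.

Definition continuous_paths (W : R -> {RV P >-> R}) : Prop :=
  forall w, {within `[0, +oo[, continuous (fun t : R => W t w)}.

Definition is_fBm (H : R) (W : R -> {RV P >-> R}) : Prop :=
  [/\ continuous_paths W,
      forall w, W 0 w = 0,
      gaussian_process W,
      forall t, 0 <= t -> ('E_P[W t] = 0)%E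
    & forall s t, 0 <= s -> 0 <= t ->
        covariance P (W s) (W t) =
        (2^-1 * (t `^ (2 * H) + s `^ (2 * H) - `|t - s| `^ (2 * H)))%:E].

End fractional_brownian_motion.

Section controlled_process.
Context {d : measure_display} {T : measurableType d} {R : realType}.
Variables (P : probability T R) (W : R -> {RV P >-> R}).

Definition regulator (u x t : R) (w : T) : R :=
  - Num.min 0 (inf [set x - u * s + W s w | s in `[0, t]]).

Definition state (u x t : R) (w : T) : R :=
  x - u * t + W t w + regulator u x t w.

(* On the null event where the supremum is infinite, sup returns 0. *)
Definition max_process (u : R) (w : T) : R :=
  sup [set W s w - u * s | s in `[0, +oo[].

Variables (p : R) (h C : R -> R).

Definition cost (u x : R) : \bar R :=
  ((h u + p * u)%:E +
   limf_esup (fun t : R =>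
     t^-1%:E *
     'E_P[fun w =>
          (\int[lebesgue_measure]_(r in `[0, t]) C (state u x r w))%R])
     (pinfty_nbhs R))%E.

Definition stationary_cost (u : R) : \bar R :=
  ((h u + p * u)%:E + 'E_P[fun w => C (max_process u w)])%E.

Definition is_minimum (A : set (\bar R)) (m : \bar R) : Prop :=
  A m /\ lbound A m.

Definition optimal_control (u : R) : Prop :=
  0 < u /\
  forall x, 0 <= x ->
    is_minimum [set cost v x | v in [set v | 0 < v]] (stationary_cost u).

End controlled_process.

Definition strictly_convex_function (R : realType)
    (D : set (convex_lmodType R^o)) (f : convex_lmodType R^o -> R^o) : Prop :=
  forall t : {i01 R}, 0 < t%:num < 1 ->
    {in D &, forall x y : convex_lmodType R^o,
      x != y -> f (x <| t |> y) < f x <| t |> f y}.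

(* The infimum over u > 0 need not be attained when C is bounded: here the cost
   of u is u itself. Hence the hypothesis C --> +oo for existence. *)
Lemma no_optimal_control_C0 (d : measure_display) (T : measurableType d)
    (R : realType) (P : probability T R) (W : R -> {RV P >-> R}) :
  ~ exists u, optimal_control W 0 id (cst 0) u.
Proof.
have sE u : stationary_cost W 0 id (cst 0) u = u%:E.
  rewrite /stationary_cost mul0r addr0.
  by rewrite (_ : (fun w => _) = cst 0) // expectation_cst adde0.
have cE u x : cost W 0 id (cst 0) u x = u%:E.
  rewrite /cost mul0r addr0 -[RHS]adde0; congr (_ + _)%E.
  rewrite (_ : (fun _ => _) = cst 0%E); last first.
    apply/funext => t /=.
    rewrite (_ : (fun w => _) = cst 0); last first.
      by apply/funext => w /=; rewrite /Rintegral integral0_eq.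
    by rewrite expectation_cst mule0.
  apply/eqP; rewrite eq_le; apply/andP; split.
    apply: (@le_trans _ _ (ereal_sup (cst 0%E @` [set: R]))).
      by apply: ereal_inf_lbound; exists setT => //; exact: filterT.
    by apply: ge_ereal_sup => _ [t _ <-].
  by apply: limf_esup_ge0 => //; exact: filter_not_empty.
move=> [u [u0 /(_ 0 (lexx 0))[_]]].
rewrite sE => /(_ (u / 2)%:E); rewrite lee_fin => uu2.
have : u <= u / 2 by apply: uu2; exists (u / 2); [exact: divr_gt0|exact: cE].
by rewrite leNgt ltr_pdivrMr// ltr_pMr// ltr1n.
Qed.

(* Main.v *)
Require Import Defs.
From HB Require Import structures.
From mathcomp Require Import all_boot all_order all_algebra.
From mathcomp Require Import all_classical all_reals all_analysis.
From mathcomp Require Import measurable_realfun ring lra.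
Set Implicit Arguments.
Unset Strict Implicit.
Unset Printing Implicit Defensive.
Import Order.TTheory GRing.Theory Num.Theory.
Import numFieldNormedType.Exports.
Local Open Scope classical_set_scope.
Local Open Scope ring_scope.

(** Write Z_u for the supremum of W s - u s over s >= 0.

The long-run average.  The reflected path is the maximum of x - u t + W t and
of R_u(t), the supremum of W t - W s - u (t - s) over s in [0, t]
([state_reflect]).  The increments of W read backwards from t have the law of
W itself ([fBm_reversal]), so R_u(t) has the law of the supremum of W s - u s
over [0, t] ([reflect_law]); hence E C(R_u(t)) increases to E C(Z_u).  The
initial state x is felt only at the times t with x - u t + W t > 0, which stop
before 2 (x + Z_(u/2)) / u, and at these times x - u t + W t <= x + Z_(u/2).
As Z_(u/2) has all its moments, the total effect of x on the integrated cost
has finite mean and disappears from the time average ([cost_stationary]).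

Equality of laws.  The definition of a Gaussian process speaks of the
one-dimensional laws of linear combinations only.  Covariances therefore give
the means of cosines of linear forms, and [cramer_wold_orthant] builds the
indicators of orthants out of such cosines by products, linear combinations
and bounded pointwise limits.  Suprema of continuous paths are suprema over
countable dense sets, so their distribution functions are probabilities of
orthants, and two of them agree as soon as covariances do.

Moments of Z_u.  Gaussian moments bound E |W b - W a|^(2 k) by a constant
times |b - a|^(2 H k).  A weighted sum Y of the 2 k-th powers of all dyadic
increments of W on all the intervals [0, 2^j] is integrable, and chaining along
dyadic approximations bounds max(0, W s - u s)^m by an affine function of Y,
simultaneously for all s >= 0, when k is large with respect to m
([fBm_drift_moment]).

The optimal control.  By self-similarity Z_u has the law of u^(-k) Z_1 with
k = H / (1 - H) > 0 ([max_process_scaling]), so the problem is to minimize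
J(u) = h u + p u + E C(u^(-k) Z_1) over u > 0.  This function is continuous,
large for large u because h is, and, when C is unbounded, large for small u
because Z_1 >= 1 with positive probability; hence it has a minimum.  The function
u |-> u^(-k) is strictly convex and C is convex and non-decreasing, so the last
term satisfies the midpoint convexity inequality, with equality only if it
takes the same value at both end points ([stationary_mean_mid_eq]).  Between
two minimizers equality holds everywhere; if p > 0 the remaining part
h u + p u is strictly increasing, which forbids it, and if h is strictly convex
the midpoint inequality for J is strict. *)

(** * Joint laws determined by linear forms *)

Section step_approximation.
Context {R : realType}.
Implicit Types x y z : R.

Lemma onem_expn_le x n N : 0 <= x <= 1 ->
  (1 - x ^+ n) ^+ N <= (1 + N%:R * x ^+ n)^-1.
Proof.
move=> /andP[x0 x1].
have z0 : 0 <= x ^+ n by apply: exprn_ge0.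
have z1 : x ^+ n <= 1 by apply: exprn_ile1.
move: (x ^+ n) z0 z1 => z z0 z1.
rewrite -[leRHS]mul1r ler_pdivlMr; last by rewrite ltr_wpDr// mulr_ge0.
elim: N => [|N IH]; first by rewrite expr0 mul0r addr0 mulr1.
rewrite exprS; apply: le_trans IH.
have u0 : 0 <= (1 - z) ^+ N by rewrite exprn_ge0// subr_ge0.
rewrite -mulrA mulrCA ler_wpM2l// -natr1 mulrDl mul1r.
have : 0 <= z * (z * N%:R) by rewrite !mulr_ge0.
by nra.
Qed.

Lemma onem_expn_ge x n N : 0 <= x <= 1 ->
  1 - N%:R * x ^+ n <= (1 - x ^+ n) ^+ N.
Proof.
move=> /andP[x0 x1].
have z0 : 0 <= x ^+ n by apply: exprn_ge0.
have z1 : x ^+ n <= 1 by apply: exprn_ile1.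
move: (x ^+ n) z0 z1 => z z0 z1.
elim: N => [|N IH]; first by rewrite expr0 mul0r subr0.
rewrite exprS -natr1.
have : 0 <= z * (z * N%:R) by rewrite !mulr_ge0.
have : (1 - z) * (1 - N%:R * z) <= (1 - z) * (1 - z) ^+ N by rewrite ler_wpM2l// subr_ge0.
by nra.
Qed.

Lemma cvg_natM_expn (q : R) : 0 <= q < 1 -> n%:R * q ^+ n @[n --> \oo] --> (0 : R).
Proof.
move=> /andP[q0 q1].
(* n q^n = (n r^n) r^n with r^2 = q, and n r^n is bounded by Bernoulli's inequality *)
pose r := Num.sqrt q.
have r0 : 0 <= r by exact: sqrtr_ge0.
have rq : r ^+ 2 = q by rewrite sqr_sqrtr.
have r1 : r < 1 by rewrite -(@ltr_sqr _ r 1)// ?nnegrE// rq expr1n.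
have H n : n%:R * r ^+ n <= (1 - r)^-1.
  rewrite -[leRHS]mul1r ler_pdivlMr ?subr_gt0//.
  have := @onem_expn_le (1 - r) 1 n; rewrite expr1 subKr => /(_ _).
  have -> : 0 <= 1 - r <= 1 by rewrite subr_ge0 (ltW r1)/= gerBl.
  move=> /(_ isT); set A := r ^+ n => HA.
  have A0 : 0 <= A by exact: exprn_ge0.
  have p0 : 0 < 1 + n%:R * (1 - r) by rewrite ltr_wpDr// mulr_ge0// subr_ge0 ltW.
  move: HA; rewrite -[leRHS]mul1r ler_pdivlMr// => HA.
  by nra.
apply: (@squeeze_cvgr _ _ _ _ (cst 0) (fun n => (1 - r)^-1 * r ^+ n)).
- apply: nearW => n; rewrite mulr_ge0 ?exprn_ge0//= -rq -exprM mulnC exprM expr2 mulrA.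
  by rewrite ler_wpM2r ?exprn_ge0.
- exact: cvg_cst.
- rewrite -[X in _ --> X](mulr0 (1 - r)^-1); apply: cvgMr.
  by apply: cvg_expr; rewrite ger0_norm.
Qed.

(** Bernstein's device for approximating a step by polynomials: by the two
Bernoulli inequalities above the limit is governed by n (2 x)^n, which vanishes
for x < 1/2 and is at least n for x >= 1/2. *)
Lemma step_polynomial_cvg x : 0 <= x <= 1 ->
  (1 - x ^+ n) ^+ (n * 2 ^ n) @[n --> \oo] --> ((x < 2^-1)%R%:R : R).
Proof.
move=> x01; have /andP[x0 x1] := x01.
have H1 n : (n * 2 ^ n)%:R * x ^+ n = n%:R * (2 * x) ^+ n :> R.
  by rewrite natrM natrX exprMn mulrA.
have [xl|xg] := ltP x 2^-1.
- apply: (@squeeze_cvgr _ _ _ _ (fun n => 1 - n%:R * (2 * x) ^+ n) (cst 1)).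
  + apply: nearW => n; rewrite -H1 onem_expn_ge//= exprn_ile1//.
      by rewrite subr_ge0 exprn_ile1.
    by rewrite gerBl exprn_ge0.
  + rewrite -[X in _ --> X](subr0 1); apply: cvgB; first exact: cvg_cst.
    by apply: cvg_natM_expn; lra.
  + exact: cvg_cst.
- apply: (@squeeze_cvgr _ _ _ _ (cst 0) (fun n => n.+1%:R^-1)).
  + apply: nearW => n; rewrite exprn_ge0 ?subr_ge0 ?exprn_ile1//=.
    apply: (le_trans (onem_expn_le _ _ x01)); rewrite H1 lef_pV2 ?posrE.
    - rewrite -natr1 addrC lerD2l ler_peMr// exprn_ege1//; lra.
    - by rewrite ltr_wpDr// mulr_ge0// exprn_ge0//; lra.
    - by [].
  + exact: cvg_cst.
  + exact: cvg_harmonic.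
Qed.

End step_approximation.

Definition bounded_mfun d (T : measurableType d) (R : realType) (F : T -> R) :=
  measurable_fun [set: T] F /\ exists M, forall w, `|F w| <= M.

Definition lincomb (T : Type) (R : realType) n (X : 'I_n -> T -> R)
  (a : 'I_n -> R) (w : T) : R := \sum_i a i * X i w.

Section bounded_mfun_lemmas.
Context d (T : measurableType d) (R : realType).
Implicit Types F G : T -> R.

Lemma bounded_mfun_cst (k : R) : bounded_mfun (cst k : T -> R).
Proof. by split; [exact: measurable_cst|exists `|k| => w /=]. Qed.

Lemma bounded_mfunM F G : bounded_mfun F -> bounded_mfun G ->
  bounded_mfun (F \* G).
Proof.
move=> [mF [M HM]] [mG [N HN]]; split; first exact: measurable_funM.
by exists (M * N) => w /=; rewrite normrM ler_pM.
Qed.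

Lemma bounded_mfunD F G : bounded_mfun F -> bounded_mfun G ->
  bounded_mfun (F \+ G).
Proof.
move=> [mF [M HM]] [mG [N HN]]; split; first exact: measurable_funD.
by exists (M + N) => w /=; rewrite (le_trans (ler_normD _ _))// lerD.
Qed.

Lemma bounded_mfunZ (k : R) F : bounded_mfun F -> bounded_mfun (fun w => k * F w).
Proof. by move=> bF; exact: (bounded_mfunM (bounded_mfun_cst k) bF). Qed.

Lemma bounded_mfun_comp d' (T' : measurableType d') F (h : T' -> T) :
  bounded_mfun F -> measurable_fun setT h -> bounded_mfun (F \o h).
Proof.
by move=> [mF [M HM]] mh; split; [exact: measurableT_comp|exists M => w /=].
Qed.

Lemma bounded_mfun_cos F c : measurable_fun setT F ->
  bounded_mfun (fun w => cos (F w + c)).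
Proof.
move=> mF; split; last by exists 1 => w; rewrite ler_norml cos_geN1 cos_le1.
apply: (@measurableT_comp _ _ _ _ _ _ cos); last exact: measurable_funD.
by apply: continuous_measurable_fun => x; exact: continuous_cos.
Qed.

Lemma bounded_mfun_integrable (P : probability T R) F : bounded_mfun F ->
  P.-integrable setT (EFin \o F).
Proof.
move=> [mF [M HM]]; apply: measurable_bounded_integrable => //.
  by rewrite -ge0_fin_numE// fin_num_measure.
exists M; split; first exact: num_real.
by move=> y My w _; exact: le_trans (HM w) (ltW My).
Qed.

Lemma measurable_lincomb n (X : 'I_n -> T -> R) a :
  (forall i, measurable_fun setT (X i)) -> measurable_fun setT (lincomb X a).
Proof.
by move=> mX; apply: measurable_sum => i; exact: measurable_funM.
Qed.

End bounded_mfun_lemmas.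

Section level_sets.
Context d (T : measurableType d) (R : realType).

Lemma measurable_sublevel (X : T -> R) b : measurable_fun setT X ->
  measurable [set w | X w <= b].
Proof.
move=> mX; rewrite (_ : [set w | _] = X @^-1` `]-oo, b]%classic).
  by rewrite -[X in measurable X]setTI; exact: mX.
by apply/seteqP; split=> w /=; rewrite in_itv.
Qed.

Lemma measurable_superlevel (X : T -> R) b : measurable_fun setT X ->
  measurable [set w | b <= X w].
Proof.
move=> mX; rewrite (_ : [set w | _] = X @^-1` `[b, +oo[%classic).
  by rewrite -[X in measurable X]setTI; exact: mX.
by apply/seteqP; split=> w /=; rewrite in_itv/= andbT.
Qed.

Lemma measurable_orthant n (U : 'I_n -> T -> R) b :
  (forall i, measurable_fun setT (U i)) ->
  measurable [set w | forall i, U i w < b i].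
Proof.
move=> mU; rewrite (_ : [set w | _] = \bigcap_(i in [set: 'I_n]) [set w | U i w < b i]).
  apply: fin_bigcap_measurable => // i _.
  rewrite (_ : [set w | _] = U i @^-1` `]-oo, b i[); last first.
    by apply/seteqP; split=> w /=; rewrite in_itv.
  by rewrite -[X in measurable X]setTI; exact: mU.
by apply/seteqP; split=> [w /= h i _|w h i]; [exact: h|exact: (h i I)].
Qed.

End level_sets.

Section cramer_wold.
Context d (T : measurableType d) (R : realType) (P : probability T R).
Variables (n : nat) (X Y : 'I_n -> T -> R).
Hypothesis mX : forall i, measurable_fun setT (X i).
Hypothesis mY : forall i, measurable_fun setT (Y i).

(** The weights [F] and [G] are carried along so that the indicator of an
orthant can be built one coordinate at a time. *)
Definition same_cos (F G : T -> R) := forall (a : 'I_n -> R) (c : R),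
  \int[P]_w (F w * cos (lincomb X a w + c)) =
  \int[P]_w (G w * cos (lincomb Y a w + c)).

(** Functions of a coordinate by which both weights can be multiplied without
destroying [same_cos].  They form an algebra closed under bounded pointwise
limits, which contains the cosines; indicators of half-lines follow. *)
Definition multiplier (i : 'I_n) (m : R -> R) := bounded_mfun m /\
  forall F G, bounded_mfun F -> bounded_mfun G -> same_cos F G ->
    same_cos (fun w => F w * m (X i w)) (fun w => G w * m (Y i w)).

Let icos (Z : 'I_n -> T -> R) F a c : (forall i, measurable_fun setT (Z i)) ->
  bounded_mfun F ->
  P.-integrable setT (EFin \o (fun w => F w * cos (lincomb Z a w + c))).
Proof.
move=> mZ bF; apply: bounded_mfun_integrable; apply: bounded_mfunM => //.
exact/bounded_mfun_cos/measurable_lincomb.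
Qed.

Lemma multiplier_comb i m1 m2 k1 k2 : multiplier i m1 -> multiplier i m2 ->
  multiplier i (fun y => k1 * m1 y + k2 * m2 y).
Proof.
move=> [b1 H1] [b2 H2]; split.
  by apply: bounded_mfunD; apply: bounded_mfunZ.
move=> F G bF bG FG a c.
have K (Z : 'I_n -> T -> R) A : (forall i, measurable_fun setT (Z i)) -> bounded_mfun A ->
   \int[P]_w (A w * (k1 * m1 (Z i w) + k2 * m2 (Z i w)) * cos (lincomb Z a w + c)) =
   k1 * \int[P]_w (A w * m1 (Z i w) * cos (lincomb Z a w + c)) +
   k2 * \int[P]_w (A w * m2 (Z i w) * cos (lincomb Z a w + c)).
  move=> mZ bA.
  have i1 : bounded_mfun (fun w => A w * m1 (Z i w)).
    by apply: bounded_mfunM => //; exact: bounded_mfun_comp.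
  have i2 : bounded_mfun (fun w => A w * m2 (Z i w)).
    by apply: bounded_mfunM => //; exact: bounded_mfun_comp.
  rewrite -!RintegralZl ?icos// -RintegralD//; last 2 first.
  - have /= := @icos Z _ a c mZ (bounded_mfunZ k1 i1).
    by apply: eq_integrable => // w _ /=; rewrite !mulrA.
  - have /= := @icos Z _ a c mZ (bounded_mfunZ k2 i2).
    by apply: eq_integrable => // w _ /=; rewrite !mulrA.
  by apply: eq_Rintegral => w _; ring.
by rewrite !K// (H1 F G)// (H2 F G).
Qed.

Lemma multiplierM i m1 m2 : multiplier i m1 -> multiplier i m2 ->
  multiplier i (fun y => m1 y * m2 y).
Proof.
move=> [b1 H1] [b2 H2]; split; first exact: bounded_mfunM.
move=> F G bF bG FG a c.
under eq_Rintegral do rewrite mulrA; under [RHS]eq_Rintegral do rewrite mulrA.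
apply: H2; [| |exact: H1].
- by apply: bounded_mfunM => //; exact: bounded_mfun_comp.
- by apply: bounded_mfunM => //; exact: bounded_mfun_comp.
Qed.

Lemma multiplier_cst i k : multiplier i (cst k).
Proof.
split; first exact: bounded_mfun_cst.
move=> F G bF bG FG a c /=.
under eq_Rintegral do rewrite mulrAC mulrC.
under [RHS]eq_Rintegral do rewrite mulrAC mulrC.
by rewrite !RintegralZl ?icos// FG.
Qed.

Lemma multiplierX i m k : multiplier i m -> multiplier i (fun y => m y ^+ k).
Proof.
move=> Hm; elim: k => [|k IH].
  by rewrite (_ : (fun _ => _) = cst 1)//; exact: multiplier_cst.
rewrite (_ : (fun _ => _) = (fun y => m y * m y ^+ k)); last first.
  by apply/funext => y; rewrite exprS.
exact: multiplierM.
Qed.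

(** A product of two cosines is a half-sum of cosines of linear forms whose
i-th coefficient is shifted by [s] or by [- s]. *)
Lemma multiplier_cos i s e : multiplier i (fun y => cos (s * y + e)).
Proof.
split; first by apply: bounded_mfun_cos; exact: measurable_funM.
move=> F G bF bG FG a c.
(* the coefficients of the linear form a + t X_i *)
pose a' (t : R) j := a j + t * (j == i)%:R.
have linE (Z : 'I_n -> T -> R) t w : lincomb Z (a' t) w = lincomb Z a w + t * Z i w.
  rewrite /lincomb /a'; under eq_bigr do rewrite mulrDl.
  rewrite big_split/=; congr (_ + _).
  rewrite (bigD1 i)//= eqxx mulr1 big1 ?addr0// => j /negPf ->.
  by rewrite mulr0 mul0r.
have K (Z : 'I_n -> T -> R) A : (forall i, measurable_fun setT (Z i)) -> bounded_mfun A ->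
   \int[P]_w (A w * cos (s * Z i w + e) * cos (lincomb Z a w + c)) =
   2^-1 * \int[P]_w (A w * cos (lincomb Z (a' s) w + (c + e))) +
   2^-1 * \int[P]_w (A w * cos (lincomb Z (a' (- s)) w + (c - e))).
  move=> mZ bA; rewrite -!RintegralZl ?icos// -RintegralD//; last 2 first.
  - have /= := @icos Z _ (a' s) (c + e) mZ (bounded_mfunZ 2^-1 bA).
    by apply: eq_integrable => // w _ /=; rewrite !mulrA.
  - have /= := @icos Z _ (a' (- s)) (c - e) mZ (bounded_mfunZ 2^-1 bA).
    by apply: eq_integrable => // w _ /=; rewrite !mulrA.
  apply: eq_Rintegral => w _; rewrite !linE.
  rewrite (_ : _ + (c + e) = (lincomb Z a w + c) + (s * Z i w + e)); last by ring.
  rewrite (_ : _ + (c - e) = (lincomb Z a w + c) - (s * Z i w + e)); last by ring.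
  move: (lincomb Z a w + c) (s * Z i w + e) => U V.
  by rewrite cosD cosB; field.
by rewrite !K// !FG.
Qed.

Lemma multiplier_cvg i (m_ : nat -> R -> R) m : (forall k, multiplier i (m_ k)) ->
  (forall k y, `|m_ k y| <= 1) -> (forall y, m_ k y @[k --> \oo] --> m y) ->
  multiplier i m.
Proof.
move=> Hm bm cm.
have m1 y : `|m y| <= 1.
  have : `|m_ k y| @[k --> \oo] --> `|m y| by apply: cvg_norm; exact: cm.
  move=> /cvg_lim <- //; apply: limr_le; last by apply: nearW => k; exact: bm.
  by apply: cvgP; apply: cvg_norm; exact: cm.
have mm : measurable_fun setT m.
  apply: (@measurable_fun_cvg _ _ _ _ m_).
    by move=> k; case: (Hm k) => -[].
  by move=> y _; exact: cm.
have bbm : bounded_mfun m by split=> //; exists 1.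
split=> // F G bF bG FG a c.
have K (Z : 'I_n -> T -> R) A : (forall i, measurable_fun setT (Z i)) -> bounded_mfun A ->
   \int[P]_w (A w * m_ k (Z i w) * cos (lincomb Z a w + c)) @[k --> \oo] -->
   \int[P]_w (A w * m (Z i w) * cos (lincomb Z a w + c)).
  move=> mZ bA; have [mA [M HM]] := bA.
  have bmZ k : bounded_mfun (fun w => A w * m_ k (Z i w)).
    by apply: bounded_mfunM => //; apply: bounded_mfun_comp => //; case: (Hm k).
  have bmZ' : bounded_mfun (fun w => A w * m (Z i w)).
    by apply: bounded_mfunM => //; apply: bounded_mfun_comp.
  have [] := @dominated_convergence _ T R P setT measurableT
    (fun k w => (A w * m_ k (Z i w) * cos (lincomb Z a w + c))%:E)
    (fun w => (A w * m (Z i w) * cos (lincomb Z a w + c))%:E) (cst M%:E).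
  - by move=> k; have /integrableP[] := icos a c mZ (bmZ k).
  - by have /integrableP[] := icos a c mZ bmZ'.
  - apply: aeW => w _; apply/cvg_EFin; first exact: nearW.
    by apply: cvgMl; apply: cvgMr; exact: cm.
  - exact/(@bounded_mfun_integrable _ _ _ P (cst M))/bounded_mfun_cst.
  - apply: aeW => w k _; rewrite /= lee_fin normrM.
    rewrite -[leRHS]mulr1 ler_pM//; last by rewrite ler_norml cos_geN1 cos_le1.
    by rewrite normrM -[leRHS]mulr1 ler_pM.
  move=> _ _; rewrite -[X in _ --> X]fineK.
    by move=> /fine_cvg.
  exact: (integrable_fin_num measurableT (icos a c mZ bmZ')).
have KX := K X F mX bF; have KY := K Y G mY bG.
apply: (cvg_unique _ KX) => //.
rewrite (_ : (fun k => _) = (fun k => \int[P]_w (G w * m_ k (Y i w) * cos (lincomb Y a w + c))))//.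
by apply/funext => k; case: (Hm k) => _; apply.
Qed.

(** The function 1/2 + 1/2 sin ((y - b) / L) is a multiplier with values in
[0, 1]; composing it with the polynomials of [step_polynomial_cvg] gives the
indicator of the periodic set where the sine is negative, and this set agrees
with y < b on any given bounded set once L is large. *)
Lemma multiplier_lt i b : multiplier i (fun y => (y < b)%R%:R).
Proof.
pose x_ (L : nat) (y : R) := 2^-1 + 2^-1 * sin ((y - b) / L.+1%:R).
have x01 L y : 0 <= x_ L y <= 1.
  have := sin_geN1 ((y - b) / L.+1%:R); have := sin_le1 ((y - b) / L.+1%:R).
  by rewrite /x_; lra.
have mx L : multiplier i (x_ L).
  rewrite (_ : x_ L = (fun y => 1 * cst 2^-1 y +
     2^-1 * cos (L.+1%:R^-1 * y + (- b / L.+1%:R - pi / 2)))); last first.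
    apply/funext => y; rewrite /x_ mul1r/=; congr (_ + _ * _).
    rewrite -cosBpihalf; congr cos; rewrite mulrBl (mulrC y); ring.
  by apply: multiplier_comb; [exact: multiplier_cst|exact: multiplier_cos].
have step L : multiplier i (fun y => (x_ L y < 2^-1)%R%:R).
  apply: (@multiplier_cvg i (fun k y => (1 - x_ L y ^+ k) ^+ (k * 2 ^ k))).
  - move=> k; apply: multiplierX.
    rewrite (_ : (fun _ => _) = (fun y => 1 * cst 1 y + (-1) * x_ L y ^+ k)); last first.
      by apply/funext => y /=; rewrite mul1r mulN1r.
    by apply: multiplier_comb; [exact: multiplier_cst|exact: multiplierX].
  - move=> k y; have /andP[x0 x1] := x01 L y.
    have z0 : 0 <= 1 - x_ L y ^+ k by rewrite subr_ge0 exprn_ile1.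
    by rewrite ger0_norm ?exprn_ge0// exprn_ile1// gerBl exprn_ge0.
  - by move=> y; exact: step_polynomial_cvg.
(* for each y the sign of the sine is that of y - b as soon as |y - b| / L < pi *)
apply: (@multiplier_cvg i (fun k y => (x_ k y < 2^-1)%R%:R)) => //.
  by move=> k y; case: (_ < _)%R; rewrite ?normr1 ?normr0.
move=> y; apply: cvg_near_cst; near=> k.
have kpos : 0 < k.+1%:R :> R by [].
have pik : `|(y - b) / k.+1%:R| < pi.
  rewrite normrM (@gtr0_norm _ k.+1%:R^-1) ?invr_gt0// ltr_pdivrMr//.
  rewrite mulrC -ltr_pdivrMr ?pi_gt0//.
  by near: k; apply: filterS (nbhs_infty_gtr (`|y - b| / pi)) => k /lt_le_trans; apply;
    rewrite ler_nat.
congr (_%:R); rewrite /x_ gtrDl pmulr_rlt0//.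
have [yb|yb|->] := ltgtP y b; last by rewrite subrr mul0r sin0 ltxx.
- rewrite -oppr_gt0 -sinN sin_gt0_pi// -mulNr divr_gt0//= ?opprB ?subr_gt0//.
  by rewrite (le_lt_trans _ pik)// -[leRHS]normrN -mulNr opprB ler_norm.
- rewrite ltNge ltW// sin_gt0_pi// divr_gt0 ?subr_gt0//=.
  by rewrite (le_lt_trans _ pik)// ler_norm.
Unshelve. all: by end_near. Qed.

(** Starting from the weights 1, multiply by the indicators of the coordinates
one after the other and evaluate at the zero linear form. *)
Lemma cramer_wold_orthant b : same_cos (cst 1) (cst 1) ->
  P [set w | forall i, X i w < b i] = P [set w | forall i, Y i w < b i].
Proof.
move=> H0.
pose F (Z : 'I_n -> T -> R) (s : seq 'I_n) w : R := \prod_(i <- s) (Z i w < b i)%R%:R.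
have FE Z i s : F Z (i :: s) = (fun w => F Z s w * (Z i w < b i)%R%:R).
  by apply/funext => w; rewrite /F big_cons mulrC.
have H s : [/\ bounded_mfun (F X s), bounded_mfun (F Y s) & same_cos (F X s) (F Y s)].
  elim: s => [|i s [bX bY IH]].
    have F0 Z : F Z [::] = cst 1 by apply/funext => w; rewrite /F big_nil.
    by rewrite !F0; split => //; exact: bounded_mfun_cst.
  have [bm Hm] := multiplier_lt i (b i).
  rewrite !FE; split; last exact: Hm.
  - by apply: bounded_mfunM => //; exact: (bounded_mfun_comp bm).
  - by apply: bounded_mfunM => //; exact: (bounded_mfun_comp bm).
have PE (Z : 'I_n -> T -> R) : (forall i, measurable_fun setT (Z i)) ->
    \int[P]_w (F Z (index_enum 'I_n) w * cos (lincomb Z (cst 0) w + 0)) =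
    fine (P [set w | forall i, Z i w < b i]).
  move=> mZ; rewrite -[in RHS](setIT [set w | _]) -integral_indic//; last exact: measurable_orthant.
  rewrite /Rintegral; congr fine; apply: eq_integral => w _; congr EFin.
  rewrite (_ : lincomb Z (cst 0) w = 0) ?addr0 ?cos0 ?mulr1; last first.
    by rewrite /lincomb big1// => j _; rewrite mul0r.
  rewrite /F indicE; case: (boolP (w \in _)) => [/set_mem/= h|].
    by rewrite big1// => i _; rewrite h.
  rewrite notin_setE/= => /existsNP[i /negP]; rewrite -leNgt => h.
  by rewrite (bigD1 i)//= ltNge h mul0r.
have [_ _ /(_ (cst 0) 0)] := H (index_enum 'I_n).
rewrite !PE// => h.
by rewrite -[LHS]fineK ?fin_num_measure// ?h ?fineK ?fin_num_measure//;
  exact: measurable_orthant.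
Qed.

End cramer_wold.

(** * Gaussian laws *)

Section density.
Local Open Scope ereal_scope.
Context d d' (T : measurableType d) (T' : measurableType d') (R : realType).
Variables (P : {measure set T -> \bar R}) (mu : {measure set T' -> \bar R}).
Variables (V : T -> T') (g : T' -> R).
Hypotheses (mV : measurable_fun setT V).
Hypotheses (mg : measurable_fun setT g) (g0 : forall x, (0 <= g x)%R).
Hypothesis VE : forall A, measurable A ->
  P (V @^-1` A) = \int[mu]_(x in A) (g x)%:E.

Import HBNNSimple.

Let density_nnsfun (f : {nnsfun T' >-> R}) :
  \int[P]_w (f (V w))%:E = \int[mu]_x ((f x)%:E * (g x)%:E).
Proof.
under [LHS]eq_integral do rewrite fimfunE -fsumEFin//.
have mVf r : measurable (V @^-1` (f @^-1` [set r])).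
  by rewrite -[X in measurable X]setTI; exact: mV.
have mi r : measurable_fun setT (fun w => \1_(f @^-1` [set r]) (V w) : R).
  rewrite (_ : (fun w => _) = \1_(V @^-1` (f @^-1` [set r]))).
    exact: measurable_indic.
  by apply/funext => w; rewrite !indicE; congr (_%:R); rewrite !inE.
have mr r : measurable_fun setT (fun w => (r * \1_(f @^-1` [set r]) (V w))%:E).
  by apply/measurable_EFinP; apply: measurable_funM => //; exact: mi.
rewrite [LHS]ge0_integral_fsum//; last first.
  by move=> n x _; rewrite EFinM nnfun_muleindic_ge0.
under [RHS]eq_integral.
  move=> x xD; rewrite fimfunE -fsumEFin// ge0_mule_fsuml; last first.
    by move=> r; rewrite EFinM nnfun_muleindic_ge0.
  over.
rewrite [RHS]ge0_integral_fsum//; last 2 first.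
  - move=> r; apply: emeasurable_funM; last exact/measurable_EFinP.
    by apply/measurable_EFinP/measurableT_comp.
  - move=> n x _; apply: mule_ge0; last by rewrite lee_fin.
    by rewrite EFinM nnfun_muleindic_ge0.
apply: eq_fsbigr => r _; have [r0|r0] := leP 0%R r; last first.
  rewrite !integral0_eq// => x _; rewrite preimage_nnfun0// indicE in_set0 mulr0//.
  by rewrite mul0e.
under eq_integral do rewrite EFinM.
rewrite ge0_integralZl//; last first.
  by apply/measurable_EFinP; exact: mi.
rewrite (eq_integral (EFin \o \1_(V @^-1` (f @^-1` [set r])))); last first.
  by move=> w _; rewrite /= !indicE; congr (_%:R%:E); rewrite !inE.
rewrite integral_indic// setIT VE// integral_mkcond -ge0_integralZl//.
- apply: eq_integral => x _; rewrite patchE indicE.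
  by case: (x \in _); rewrite !(mulr1, mulr0, mul0e, mule0).
- by apply/(measurable_restrictT _ _).1 => //; apply/measurable_funTS/measurable_EFinP.
- by move=> x _; rewrite patchE; case: ifP; rewrite ?lee_fin.
Qed.

(** By definition of the density for indicators, hence for simple functions, and
then by monotone convergence. *)
Lemma ge0_integral_density (f : T' -> \bar R) : measurable_fun setT f ->
  (forall x, 0 <= f x) -> \int[P]_w f (V w) = \int[mu]_x (f x * (g x)%:E).
Proof.
move=> mf f0.
pose f_ := nnsfun_approx measurableT mf.
have f_f x : (f_ n x)%:E @[n --> \oo] --> f x by exact: cvg_nnsfun_approx.
have ndf x : nondecreasing_seq (fun n => (f_ n x)%:E).
  by move=> a b ab; rewrite lee_fin; exact/lefP/nd_nnsfun_approx.
have fn0 n x : 0 <= (f_ n x)%:E by rewrite lee_fin.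
have mf_ n : measurable_fun setT (fun w => (f_ n (V w))%:E).
  exact/measurable_EFinP/measurableT_comp.
have H1 : \int[P]_w (f_ n (V w))%:E @[n --> \oo] --> \int[P]_w f (V w).
  have := @cvg_monotone_convergence _ T R P setT measurableT
     (fun n w => (f_ n (V w))%:E) mf_ (fun n w _ => fn0 n (V w)) (fun w _ => ndf (V w)).
  by rewrite (eq_integral (f \o V))// => x _; apply/cvg_lim => //; exact: f_f.
have H2 : \int[P]_w (f_ n (V w))%:E @[n --> \oo] --> \int[mu]_x (f x * (g x)%:E).
  have mG n : measurable_fun setT (fun x => (f_ n x)%:E * (g x)%:E).
    by apply: emeasurable_funM; [exact/measurable_EFinP|exact/measurable_EFinP].
  rewrite (_ : (fun n => _) = (fun n => \int[mu]_x ((f_ n x)%:E * (g x)%:E))); last first.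
    by apply/funext => n; rewrite density_nnsfun.
  have := @cvg_monotone_convergence _ T' R mu setT measurableT
     (fun n x => (f_ n x)%:E * (g x)%:E) mG.
  rewrite (eq_integral (fun x => f x * (g x)%:E)); last first.
    move=> x _; apply/cvg_lim => //; apply: cvgeMr => //; exact: f_f.
  apply => [n x _|x _ a b ab]; first by rewrite mule_ge0 ?lee_fin.
  by rewrite lee_wpmul2r ?lee_fin//; exact: ndf.
exact: (cvg_unique _ H1 H2).
Qed.

End density.

Section gaussian_law_theory.
Context {R : realType}.
Implicit Types m s th : R.

(** Completing the square: an exponential tilt translates a normal density. *)
Lemma normal_pdf_expR m s th x : s != 0 ->
  expR (th * x) * normal_pdf m s x =
  expR (m * th + s ^+ 2 * th ^+ 2 / 2) * normal_pdf (m + s ^+ 2 * th) s x.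
Proof.
move=> s0; rewrite !normal_pdfE// mulrCA [RHS]mulrCA; congr (_ * _).
rewrite /normal_fun -!expRD; congr expR; field.
exact: s0.
Qed.

(** A Gaussian factor only changes the variance of a normal density. *)
Lemma normal_pdf_gauss s s' x : s != 0 -> s' != 0 -> 0 < s' / s ->
  expR (- ((s' ^- 2 - s ^- 2) / 2 * x ^+ 2)) * normal_pdf 0 s x =
  s' / s * normal_pdf 0 s' x.
Proof.
move=> s0 s'0 ss'; rewrite !normal_pdfE// mulrCA mulrA.
have -> : normal_peak s = s' / s * normal_peak s'.
  rewrite /normal_peak.
  have E t : t != 0 -> Num.sqrt (t ^+ 2 * pi *+ 2) = `|t| * Num.sqrt (pi *+ 2).
    by move=> t0; rewrite -mulrnAr sqrtrM ?sqr_ge0// sqrtr_sqr.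
  have p0 : Num.sqrt (pi *+ 2) != 0 :> R.
    by rewrite gt_eqF// sqrtr_gt0 mulrn_wgt0// pi_gt0.
  rewrite !E// -[s' / s]gtr0_norm// normrM normfV; field.
  by rewrite p0 !normr_eq0 s0 s'0.
rewrite -!mulrA; congr (_ * (_ * (_ * _))).
rewrite /normal_fun -!expRD; congr expR; field.
by rewrite s0 s'0.
Qed.

End gaussian_law_theory.

(** As in [gaussian_law], [s] is a standard deviation up to sign, and [s = 0]
stands for the Dirac law at [m]. *)
Definition has_gaussian_law d (T : measurableType d) (R : realType)
    (P : probability T R) (m s : R) (V : T -> R) :=
  measurable_fun setT V /\
  forall A : set R, measurable A -> P (V @^-1` A) = gaussian_law m s A.

Section gaussian_rv.
Context d (T : measurableType d) (R : realType) (P : probability T R).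
Implicit Types (V : T -> R) (m s th : R).

Lemma gaussian_law0 m V : has_gaussian_law P m 0 V ->
  forall f : R -> \bar R, measurable_fun setT f -> (forall x, 0 <= f x)%E ->
  (\int[P]_w f (V w) = f m)%E.
Proof.
move=> [mV HV] f mf f0.
rewrite -(@ge0_integral_pushforward _ _ _ _ _ V mV P setT)//.
rewrite (@eq_measure_integral _ _ _ _ (dirac m)).
  by rewrite integral_dirac// diracT mul1e.
move=> A mA _; transitivity (P (V @^-1` A)) => //.
by rewrite HV// /gaussian_law eqxx.
Qed.

Lemma gaussian_integral m s V : s != 0 -> has_gaussian_law P m s V ->
  forall f : R -> \bar R, measurable_fun setT f -> (forall x, 0 <= f x)%E ->
  (\int[P]_w f (V w) = \int[lebesgue_measure]_x (f x * (normal_pdf m s x)%:E))%E.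
Proof.
move=> s0 [mV HV] f mf f0.
apply: ge0_integral_density => //.
- exact: measurable_normal_pdf.
- exact: normal_pdf_ge0.
- by move=> A mA; have := HV A mA; rewrite /gaussian_law (negbTE s0) => HA; exact: HA.
Qed.

Lemma gaussian_mgf m s th V : has_gaussian_law P m s V ->
  (\int[P]_w (expR (th * V w))%:E = (expR (m * th + s ^+ 2 * th ^+ 2 / 2))%:E)%E.
Proof.
have mE : measurable_fun setT (fun x : R => (expR (th * x))%:E).
  by apply/measurable_EFinP; apply: measurableT_comp.
have [->|s0] := eqVneq s 0 => HV.
  rewrite (gaussian_law0 HV (f := fun x => (expR (th * x))%:E))//.
    by rewrite expr0n/= !mul0r addr0 mulrC.
rewrite (gaussian_integral s0 HV (f := fun x => (expR (th * x))%:E))//.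
under eq_integral do rewrite -EFinM normal_pdf_expR// EFinM.
rewrite ge0_integralZl//.
- by rewrite integral_normal_pdf mule1.
- apply/measurable_EFinP; exact: measurable_normal_pdf.
- by move=> x _; rewrite lee_fin normal_pdf_ge0.
Qed.

Lemma gaussian_expN_sq s s' V : s != 0 -> s' != 0 -> 0 < s' / s ->
  has_gaussian_law P 0 s V ->
  (\int[P]_w (expR (- ((s' ^- 2 - s ^- 2) / 2 * V w ^+ 2)))%:E = (s' / s)%:E)%E.
Proof.
move=> s0 s'0 ss' HV.
rewrite (gaussian_integral s0 HV (f := fun x => (expR (- ((s' ^- 2 - s ^- 2) / 2 * x ^+ 2)))%:E)); last 2 first.
- apply/measurable_EFinP; apply: measurableT_comp => //.
  apply: measurable_funN; apply: measurable_funM => //; exact: measurable_funX.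
- by move=> x; rewrite lee_fin expR_ge0.
under eq_integral do rewrite -EFinM normal_pdf_gauss// EFinM.
rewrite ge0_integralZl//.
- by rewrite integral_normal_pdf mule1.
- apply/measurable_EFinP; exact: measurable_normal_pdf.
- by move=> x _; rewrite lee_fin normal_pdf_ge0.
- by rewrite lee_fin ltW.
Qed.

(** An even power is dominated by the exponentials through their Taylor series,
and the scale [th] is left free so that it can be matched to [s]. *)
Lemma gaussian_moment m s (th : R) k V : 0 < th -> has_gaussian_law P m s V ->
  (\int[P]_w (V w ^+ k.*2)%:E <=
   ((k.*2)`!%:R / th ^+ k.*2 * (expR (m * th + s ^+ 2 * th ^+ 2 / 2) + expR (- m * th + s ^+ 2 * th ^+ 2 / 2)))%:E)%E.
Proof.
move=> th0 HV; have [mV _] := HV.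
have mE t : measurable_fun setT (fun w => (expR (t * V w))%:E).
  apply/measurable_EFinP; apply: measurableT_comp => //.
  exact: measurable_funM.
have c0 : 0 <= (k.*2)`!%:R / th ^+ k.*2 by rewrite divr_ge0// exprn_ge0// ltW.
have Hpt (x : R) : x ^+ k.*2 <= (k.*2)`!%:R * (expR x + expR (- x)).
  case: k c0 => [|k] _.
    rewrite double0 expr0 fact0 mul1r.
    have := expR_ge1Dx x; have := expR_ge1Dx (- x).
    have := expR_ge0 x; have := expR_ge0 (-x); lra.
  rewrite mulrC -ler_pdivrMr ?ltr0n ?fact_gt0//.
  have [x0|x0] := leP 0 x.
    have := expR_ge1Dxn k.*2.+1 x0; have := expR_ge0 (- x).
    rewrite doubleS; lra.
  have : 0 <= - x by rewrite oppr_ge0 ltW.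
  move/(expR_ge1Dxn k.*2.+1); have := expR_ge0 x.
  have -> : (- x) ^+ k.*2.+2 = x ^+ k.*2.+2.
    by rewrite -doubleS -mul2n !exprM sqrrN.
  rewrite doubleS; lra.
apply: (@le_trans _ _ (\int[P]_w (((k.*2)`!%:R / th ^+ k.*2)%:E *
   ((expR (th * V w))%:E + (expR (- th * V w))%:E)))%E).
  apply: ge0_le_integral => //.
  - by move=> w _; rewrite lee_fin -mul2n exprM exprn_ge0// sqr_ge0.
  - exact/measurable_EFinP/measurable_funX.
  - by apply: emeasurable_funM => //; apply: emeasurable_funD.
  move=> w _; rewrite -EFinD -EFinM lee_fin.
  rewrite mulrAC ler_pdivlMr ?exprn_gt0// -exprMn mulrC.
  by rewrite (le_trans (Hpt _))// ler_wpM2l// mulNr mulrC.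
rewrite ge0_integralZl//; last 2 first.
- exact: emeasurable_funD.
- by move=> w _; rewrite adde_ge0// lee_fin expR_ge0.
rewrite ge0_integralD//.
rewrite !(gaussian_mgf _ HV) sqrrN.
by rewrite mulrN mulNr.
Qed.

End gaussian_rv.

Section gaussian_parameters.
Context d (T : measurableType d) (R : realType) (P : probability T R).
Implicit Types (V : T -> R) (m s th : R).

Lemma Rintegral_prob_cst (r : R) : \int[P]_w r = r.
Proof. by rewrite /Rintegral integral_cst//= probability_setT mule1. Qed.

Lemma gaussian_integrableX m s k V : has_gaussian_law P m s V ->
  P.-integrable setT (fun w => (V w ^+ k.*2)%:E).
Proof.
move=> HV; have [mV _] := HV; apply/integrableP; split.
  exact/measurable_EFinP/measurable_funX.
apply: le_lt_trans (ltry _); last first.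
apply: le_trans (gaussian_moment k (ltr01 : 0 < 1 :> R) HV).
apply: ge0_le_integral => //.
- by apply/measurable_EFinP/measurableT_comp => //; exact: measurable_funX.
- exact/measurable_EFinP/measurable_funX.
- move=> w _; rewrite lee_fin ger0_norm//.
  by rewrite -mul2n exprM exprn_ge0// sqr_ge0.
Qed.

Lemma gaussian_integrable m s V : has_gaussian_law P m s V ->
  P.-integrable setT (EFin \o V).
Proof.
move=> HV; have [mV _] := HV.
have i2 : P.-integrable setT (fun w => (1 + V w ^+ 2)%:E).
  under eq_fun do rewrite EFinD.
  apply: integrableD => //; last exact: (gaussian_integrableX 1 HV).
  by apply: finite_measure_integrable_cst.
apply: (le_integrable measurableT _ _ i2); first exact/measurable_EFinP.
move=> w _; rewrite lee_fin [leRHS]ger0_norm; last by rewrite addr_ge0// sqr_ge0.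
by rewrite ler_norml; have := sqr_ge0 (V w - 1); have := sqr_ge0 (V w + 1); nra.
Qed.

Lemma gaussian_expR_integrable m s th V : has_gaussian_law P m s V ->
  P.-integrable setT (fun w => (expR (th * V w))%:E).
Proof.
move=> HV; have [mV _] := HV; apply/integrableP; split.
  by apply/measurable_EFinP; apply: measurableT_comp => //; exact: measurable_funM.
under eq_integral do rewrite /= ger0_norm ?expR_ge0//.
by rewrite (gaussian_mgf _ HV) ltry.
Qed.

(** The linear lower bound of the exponential turns the moment generating
function into 0 <= m th + s^2 th^2 / 2 for all [th], which forces [m = 0]. *)
Lemma gaussian_mean0 m s V : has_gaussian_law P m s V ->
  \int[P]_w V w = 0 -> m = 0.
Proof.
move=> HV EV.
have iV := gaussian_integrable HV.
have H th : 0 <= m * th + s ^+ 2 * th ^+ 2 / 2.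
  rewrite -ler_expR expR0.
  have -> : expR (m * th + s ^+ 2 * th ^+ 2 / 2) = \int[P]_w expR (th * V w).
    by rewrite /Rintegral (gaussian_mgf _ HV).
  have -> : 1 = \int[P]_w (1 + th * V w).
    rewrite RintegralD//; last 2 first.
    - exact: finite_measure_integrable_cst.
    - by have := integrableZl measurableT th iV.
    by rewrite RintegralZl// EV mulr0 addr0 Rintegral_prob_cst.
  apply: le_Rintegral => //.
  - rewrite /comp; under eq_fun do rewrite EFinD.
    apply: integrableD => //; first exact: finite_measure_integrable_cst.
    by have := integrableZl measurableT th iV.
  - exact: gaussian_expR_integrable HV.
  - by move=> w _; exact: expR_ge1Dx.
have [s0|s0] := eqVneq s 0.
  have := H (- m); rewrite s0 expr0n/= !mul0r addr0 mulrN oppr_ge0.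
  by rewrite -expr2 real_exprn_even_le0//= ?num_real// => /eqP.
have s2 : 0 < s ^+ 2 by rewrite exprn_even_gt0.
have := H (- m / s ^+ 2).
have -> : m * (- m / s ^+ 2) + s ^+ 2 * (- m / s ^+ 2) ^+ 2 / 2 = - (m ^+ 2 * (s ^- 2 / 2)).
  by field.
rewrite oppr_ge0 pmulr_lle0 ?divr_gt0 ?invr_gt0//.
by rewrite real_exprn_even_le0//= ?num_real// => /eqP.
Qed.

(** The linear lower bound of the exponential, applied to the mean of
exp(- l V^2) known from [gaussian_expN_sq], gives an inequality for every
r > 0, where r s is the modified standard deviation; letting r approach 1 from
both sides determines the second moment. *)
Lemma gaussian_variance s V : has_gaussian_law P 0 s V -> \int[P]_w (V w ^+ 2) = s ^+ 2.
Proof.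
move=> HV; have [mV _] := HV.
have iV2 : P.-integrable setT (fun w => (V w ^+ 2)%:E) := gaussian_integrableX 1 HV.
have [s0|s0] := eqVneq s 0.
  move: HV; rewrite s0 => HV.
  rewrite /Rintegral (gaussian_law0 HV (f := fun x => (x ^+ 2)%:E))//.
  - exact/measurable_EFinP/measurable_funX.
  - by move=> x; rewrite lee_fin sqr_ge0.
have s2 : 0 < s ^+ 2 by rewrite exprn_even_gt0.
set v := \int[P]_w _; pose k := v / s ^+ 2.
have v0 : 0 <= v by apply: Rintegral_ge0 => w _; rewrite sqr_ge0.
have k0 : 0 <= k by rewrite divr_ge0// ltW.
suff : k = 1 by move/(canRL (mulfVK (lt0r_neq0 s2))); rewrite mul1r.
have H r : 0 < r -> (r ^+ 2 - 1) * k <= 2 * r ^+ 2 * (r - 1).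
  move=> r0.
  have rs0 : r * s != 0 by rewrite mulf_neq0// gt_eqF.
  have E : (r * s) / s = r by rewrite mulfK.
  have ms : \int[P]_w expR (- (((r * s) ^- 2 - s ^- 2) / 2 * V w ^+ 2)) = r.
    by rewrite /Rintegral (gaussian_expN_sq s0 rs0 _ HV) ?E.
  set l := (_ / 2) in ms.
  have : 1 - l * v <= r.
    rewrite -[leRHS]ms.
    have -> : 1 - l * v = \int[P]_w (1 + (- l) * V w ^+ 2).
      rewrite RintegralD//; last 2 first.
      - exact: finite_measure_integrable_cst.
      - by have := integrableZl measurableT (- l) iV2.
      by rewrite RintegralZl// Rintegral_prob_cst mulNr.
    apply: le_Rintegral => //.
    - rewrite /comp; under eq_fun do rewrite EFinD.
      apply: integrableD => //; first exact: finite_measure_integrable_cst.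
      by have := integrableZl measurableT (- l) iV2.
    - apply/integrableP; split.
        apply/measurable_EFinP; apply: measurableT_comp => //.
        apply: measurable_funN; apply: measurable_funM => //; exact: measurable_funX.
      under eq_integral do rewrite /= ger0_norm ?expR_ge0//.
      by rewrite (gaussian_expN_sq s0 rs0 _ HV) ?E ?ltry.
    - by move=> w _; rewrite mulNr; exact: expR_ge1Dx.
  have -> : l * v = (r ^- 2 - 1) / 2 * k by rewrite /l /k; field; rewrite s0 gt_eqF.
  have p : 0 < 2 * r ^+ 2 by rewrite mulr_gt0// exprn_gt0.
  move=> /(ler_wpM2l (ltW p)).
  have -> : 2 * r ^+ 2 * (1 - (r ^- 2 - 1) / 2 * k) = 2 * r ^+ 2 - (1 - r ^+ 2) * k.
    by field; rewrite gt_eqF.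
  by nra.
apply/eqP; rewrite eq_le; apply/andP; split; rewrite leNgt; apply/negP => k1.
(* for k > 1, [dl] is small enough that r = 1 + dl violates H *)
- pose dl := (k - 1) / (k + 3).
  have k3 : 0 < k + 3 by lra.
  have d0 : 0 < dl by rewrite divr_gt0// subr_gt0.
  have d1 : dl < 1 by rewrite ltr_pdivrMr//; lra.
  have dE : dl * (k + 3) = k - 1 by rewrite mulfVK// gt_eqF.
  have := H (1 + dl) ltac:(lra).
  have -> : ((1 + dl) ^+ 2 - 1) * k = dl * ((2 + dl) * k) by ring.
  have -> : 2 * (1 + dl) ^+ 2 * (1 + dl - 1) = dl * (2 * (1 + dl) ^+ 2) by ring.
  by rewrite ler_pM2l//; nra.
(* for k < 1, [dl] is small enough that r = 1 - dl violates H *)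
- pose dl := (1 - k) / 4.
  have d0 : 0 < dl by rewrite divr_gt0// subr_gt0.
  have dE : dl * 4 = 1 - k by rewrite mulfVK.
  have := H (1 - dl) ltac:(lra).
  have -> : ((1 - dl) ^+ 2 - 1) * k = - (dl * ((2 - dl) * k)) by ring.
  have -> : 2 * (1 - dl) ^+ 2 * (1 - dl - 1) = - (dl * (2 * (1 - dl) ^+ 2)) by ring.
  by rewrite lerN2 ler_pM2l//; nra.
Qed.

Definition gaussian_moment_cst k : R := (k.*2)`!%:R * (2 * expR 2^-1).

Lemma gaussian_moment_cst_ge0 k : 0 <= gaussian_moment_cst k.
Proof. by rewrite !mulr_ge0// expR_ge0. Qed.

(** The choice [th = `|s|^-1] in [gaussian_moment] makes the exponentials
independent of [s]. *)
Lemma gaussian_moment_le s k V : has_gaussian_law P 0 s V ->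
  (\int[P]_w (V w ^+ k.*2)%:E <= (gaussian_moment_cst k * s ^+ k.*2)%:E)%E.
Proof.
move=> HV; have [s0|s0] := eqVneq s 0.
  move: HV; rewrite s0 => HV.
  rewrite (gaussian_law0 HV (f := fun x => (x ^+ k.*2)%:E)).
  - rewrite lee_fin; case: k => [|k]; last by rewrite doubleS expr0n/= mulr0.
    rewrite double0 !expr0 mulr1 /gaussian_moment_cst double0 fact0 mul1r.
    by have := expR_ge1Dx (2^-1 : R); lra.
  - exact/measurable_EFinP/measurable_funX.
  - by move=> x; rewrite lee_fin -mul2n exprM exprn_ge0// sqr_ge0.
have ns0 : 0 < `|s|^-1 by rewrite invr_gt0 normr_gt0.
apply: le_trans (gaussian_moment k ns0 HV) _; rewrite lee_fin oppr0 !mul0r !add0r.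
have -> : s ^+ 2 * `|s|^-1 ^+ 2 = 1.
  by rewrite exprVn -normrX ger0_norm ?sqr_ge0// divff// expf_neq0.
rewrite mul1r exprVn invrK /gaussian_moment_cst.
rewrite (_ : `|s| ^+ k.*2 = s ^+ k.*2); last first.
  by rewrite -mul2n !exprM -normrX ger0_norm ?sqr_ge0.
by rewrite -mulr2n -[expR 2^-1 *+ 2]mulr_natl mulrAC.
Qed.

(** [s] and [s'] may have opposite signs: the law depends on the square only. *)
Lemma gaussian_cos s s' c V V' : s ^+ 2 = s' ^+ 2 ->
  has_gaussian_law P 0 s V -> has_gaussian_law P 0 s' V' ->
  \int[P]_w cos (V w + c) = \int[P]_w cos (V' w + c).
Proof.
move=> ss' [mV HV] [mV' HV'].
have mc : measurable_fun setT (fun x : R => (cos (x + c))%:E).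
  by apply/measurable_EFinP; have [] := bounded_mfun_cos c (@measurable_id _ R setT).
have K (U : T -> R) : measurable_fun setT U -> \int[P]_w cos (U w + c) =
    fine (\int[pushforward P U]_x (cos (x + c))%:E)%E.
  move=> mU; rewrite (@integral_pushforward _ _ _ _ _ U mU P setT _ mc)//.
  exact/bounded_mfun_integrable/bounded_mfun_cos.
rewrite !K//; congr fine; apply: eq_measure_integral => A mA _.
transitivity (P (V' @^-1` A)) => //; transitivity (P (V @^-1` A)) => //.
rewrite HV// HV'// /gaussian_law.
have -> : normal_prob 0 s A = normal_prob 0 s' A.
  apply: eq_integral => x _.
  have ss0 : (s == 0) = (s' == 0) by rewrite -sqrf_eq0 ss' sqrf_eq0.
  by rewrite /normal_pdf ss0 /normal_peak /normal_fun ss'.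
by rewrite -sqrf_eq0 ss' sqrf_eq0.
Qed.

End gaussian_parameters.

(** * Centred Gaussian families *)

Section gaussian_families.
Context d (T : measurableType d) (R : realType) (P : probability T R).

Lemma Rintegral_sum n (f : 'I_n -> T -> R) :
  (forall i, P.-integrable setT (EFin \o f i)) ->
  \int[P]_w (\sum_i f i w) = \sum_i \int[P]_w f i w.
Proof.
move=> fi; rewrite /Rintegral.
under eq_integral do rewrite -sumEFin.
rewrite integral_sum// -sum_fine// => i _.
exact: (integrable_fin_num measurableT (fi i)).
Qed.

Definition gaussian_family n (X : 'I_n -> T -> R) :=
  (forall a, exists m s, has_gaussian_law P m s (lincomb X a)) /\
  (forall i, \int[P]_w X i w = 0).

Lemma lincomb_delta n (X : 'I_n -> T -> R) i :
  lincomb X (fun j => (j == i)%:R) = X i.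
Proof.
apply/funext => w; rewrite /lincomb (bigD1 i)//= eqxx mul1r big1 ?addr0//.
by move=> j /negPf ->; rewrite mul0r.
Qed.

Lemma gaussian_family_integrable2 n (X : 'I_n -> T -> R) i j : gaussian_family X ->
  P.-integrable setT (EFin \o (fun w => X i w * X j w)).
Proof.
move=> [GX _].
have mX k : measurable_fun setT (X k).
  by have [m [s [+ _]]] := GX (fun j => (j == k)%:R); rewrite lincomb_delta.
have iX k : P.-integrable setT (fun w => (X k w ^+ 2)%:E).
  have [m [s]] := GX (fun j => (j == k)%:R); rewrite lincomb_delta => h.
  exact: (gaussian_integrableX 1 h).
apply: (le_integrable measurableT _ _ (integrableD measurableT (iX i) (iX j))).
  exact/measurable_EFinP/measurable_funM.
move=> w _; rewrite /= lee_fin [leRHS]ger0_norm; last by rewrite addr_ge0// sqr_ge0.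
by rewrite ler_norml; have := sqr_ge0 (X i w - X j w); have := sqr_ge0 (X i w + X j w);
  have := sqr_ge0 (X i w);  have := sqr_ge0 (X j w); nra.
Qed.

(** Centring and second moments determine the two parameters left unspecified
in [gaussian_family]. *)
Lemma gaussian_family_lincomb n (X : 'I_n -> T -> R) a : gaussian_family X ->
  exists2 s, s ^+ 2 = \sum_i \sum_j a i * a j * \int[P]_w (X i w * X j w) &
    has_gaussian_law P 0 s (lincomb X a).
Proof.
move=> GX; have [lX cX] := GX.
have [m [s Hms]] := lX a.
have iX k : P.-integrable setT (EFin \o X k).
  have [m' [s']] := lX (fun j => (j == k)%:R); rewrite lincomb_delta => h.
  exact: (gaussian_integrable h).
have m0 : m = 0.
  apply: (gaussian_mean0 Hms).
  rewrite Rintegral_sum => [|i]; last by have := integrableZl measurableT (a i) (iX i).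
  by rewrite big1// => i _; rewrite RintegralZl// cX mulr0.
rewrite m0 in Hms; exists s => //; rewrite -(gaussian_variance Hms).
have E w : lincomb X a w ^+ 2 = \sum_i \sum_j a i * a j * (X i w * X j w).
  rewrite /lincomb expr2 big_distrl; apply: eq_bigr => i _ /=.
  by rewrite big_distrr; apply: eq_bigr => j _ /=; ring.
under eq_Rintegral do rewrite E.
have iij i j : P.-integrable setT (EFin \o (fun w => a i * a j * (X i w * X j w))).
  by have := integrableZl measurableT (a i * a j) (gaussian_family_integrable2 i j GX).
rewrite Rintegral_sum => [|i].
  apply: eq_bigr => i _; rewrite Rintegral_sum//; apply: eq_bigr => j _.
  by rewrite RintegralZl//; exact: gaussian_family_integrable2.
rewrite (_ : _ \o _ = (fun w => \sum_(j < n) (a i * a j * (X i w * X j w))%:E)%E).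
  by apply: integrable_sum => // j _; exact: iij.
by apply/funext => w /=; rewrite sumEFin.
Qed.

(** Equal covariances give equal variances to all linear combinations, hence
equal means to their cosines. *)
Lemma gaussian_family_orthant n (X Y : 'I_n -> T -> R) b :
  gaussian_family X -> gaussian_family Y ->
  (forall i j, \int[P]_w (X i w * X j w) = \int[P]_w (Y i w * Y j w)) ->
  P [set w | forall i, X i w < b i] = P [set w | forall i, Y i w < b i].
Proof.
move=> GX GY XY.
have mF (Z : 'I_n -> T -> R) i : gaussian_family Z -> measurable_fun setT (Z i).
  move=> [GZ _].
  by have [m [s [+ _]]] := GZ (fun j => (j == i)%:R); rewrite lincomb_delta.
apply: cramer_wold_orthant => [i|i|]; [exact: mF|exact: mF|].
move=> a c; under eq_Rintegral do rewrite mul1r; under [RHS]eq_Rintegral do rewrite mul1r.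
have [s sE Hs] := gaussian_family_lincomb a GX.
have [s' s'E Hs'] := gaussian_family_lincomb a GY.
apply: (gaussian_cos _ _ Hs Hs'); rewrite sE s'E.
by apply: eq_bigr => i _; apply: eq_bigr => j _; rewrite XY.
Qed.

End gaussian_families.

(** * Fractional Brownian motion *)

Section countable_orthants.
Context d (T : measurableType d) (R : realType) (P : probability T R).

(** The orthants of finitely many coordinates with bounds relaxed by 1/(n+1)
decrease to the closed orthant of the whole sequence. *)
Lemma countable_orthant (U V : nat -> T -> R) :
  (forall i, measurable_fun setT (U i)) -> (forall i, measurable_fun setT (V i)) ->
  (forall n (b : 'I_n -> R), P [set w | forall i : 'I_n, U i w < b i] =
                             P [set w | forall i : 'I_n, V i w < b i]) ->
  forall b : nat -> R, P [set w | forall i, U i w <= b i] =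
                       P [set w | forall i, V i w <= b i].
Proof.
move=> mU mV UV b.
pose A (Z : nat -> T -> R) n := [set w | forall i : 'I_n, Z i w < b i + n.+1%:R^-1].
have mA (Z : nat -> T -> R) n : (forall i, measurable_fun setT (Z i)) -> measurable (A Z n).
  by move=> mZ; exact: (@measurable_orthant _ _ _ n (fun i => Z i) (fun i => b i + n.+1%:R^-1)).
have AE (Z : nat -> T -> R) : [set w | forall i, Z i w <= b i] = \bigcap_n A Z n.
  apply/seteqP; split=> [w /= h n _ i|w h i].
    by rewrite /= (le_lt_trans (h i))// ltrDl invr_gt0.
  apply/ler_addgt0Pr => e e0.
  have [n _ nP] := near_infty_natSinv_lt (PosNum e0).
  pose m := maxn n i.+1.
  have im : (i < m)%N by rewrite /m leq_max leqnn orbT.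
  have := h m I (Ordinal im) => /= /ltW/le_trans; apply.
  by rewrite lerD2l ltW// (nP m)//= /m leq_maxl.
have cA (Z : nat -> T -> R) : (forall i, measurable_fun setT (Z i)) ->
   P (A Z n) @[n --> \oo] --> P [set w | forall i, Z i w <= b i].
  move=> mZ; rewrite AE; apply: (@nonincreasing_cvg_mu _ _ _ P (A Z)).
  - by rewrite -ge0_fin_numE// fin_num_measure//; exact: mA.
  - by move=> n; exact: mA.
  - by apply: bigcapT_measurable => n; exact: mA.
  - move=> n m nm; apply/subsetPset => w /= h i.
    rewrite (lt_le_trans (h (widen_ord nm i)))//= lerD2l.
    by rewrite lef_pV2 ?posrE// ler_nat ltnS.
apply: (cvg_unique _ (cA U mU)) => //.
rewrite (_ : (fun n => P (A U n)) = (fun n => P (A V n))); first exact: cA.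
by apply/funext => n; exact: (UV n (fun i => b i + n.+1%:R^-1)).
Qed.

End countable_orthants.

Section fBm.
Context d (T : measurableType d) (R : realType) (P : probability T R).
Variables (H : R) (W : R -> {RV P >-> R}).
Hypotheses (H_range : 2^-1 <= H < 1) (W_fBm : is_fBm H W).

Definition fBm_cov (s t : R) : R :=
  2^-1 * (t `^ (2 * H) + s `^ (2 * H) - `|t - s| `^ (2 * H)).

Let H0 : 0 < H. Proof. by case/andP: H_range => h _; lra. Qed.

Lemma fBm_mean t : 0 <= t -> \int[P]_w W t w = 0.
Proof.
move=> t0; case: W_fBm => _ _ _ /(_ t t0) + _.
by rewrite unlock /Rintegral => ->.
Qed.

Lemma fBm_family n (t : 'I_n -> R) : (forall i, 0 <= t i) ->
  gaussian_family P (fun i => W (t i) : T -> R).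
Proof.
move=> t0; split; last by move=> i; exact: fBm_mean.
move=> a; case: W_fBm => _ _ /(_ n t a t0)[m [s Hms]] _ _; exists m, s; split => //.
by apply: measurable_lincomb => i.
Qed.

Lemma fBm_integrable2 s t : 0 <= s -> 0 <= t ->
  P.-integrable setT (EFin \o (fun w => W s w * W t w)).
Proof.
move=> s0 t0.
have := @gaussian_family_integrable2 _ _ _ P 2 _ ord0 (lift ord0 ord0)
  (@fBm_family 2 (fun i => if i == ord0 then s else t) _).
by rewrite eqxx /=; apply => i; case: ifP.
Qed.

Lemma fBm_covE s t : 0 <= s -> 0 <= t ->
  \int[P]_w (W s w * W t w) = fBm_cov s t.
Proof.
move=> s0 t0; case: W_fBm => _ _ _ EW /(_ s t s0 t0).
rewrite unlock (EW s s0) (EW t t0) /= unlock /Rintegral => E.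
rewrite (eq_integral (fun w => ((W s w - 0) * (W t w - 0))%:E)); last first.
  by move=> w _; rewrite !subr0.
by move: E; rewrite /fBm_cov; move=> E; rewrite [X in fine X]E.
Qed.

Lemma fBm_covxx s : 0 <= s -> fBm_cov s s = s `^ (2 * H).
Proof.
move=> s0; rewrite /fBm_cov subrr normr0 powR0 ?subr0; last by rewrite gt_eqF// mulr_gt0.
by field.
Qed.

Lemma fBm_law t : 0 <= t -> exists2 s, s ^+ 2 = t `^ (2 * H) &
  has_gaussian_law P 0 s (W t).
Proof.
move=> t0; have GF := @fBm_family 1 (fun=> t) (fun=> t0).
have [s sE Hs] := gaussian_family_lincomb (fun j => (j == ord0)%:R) GF.
exists s; last by move: Hs; rewrite lincomb_delta.
by rewrite sE !big_ord1 /= !mul1r fBm_covE// fBm_covxx.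
Qed.

(** The cross terms cancel and leave |b - a|^(2 H): increments are stationary. *)
Lemma fBm_incr_law a b : 0 <= a -> 0 <= b ->
  exists2 s, s ^+ 2 = `|b - a| `^ (2 * H) &
  has_gaussian_law P 0 s (fun w => W b w - W a w).
Proof.
move=> a0 b0.
have GF := @fBm_family 2 (fun i => if i == ord0 then b else a) (fun i =>
  if i == ord0 as x return 0 <= (if x then b else a) then b0 else a0).
have [s sE Hs] := gaussian_family_lincomb (fun j => if j == ord0 then 1 else -1) GF.
exists s.
  rewrite sE !big_ord_recl !big_ord0 /= !addr0 !fBm_covE//.
  by rewrite !fBm_covxx// /fBm_cov (distrC a b); field.
move: Hs; rewrite (_ : lincomb _ _ = (fun w => W b w - W a w))//.
by apply/funext => w; rewrite /lincomb !big_ord_recl big_ord0 /= addr0 mul1r mulN1r.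
Qed.

Lemma fBm_incr_moment k a b : 0 <= a -> 0 <= b ->
  (\int[P]_w ((W b w - W a w) ^+ k.*2)%:E <=
   (gaussian_moment_cst R k * (`|b - a| `^ (2 * H)) ^+ k)%:E)%E.
Proof.
move=> a0 b0; have [s sE Hs] := fBm_incr_law a0 b0.
by rewrite (le_trans (gaussian_moment_le k Hs))// -mul2n exprM sE.
Qed.

(** Both families are Gaussian and centred, and the covariance is homogeneous
of degree 2 H. *)
Lemma fBm_scaling n (r : 'I_n -> R) c b : 0 < c -> (forall i, 0 <= r i) ->
  P [set w | forall i, W (c * r i) w < b i] =
  P [set w | forall i, c `^ H * W (r i) w < b i].
Proof.
move=> c0 r0.
have cr0 i : 0 <= c * r i by rewrite mulr_ge0// ltW.
have GF := fBm_family r0.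
apply: (gaussian_family_orthant (X := fun i => W (c * r i)) (Y := fun i w => c `^ H * W (r i) w)).
- exact: fBm_family.
- split.
    move=> a; have [m [s [mV HV]]] := GF.1 (fun i => a i * c `^ H).
    exists m, s; rewrite (_ : lincomb _ a = lincomb (fun i => W (r i) : T -> R) (fun i => a i * c `^ H))//.
    by apply/funext => w; apply: eq_bigr => i _; rewrite mulrA.
  move=> i; rewrite RintegralZl//; first by rewrite GF.2 mulr0.
  have [s _ /gaussian_integrable] := fBm_law (r0 i); exact.
- move=> i j; rewrite fBm_covE//.
  transitivity (\int[P]_w (c `^ (2 * H) * (W (r i) w * W (r j) w))).
    rewrite RintegralZl//; last exact: fBm_integrable2.
    rewrite fBm_covE// /fBm_cov -mulrBr normrM (gtr0_norm c0).
    rewrite (powRM _ (ltW c0) (r0 j)) (powRM _ (ltW c0) (r0 i)).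
    by rewrite (powRM _ (ltW c0) (normr_ge0 _)); ring.
  apply: eq_Rintegral => w _.
  have -> : c `^ (2 * H) = c `^ H * c `^ H.
    by rewrite mulrC powRrM powR_mulrn ?powR_ge0// expr2.
  by ring.
Qed.

(** The differences W t - W (t - r i) are linear combinations of the values at
t and at the points t - r i, with the same covariances as the W (r i) because
increments are stationary. *)
Lemma fBm_reversal n (r : 'I_n -> R) t b : (forall i, 0 <= r i <= t) ->
  P [set w | forall i, W t w - W (t - r i) w < b i] =
  P [set w | forall i, W (r i) w < b i].
Proof.
move=> rt.
have r0 i : 0 <= r i by case/andP: (rt i).
have tr0 i : 0 <= t - r i by rewrite subr_ge0; case/andP: (rt i).
case: n r b rt r0 tr0 => [|n] r b rt r0 tr0.
  by congr (P _); apply/seteqP; split=> w /= _ [].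
have t0 : 0 <= t by have /andP[/le_trans h /h] := rt ord0.
have GF := fBm_family r0.
(* the points t, t - r 0, t - r 1, and so on *)
pose t' (j : 'I_n.+2) := if unlift ord0 j is Some i then t - r i else t.
have t'0 j : 0 <= t' j by rewrite /t'; case: unliftP.
have GF' := fBm_family t'0.
apply: (gaussian_family_orthant (X := fun i w => W t w - W (t - r i) w) (Y := fun i => W (r i))) => //.
- split.
    move=> a.
    pose a' (j : 'I_n.+2) := if unlift ord0 j is Some i then - a i else \sum_i a i.
    have [m [s [mV HV]]] := GF'.1 a'.
    exists m, s; rewrite (_ : lincomb _ a = lincomb (fun i => W (t' i) : T -> R) a')//.
    apply/funext => w; rewrite /lincomb [RHS]big_ord_recl /a' /t' unlift_none.
    rewrite [X in _ = _ + X](eq_bigr (fun i => - (a i * W (t - r i) w))); last first.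
      by move=> i _; rewrite liftK mulNr.
    by rewrite mulr_suml sumrN -sumrB; apply: eq_bigr => i _; rewrite mulrBr.
  move=> i; have [s _ Hs] := fBm_incr_law (tr0 i) t0.
  rewrite RintegralB//; last 2 first.
  + by have [? _ /gaussian_integrable] := fBm_law t0; exact.
  + by have [? _ /gaussian_integrable] := fBm_law (tr0 i); exact.
  by rewrite !fBm_mean// subr0.
- move=> i j; rewrite fBm_covE//.
  transitivity (\int[P]_w ((W t w * W t w - W t w * W (t - r j) w)
     - (W (t - r i) w * W t w - W (t - r i) w * W (t - r j) w))).
    by apply: eq_Rintegral => w _; ring.
  rewrite RintegralB//; last 2 first.
  + by have := integrableB measurableT (fBm_integrable2 t0 t0) (fBm_integrable2 t0 (tr0 j)).
  + by have := integrableB measurableT (fBm_integrable2 (tr0 i) t0) (fBm_integrable2 (tr0 i) (tr0 j)).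
  rewrite !RintegralB//; try exact: fBm_integrable2.
  rewrite !fBm_covE// fBm_covxx// /fBm_cov.
  have -> : t - r j - t = - r j by ring.
  have -> : t - (t - r i) = r i by ring.
  have -> : t - r j - (t - r i) = - (r j - r i) by ring.
  rewrite !normrN (ger0_norm (r0 j)) (ger0_norm (r0 i)).
  by field.
Qed.

(** If W 1 stayed below 2, its exponential moment at 5 would be at most
exp(10), whereas it is exp(25 / 2). *)
Lemma fBm_tail : (0 < P [set w | (2 <= W 1 w)%R])%E.
Proof.
have [s s1 Hs] := fBm_law ler01; rewrite powR1 in s1.
have m2 : measurable [set w | (2 <= W 1 w)%R] by exact: measurable_superlevel.
rewrite lt0e measure_ge0 andbT; apply/negP => /eqP P0.
have := gaussian_mgf 5 Hs; rewrite s1 mul0r add0r mul1r => E.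
suff : (\int[P]_w (expR (5 * W 1 w))%:E <= (expR 10)%:E)%E.
  by rewrite E lee_fin ler_expR; lra.
rewrite (ae_eq_integral (fun w => (expR (5 * Num.min (W 1 w) 2))%:E))//.
- apply: (@le_trans _ _ (\int[P]_w (expR 10)%:E)%E).
    apply: ge0_le_integral => //.
    + apply/measurable_EFinP; apply: measurableT_comp => //.
      by apply: measurable_funM => //; exact: measurable_minr.
    + move=> w _; rewrite lee_fin ler_expR.
      rewrite (_ : 10 = 5 * 2); last by ring.
      by rewrite ler_wpM2l// ge_min lexx orbT.
  by rewrite integral_cst//= probability_setT mule1.
- by apply/measurable_EFinP; apply: measurableT_comp => //; exact: measurable_funM.
- apply/measurable_EFinP; apply: measurableT_comp => //.
  by apply: measurable_funM => //; exact: measurable_minr.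
- exists [set w | (2 <= W 1 w)%R]; split => // w /= /not_implyP[_ h].
  rewrite leNgt; apply/negP => h2; apply: h.
  by rewrite min_l// ltW.
Qed.

End fBm.

(** * Moments of the drifted path *)

Section chaining.
Context {R : realType}.
Implicit Types (f : R -> R) (p : nat -> R).

Lemma within_cvg (A : set R) f p s : {within A, continuous f} ->
  A s -> (forall n, A (p n)) -> p n @[n --> \oo] --> s ->
  f (p n) @[n --> \oo] --> f s.
Proof.
move=> /subspace_continuousP cf As Ap ps.
apply: cvg_comp (cf s As) => U /= AU.
have h : nbhs \oo (p @^-1` (fun x => A x -> U x)) := ps _ AU.
by apply: filterS h => n /= /(_ (Ap n)).
Qed.

Definition dyadic_floor (n : nat) (y : R) : R := (Num.trunc (2 ^+ n * y))%:R / 2 ^+ n.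

Lemma dyadic_floor_ge0 n y : 0 <= dyadic_floor n y.
Proof. by rewrite /dyadic_floor divr_ge0// exprn_ge0. Qed.

Lemma dyadic_floor_le n y : 0 <= y -> dyadic_floor n y <= y.
Proof.
move=> y0; have p : 0 < 2 ^+ n :> R by rewrite exprn_gt0.
have /andP[h _] := @truncn_itv R (2 ^+ n * y) (mulr_ge0 (ltW p) y0).
by rewrite /dyadic_floor ler_pdivrMr// (mulrC y).
Qed.

Lemma cvg_dyadic_floor y : 0 <= y -> dyadic_floor n y @[n --> \oo] --> y.
Proof.
move=> y0.
apply: (@squeeze_cvgr _ _ _ _ (fun n => y - 2^-1 ^+ n) (cst y)).
- apply: nearW => n; rewrite dyadic_floor_le// andbT.
  have p : 0 < 2 ^+ n :> R by rewrite exprn_gt0.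
  have /andP[_ h] := @truncn_itv R (2 ^+ n * y) (mulr_ge0 (ltW p) y0).
  rewrite ler_pdivlMr// (mulrC (_ - _)) mulrBr exprVn divff ?gt_eqF//.
  by rewrite lerBlDr natr1 ltW.
- rewrite -[X in _ --> X]subr0; apply: cvgB; first exact: cvg_cst.
  by apply: cvg_expr; rewrite gtr0_norm// invf_lt1// ltr1n.
- exact: cvg_cst.
Qed.

(** Join 0 to [s] by the successive dyadic approximations of s / L from below:
at each level the path moves by at most one dyadic increment, and the
increments add up to a geometric series. *)
Lemma dyadic_chaining f (L B rho : R) :
  {within `[0, +oo[, continuous f} -> f 0 = 0 -> 0 < L -> 0 <= B -> 0 <= rho < 1 ->
  (forall n l, (l < 2 ^ n)%N ->
     `|f (L * (l.+1%:R / 2 ^+ n)) - f (L * (l%:R / 2 ^+ n))| <= B * rho ^+ n) ->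
  forall s, 0 <= s < L -> `|f s| <= B / (1 - rho).
Proof.
move=> cf f0 L0 B0 /andP[r0 r1] Hf s /andP[s0 sL].
pose y := s / L.
have y0 : 0 <= y by rewrite divr_ge0// ltW.
have y1 : y < 1 by rewrite ltr_pdivrMr// mul1r.
pose a n := Num.trunc (2 ^+ n * y).
have a_itv n : (a n)%:R <= 2 ^+ n * y < (a n).+1%:R.
  by apply: truncn_itv; rewrite mulr_ge0// exprn_ge0.
pose p n := L * ((a n)%:R / 2 ^+ n).
have pow0 n : 0 < 2 ^+ n :> R by rewrite exprn_gt0.
have a_lt n : (a n < 2 ^ n)%N.
  have /andP[h _] := a_itv n; rewrite -(ltr_nat R) natrX.
  by rewrite (le_lt_trans h)// -[ltRHS]mulr1 ltr_pM2l.
have aS n : a n.+1 = (a n).*2 \/ a n.+1 = (a n).*2.+1.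
  have /andP[h1 h2] := a_itv n; have /andP[h3 h4] := a_itv n.+1.
  have e : 2 ^+ n.+1 * y = 2 * (2 ^+ n * y) by rewrite exprS mulrA.
  have k1 : ((a n).*2 < (a n.+1).+1)%N.
    rewrite -(ltr_nat R) (le_lt_trans _ h4)// e -mul2n natrM ler_pM2l//.
  have k2 : (a n.+1 < (a n).+1.*2)%N.
    rewrite -(ltr_nat R) (le_lt_trans h3)// e -mul2n natrM ltr_pM2l//.
  move: k1 k2; rewrite doubleS !ltnS leq_eqVlt => /predU1P[-> _|k1 k2].
    by left.
  by right; apply/eqP; rewrite eqn_leq k2.
have bnd n : `|f (p n)| <= B * (1 - rho ^+ n.+1) / (1 - rho).
  elim: n => [|n IH].
    have a00 : a 0%N = 0%N by have := a_lt 0%N; rewrite expn0; case: (a 0%N).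
    rewrite /p a00 mul0r mulr0 f0 normr0 expr1 divr_ge0// ?mulr_ge0// subr_ge0 ltW//.
  have step : `|f (p n.+1) - f (p n)| <= B * rho ^+ n.+1.
    have pE : p n = L * (((a n).*2)%:R / 2 ^+ n.+1).
      by rewrite /p -mul2n natrM exprS; congr (_ * _); field; rewrite gt_eqF.
    rewrite pE /p; case: (aS n) => ->.
      by rewrite subrr normr0 mulr_ge0// exprn_ge0.
    by apply: Hf; rewrite expnS mul2n ltn_double.
  rewrite -(subrK (f (p n)) (f (p n.+1))) (le_trans (ler_normD _ _))//.
  rewrite (le_trans (lerD step IH))// le_eqVlt; apply/orP; left; apply/eqP.
  by rewrite (exprS rho n.+1); field; rewrite gt_eqF// subr_gt0.
have ps : p n @[n --> \oo] --> s.
  have -> : s = L * y by rewrite /y mulrC divfK// gt_eqF.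
  by apply: cvgMr; exact: (cvg_dyadic_floor y0).
have A0 x : 0 <= x -> `[0, +oo[%classic x by rewrite /= in_itv/= andbT.
have cfp : f (p n) @[n --> \oo] --> f s.
  apply: (within_cvg cf) => //; first exact: A0.
  by move=> n; apply: A0; rewrite mulr_ge0 ?divr_ge0 ?(ltW L0) ?(ltW (pow0 n)).
have cn : `|f (p n)| @[n --> \oo] --> `|f s| by exact: cvg_norm.
rewrite -(cvg_lim _ cn)//; apply: limr_le; first by apply: cvgP; exact: cn.
apply: nearW => n; rewrite (le_trans (bnd n))// ler_pM2r ?invr_gt0 ?subr_gt0//.
by rewrite ler_piMr// gerBl exprn_ge0.
Qed.

Lemma geometric_eseries (a z : R) : 0 <= z < 1 ->
  (\sum_(0 <= n <oo) (a * z ^+ n)%:E = (a / (1 - z))%:E)%E.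
Proof.
move=> /andP[z0 z1].
have := @cvg_geometric_series R a z; rewrite ger0_norm// => /(_ z1) h.
apply/cvg_lim => //.
rewrite (_ : (fun n => _) = EFin \o series (geometric a z)).
  by apply/cvg_EFin; [exact: nearW|exact: h].
by apply/funext => n; rewrite /= /series/= sumEFin.
Qed.

Lemma dyadic_block (s : R) : 1 <= s -> exists j : nat, s < 2 ^+ j <= 2 * s.
Proof.
move=> s1.
have ex : exists n, s < 2 ^+ n.
  exists (Num.trunc s).+1; have /andP[_ h] := truncn_itv (le_trans ler01 s1).
  rewrite (lt_trans h)// -natrX ltr_nat.
  exact: ltn_expl.
case: (ex_minnP ex) => -[|j] h hmin; first by move: h; rewrite expr0 ltNge s1.
exists j.+1; rewrite h exprS ler_pM2l// leNgt; apply/negP => /hmin.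
by rewrite ltnn.
Qed.

(** [dyadic_chaining] with [B] a root of order [k.*2]: bounds on even powers of
the increments are what an integrable sum of such powers provides.  The ratio
9/10 accounts for the factor 10 = 1 / (1 - 9/10). *)
Lemma even_dyadic_bound f (k th : nat) (y : R) : (0 < k)%N -> 0 <= y ->
  {within `[0, +oo[, continuous f} -> f 0 = 0 ->
  (forall j n l, (l < 2 ^ n)%N ->
     (f (2 ^+ j * (l.+1%:R / 2 ^+ n)) - f (2 ^+ j * (l%:R / 2 ^+ n))) ^+ k.*2 <=
     y * (2 ^+ th) ^+ j * (9 / 10) ^+ (k.*2 * n)) ->
  forall j s, 0 <= s < 2 ^+ j -> f s ^+ k.*2 <= 10 ^+ k.*2 * (y * (2 ^+ th) ^+ j).
Proof.
move=> k0 y0 cf f0 Hf j s sj.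
have [q qk] : exists q, q = k.*2 by exists k.*2.
rewrite -qk in Hf *.
have q0 : (0 < q)%N by rewrite qk double_gt0.
have p2 : 0 <= (2 ^+ th) ^+ j :> R by rewrite -exprM exprn_ge0.
have [z zE] : exists z, z = y * (2 ^+ th) ^+ j by eexists.
have z0 : 0 <= z by rewrite zE mulr_ge0.
pose B := z `^ (q%:R^-1).
have BE : B ^+ q = z.
  by rewrite -powR_mulrn ?powR_ge0// -powRrM mulVf ?pnatr_eq0 -?lt0n// powRr1.
have B0 : 0 <= B by exact: powR_ge0.
have evq x : `|x| ^+ q = x ^+ q :> R.
  by rewrite qk -mul2n !exprM -normrX ger0_norm ?sqr_ge0.
have rho0 : 0 <= 9 / 10 :> R by lra.
have p2j : 0 < 2 ^+ j :> R by rewrite exprn_gt0.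
have chain := @dyadic_chaining f (2 ^+ j) B (9 / 10) cf f0 p2j B0.
have : `|f s| <= B / (1 - 9 / 10).
  apply: chain => //; first by lra.
  move=> n l ln.
  rewrite -(@ler_pXn2r _ q)// ?nnegrE ?mulr_ge0 ?exprn_ge0//.
  rewrite evq exprMn BE -exprM mulnC zE; exact: Hf.
have -> : B / (1 - 9 / 10) = 10 * B by field.
by move=> h; rewrite -evq -zE -BE -exprMn lerXn2r// nnegrE mulr_ge0.
Qed.

(** On [0, 1] the drift is ignored.  On a block 2^(j-1) <= s < 2^j the path can
only exceed u s if f s / (u s) >= 1, and multiplying f s ^ m by the power [th]
of this ratio produces the exponent [k.*2] that the dyadic bound controls; the
factor (2^th)^j of that bound is then absorbed by (u s)^th. *)
Lemma drift_bound f (k th m : nat) (y u : R) : (0 < k)%N -> 0 <= y -> 0 < u ->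
  (0 < m)%N -> k.*2 = (m + th)%N ->
  {within `[0, +oo[, continuous f} -> f 0 = 0 ->
  (forall j n l, (l < 2 ^ n)%N ->
     (f (2 ^+ j * (l.+1%:R / 2 ^+ n)) - f (2 ^+ j * (l%:R / 2 ^+ n))) ^+ k.*2 <=
     y * (2 ^+ th) ^+ j * (9 / 10) ^+ (k.*2 * n)) ->
  forall s, 0 <= s ->
    Num.max 0 (f s - u * s) ^+ m <= 1 + 10 ^+ k.*2 * (1 + (2 / u) ^+ th) * y.
Proof.
move=> k0 y0 u0 m0 kE cf f0 Hf s s0.
have block := even_dyadic_bound k0 y0 cf f0 Hf.
move: block kE; move: k.*2 => q block kE.
have c0 : 0 <= (2 / u) ^+ th by rewrite exprn_ge0// divr_ge0// ltW.
have t0 : 0 <= 10 ^+ q :> R by rewrite exprn_ge0.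
have A0 : 0 <= 10 ^+ q * (1 + (2 / u) ^+ th) by rewrite mulr_ge0// addr_ge0.
have [Ws|Ws] := leP (f s - u * s) 0.
  by rewrite expr0n gtn_eqF//= addr_ge0// mulr_ge0.
have us0 : 0 <= u * s by rewrite mulr_ge0// ltW.
have W_gt0 : 0 < f s by lra.
apply: (@le_trans _ _ (f s ^+ m)).
  by apply: lerXn2r; rewrite ?nnegrE; lra.
have [s1|s1] := ltP s 1.
  have := block 0%N s; rewrite expr0 s0 s1 expr0 mulr1 => /(_ isT) h.
  have : f s ^+ m <= 1 + f s ^+ q.
    have [W1|W1] := leP (f s) 1.
      apply: (@le_trans _ _ 1); first by apply: exprn_ile1 => //; exact: ltW.
      by rewrite lerDl exprn_ge0// ltW.
    rewrite (@le_trans _ _ (f s ^+ q))// ?lerDr//.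
    by rewrite ler_weXn2l// ?(ltW W1)// kE leq_addr.
  move=> /le_trans; apply; rewrite lerD2l (le_trans h)// -mulrA ler_wpM2l//.
  by rewrite ler_peMl// lerDl.
have [j /andP[j1 j2]] := dyadic_block s1.
have := block j s; rewrite s0 j1 => /(_ isT) h.
have us_gt0 : 0 < u * s by rewrite mulr_gt0//; lra.
apply: (@le_trans _ _ (f s ^+ q / (u * s) ^+ th)).
  rewrite ler_pdivlMr ?exprn_gt0// kE exprD ler_wpM2l ?exprn_ge0 ?(ltW W_gt0)//.
  by rewrite lerXn2r ?nnegrE ?(ltW W_gt0) ?(ltW us_gt0)//; lra.
have p0 : 0 < (u * s) ^+ th by rewrite exprn_gt0.
rewrite ler_pdivrMr// (le_trans h)//.
have h1 : (2 ^+ th) ^+ j <= (2 * s) ^+ th :> R.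
  by rewrite -exprM mulnC exprM lerXn2r ?nnegrE ?exprn_ge0// mulr_ge0.
apply: (@le_trans _ _ (10 ^+ q * (y * (2 * s) ^+ th))).
  by rewrite ler_wpM2l// ler_wpM2l.
have -> : (2 * s) ^+ th = (2 / u) ^+ th * (u * s) ^+ th.
  by rewrite -exprMn; congr (_ ^+ _); field; rewrite gt_eqF.
move: (10 ^+ q) ((2 / u) ^+ th) ((u * s) ^+ th) t0 c0 p0 => t c p t0 c0 p0.
have -> : t * (y * (c * p)) = (t * c * y) * p by ring.
rewrite ler_wpM2r ?(ltW p0)//.
have : 0 <= t * y by rewrite mulr_ge0.
by nra.
Qed.

End chaining.

Section fBm_moments.
Context d (T : measurableType d) (R : realType) (P : probability T R).
Variables (H : R) (W : R -> {RV P >-> R}).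
Hypotheses (H_range : 2^-1 <= H < 1) (W_fBm : is_fBm H W).

(** The dominating function is affine in the sum over [j] and [n] of the
increments of level [n] on [0, 2^j], raised to the power [k.*2] and weighted so
that [drift_bound] applies with y equal to this sum.  Its mean is a double
geometric series: the ratio in [j] is 2^(2 H k - th), below 1 as soon as
m < 2 k (1 - H), and the ratio in [n] is 2 (50/81)^k, because there are 2^n
increments, each of mean at most a multiple of 2^(-n k), and the weight
contributes (10/9)^(2 k n). *)
Lemma fBm_drift_moment (u : R) (m : nat) : 0 < u -> (0 < m)%N ->
  exists D : T -> \bar R, [/\ measurable_fun setT D, (forall w, (1 <= D w)%E),
    (\int[P]_w D w < +oo)%E &
    forall w s, 0 <= s -> (((Num.max 0 (W s w - u * s)) ^+ m)%:E <= D w)%E].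
Proof.
move=> u0 m0; have /andP[H2 H1] := H_range.
have [cW W0 _ _ _] := W_fBm.
(* the exponent: al < 1 needs m < 2 k (1 - H), and be < 1 needs k >= 2 *)
have [k [k2 kH]] : exists k, (2 <= k)%N /\ m%:R < (k.*2)%:R * (1 - H).
  exists (Num.trunc (m%:R / (1 - H))).+2; split=> //.
  rewrite -ltr_pdivrMr ?subr_gt0//.
  have /andP[_ h] := @truncn_itv R (m%:R / (1 - H)) ltac:(by rewrite divr_ge0// subr_ge0 ltW).
  by rewrite (lt_le_trans h)// ler_nat -addnn (leq_trans (leqnSn _))// leq_addr.
pose q := k.*2; pose th := (q - m)%N.
have mq : (m < q)%N.
  rewrite -(ltr_nat R) (lt_le_trans kH)// ler_piMr//; lra.
have qth : q%:R = m%:R + th%:R :> R by rewrite -natrD /th subnKC// ltnW.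
(* an increment over a time 2^j 2^-n has variance c^j c^-n, and c >= 2 since H >= 1/2 *)
have [c cE] : exists c : R, c = 2 `^ (2 * H) by eexists.
have c2 : 2 <= c.
  by rewrite cE -[leLHS]powRr1//; apply: ler_powR; lra.
have cgt0 : 0 < c by exact: lt_le_trans c2.
have cn2 n : c ^- n <= 2 ^- n.
  by rewrite lef_pV2 ?posrE ?exprn_gt0//; apply: lerXn2r => //; exact: ltW.
have cXn j : (2 ^+ j : R) `^ (2 * H) = c ^+ j.
  by rewrite -!powR_mulrn ?(ltW cgt0)// cE -!powRrM mulrC.
have cVn n : (2 ^- n : R) `^ (2 * H) = c ^- n.
  by rewrite -!powR_invn ?(ltW cgt0)// cE -!powRrM mulrC.
(* [al] and [be] are the ratios of the geometric series in [j] and in [n] *)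
pose al := c ^+ k / 2 ^+ th.
have al01 : 0 <= al < 1.
  rewrite divr_ge0 ?exprn_ge0 ?(ltW cgt0)//= ltr_pdivrMr ?exprn_gt0// mul1r.
  rewrite -powR_mulrn ?(ltW cgt0)// cE -powRrM -[ltRHS]powR_mulrn//.
  rewrite /powR pnatr_eq0/= ltr_expR ltr_pM2r ?ln_gt0// ?ltr1n//.
  have -> : 2 * H * k%:R = q%:R * H by rewrite /q -mul2n natrM; ring.
  by move: kH; rewrite -/q mulrBr mulr1; lra.
pose rho : R := 9 / 10.
have rho0 : 0 < rho by rewrite /rho; lra.
pose be : R := 2 * (50 / 81) ^+ k.
have be01 : 0 <= be < 1.
  rewrite mulr_ge0 ?exprn_ge0//=; try lra.
  rewrite /be -(subnK k2) exprD.
  have h : (50 / 81 : R) ^+ (k - 2) <= 1 by apply: exprn_ile1; lra.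
  have h0 : 0 <= (50 / 81 : R) ^+ (k - 2) by apply: exprn_ge0; lra.
  nra.
pose M := gaussian_moment_cst R k.
have M0 : 0 <= M by exact: gaussian_moment_cst_ge0.
pose pt j n l : R := 2 ^+ j * (l%:R / 2 ^+ n).
have pt0 j n l : 0 <= pt j n l by rewrite mulr_ge0 ?exprn_ge0// divr_ge0// exprn_ge0.
pose De j n l w := (W (pt j n l.+1) w - W (pt j n l) w) ^+ q.
have De0 j n l w : 0 <= De j n l w by rewrite /De /q -mul2n exprM exprn_ge0// sqr_ge0.
pose wt j n : R := (2 ^+ th) ^- j * rho ^- (q * n).
have wt0 j n : 0 < wt j n by rewrite mulr_gt0// invr_gt0 !exprn_gt0.
pose g j n w := (wt j n * \sum_(l < 2 ^ n) De j n l w)%:E.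
have g0 j n w : (0 <= g j n w)%E by rewrite lee_fin mulr_ge0 ?(ltW (wt0 _ _))// sumr_ge0.
have mDe j n l : measurable_fun setT (De j n l).
  by apply: measurable_funX; exact: measurable_funB.
have mg j n : measurable_fun setT (g j n).
  by apply/measurable_EFinP; apply: measurable_funM => //; exact: measurable_sum.
pose S j w := (\sum_(0 <= n <oo) g j n w)%E.
have mS j : measurable_fun setT (S j).
  by apply: ge0_emeasurable_sum => // n _; exact: mg.
have S0 j w : (0 <= S j w)%E by exact: nneseries_ge0.
pose Y w := (\sum_(0 <= j <oo) S j w)%E.
have mY : measurable_fun setT Y by apply: ge0_emeasurable_sum => // j _; exact: mS.
have Y0 w : (0 <= Y w)%E by exact: nneseries_ge0.
have intg j n : (\int[P]_w g j n w <= (M * al ^+ j * be ^+ n)%:E)%E.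
  rewrite /g; under eq_integral do rewrite EFinM.
  rewrite ge0_integralZl//; last 3 first.
  - by apply/measurable_EFinP; exact: measurable_sum.
  - by move=> w _; rewrite lee_fin sumr_ge0.
  - by rewrite lee_fin ltW.
  under eq_integral do rewrite -sumEFin.
  rewrite ge0_integral_sum//; last 2 first.
  - by move=> l; apply/measurable_EFinP; exact: mDe.
  - by move=> l w _; rewrite lee_fin De0.
  apply: (@le_trans _ _ ((wt j n)%:E * \sum_(l < 2 ^ n) (M * ((c ^+ j / 2 ^+ n) ^+ k))%:E)%E).
    rewrite lee_wpmul2l ?lee_fin ?(ltW (wt0 _ _))//.
    apply: lee_sum => l _.
    apply: le_trans (fBm_incr_moment H_range W_fBm k (pt0 j n l) (pt0 j n l.+1)) _.
    rewrite lee_fin.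
    rewrite ler_wpM2l// lerXn2r ?nnegrE ?powR_ge0 ?divr_ge0 ?exprn_ge0 ?(ltW cgt0)//.
    have -> : pt j n l.+1 - pt j n l = 2 ^+ j * 2 ^- n.
      by rewrite /pt -mulrBr -mulrBl -natrB// subSnn mul1r.
    rewrite ger0_norm ?mulr_ge0 ?invr_ge0 ?exprn_ge0//.
    rewrite powRM ?invr_ge0 ?exprn_ge0//.
    rewrite cXn cVn ler_wpM2l ?exprn_ge0 ?(ltW cgt0)//.
  rewrite sumEFin -EFinM lee_fin big_const_ord iter_addr_0 -[(_ *+ (2 ^ n))%R]mulr_natl.
  rewrite le_eqVlt; apply/orP; left; apply/eqP.
  rewrite natrX expr_div_n (exprAC c j k) (exprAC 2 n k) /wt /al /be.
  have -> : rho ^+ (q * n) = ((rho ^+ 2) ^+ k) ^+ n by rewrite /q -mul2n !exprM.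
  have -> : (50 / 81 : R) ^+ k = ((rho ^+ 2) ^+ k)^-1 * (2 ^+ k)^-1.
    by rewrite -!exprVn -exprMn; congr (_ ^+ _); rewrite /rho; field.
  have : (rho ^+ 2) ^+ k != 0 by rewrite !expf_neq0// gt_eqF.
  have : 2 ^+ k != 0 :> R by rewrite expf_neq0.
  have : 2 ^+ th != 0 :> R by rewrite expf_neq0.
  move: (rho ^+ 2 ^+ k) (2 ^+ k) (2 ^+ th) (c ^+ k) => r0 z0 t0 a0 tn zn rn.
  rewrite !exprMn !exprVn; ring.
have intY : (\int[P]_w Y w < +oo)%E.
  rewrite integral_nneseries//.
  apply: (@le_lt_trans _ _ (\sum_(0 <= j <oo) (M / (1 - be) * al ^+ j)%:E)%E).
    apply: lee_nneseries => [j _ _|j _]; first exact: integral_ge0.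
    rewrite integral_nneseries//.
    have -> : (M / (1 - be) * al ^+ j) = (M * al ^+ j) / (1 - be) by rewrite mulrAC.
    rewrite -geometric_eseries//; apply: lee_nneseries => [n _ _|n _].
      exact: integral_ge0.
    exact: intg.
  by rewrite geometric_eseries// ltry.
pose A : R := 10 ^+ q * (1 + (2 / u) ^+ th).
have A0 : 0 <= A by rewrite mulr_ge0 ?exprn_ge0// addr_ge0// exprn_ge0// divr_ge0// ltW.
exists (fun w => 1 + A%:E * Y w)%E; split.
- by apply: emeasurable_funD => //; exact: measurable_funeM.
- by move=> w; rewrite leeDl// mule_ge0// lee_fin.
- rewrite ge0_integralD//; last 2 first.
  + by move=> w _; rewrite mule_ge0// lee_fin.
  + exact: measurable_funeM.
  rewrite integral_cst// ge0_integralZl//.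
  rewrite lte_add_pinfty//; first by rewrite mul1e -ge0_fin_numE// fin_num_measure.
  by rewrite lte_mul_pinfty// lee_fin.
move=> w s s0.
have [Yoo|Yfin] := eqVneq (Y w) +oo%E.
  have A1 : 0 < A by rewrite mulr_gt0 ?exprn_gt0// ltr_wpDr// exprn_ge0// divr_ge0// ltW.
  by rewrite Yoo gt0_muley ?lte_fin// addey// leey.
have Yf : Y w \is a fin_num by rewrite ge0_fin_numE// lt_neqAle Yfin leey.
pose y := fine (Y w).
have yE : Y w = y%:E by rewrite fineK.
have y0 : 0 <= y by rewrite fine_ge0.
rewrite yE -EFinM -EFinD lee_fin.
have Dle j n l : (l < 2 ^ n)%N -> De j n l w <= y * (2 ^+ th) ^+ j * rho ^+ (q * n).
  move=> ln; rewrite -ler_pdivrMr ?exprn_gt0// -ler_pdivrMr ?exprn_gt0//.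
  have gY : (g j n w <= Y w)%E.
    apply: (@le_trans _ _ (S j w)).
      rewrite /S (nneseriesD1 (n := n))//.
      by rewrite leeDl// nneseries_ge0.
    rewrite /Y (nneseriesD1 (n := j))//.
    by rewrite leeDl// nneseries_ge0.
  move: gY; rewrite yE lee_fin; apply: le_trans.
  rewrite mulrAC -mulrA mulrC ler_wpM2l ?(ltW (wt0 _ _))//.
  by rewrite (bigD1 (Ordinal ln))//= lerDl sumr_ge0.
have kE : k.*2 = (m + th)%N by rewrite /th subnKC// ltnW.
exact: (@drift_bound R (fun t => W t w) k th m y u (ltnW k2) y0 u0 m0 kE (cW w) (W0 w) Dle s s0).
Qed.

End fBm_moments.

(** * Suprema over dense sequences *)

Section dense_suprema.
Context {R : realType}.
Implicit Types (A : set R) (e : nat -> R) (g : R -> R).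

Definition dense_in A e := (forall i, A (e i)) /\
  forall y, A y -> exists p : nat -> nat, e (p n) @[n --> \oo] --> y.

Definition dyadic (i : nat) : R :=
  if unpickle i is Some (k, n) then (k : nat)%:R / 2 ^+ (n : nat) else 0.

Lemma dyadic_ge0 i : 0 <= dyadic i.
Proof.
rewrite /dyadic; case: unpickle => [[k n]|//].
by rewrite divr_ge0// exprn_ge0.
Qed.

Lemma dyadic_floorP (y : R) n : dyadic (pickle (Num.trunc (2 ^+ n * y), n)) = dyadic_floor n y.
Proof. by rewrite /dyadic pickleK. Qed.

Lemma dense_dyadic : dense_in `[0, +oo[ dyadic.
Proof.
split=> [i|y]; first by rewrite /= in_itv/= andbT dyadic_ge0.
rewrite /= in_itv/= andbT => y0.
exists (fun n => pickle (Num.trunc (2 ^+ n * y), n)).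
under eq_fun do rewrite dyadic_floorP; exact: cvg_dyadic_floor.
Qed.

Definition dyadic01 i := Num.min 1 (dyadic i).

Lemma dyadic01_itv i : 0 <= dyadic01 i <= 1.
Proof. by rewrite le_min ler01 dyadic_ge0/= ge_min lexx. Qed.

(** Truncation at 1 keeps the dyadic numbers dense and makes one sequence serve
every interval [0, t] after rescaling. *)
Lemma dense_dyadic01 : dense_in `[0, 1] dyadic01.
Proof.
split=> [i|y]; first by rewrite /= in_itv/= dyadic01_itv.
rewrite /= in_itv/= => /andP[y0 y1].
exists (fun n => pickle (Num.trunc (2 ^+ n * y), n)).
rewrite /dyadic01; under eq_fun do rewrite dyadic_floorP.
rewrite (_ : (fun n => _) = dyadic_floor ^~ y); first exact: cvg_dyadic_floor.
apply/funext => n; rewrite min_r//.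
exact: le_trans (dyadic_floor_le _ y0) y1.
Qed.

Lemma dense_scale e (c : R) : 0 < c -> dense_in `[0, +oo[ e ->
  dense_in `[0, +oo[ (fun i => c * e i).
Proof.
move=> c0 [eA ed]; split=> [i|y].
  by have := eA i; rewrite /= !in_itv/= !andbT => h; rewrite mulr_ge0// ltW.
rewrite /= in_itv/= andbT => y0.
have [p hp] := ed (y / c) ltac:(by rewrite /= in_itv/= andbT divr_ge0// ltW).
exists p; rewrite -[X in _ --> X](mulfVK (lt0r_neq0 c0)) mulrC; exact: cvgMr.
Qed.

Lemma dense_le A e g b : dense_in A e -> {within A, continuous g} ->
  (forall i, g (e i) <= b) -> forall y, A y -> g y <= b.
Proof.
move=> [eA ed] cg gb y Ay; have [p hp] := ed y Ay.
have cgp : g (e (p n)) @[n --> \oo] --> g y.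
  by apply: (within_cvg cg) => // n; exact: eA.
by rewrite -(cvg_lim _ cgp)//; apply: limr_le; [apply: cvgP cgp|exact: nearW].
Qed.

(** On a set without an upper bound both sides are 0, by convention; hence the
supremum of any path, bounded or not, is a measurable function of countably many
of its values. *)
Lemma sup_fine (S : set R) : S !=set0 -> sup S = fine (ereal_sup (EFin @` S)).
Proof.
move=> S0; have [uS|uS] := pselect (has_ubound S); first by rewrite ereal_sup_EFin.
rewrite hasNub_ereal_sup// sup_out// => -[].
by [].
Qed.

Lemma dense_ereal_sup A e g : dense_in A e -> {within A, continuous g} ->
  ereal_sup (EFin @` (g @` A)) = ereal_sup (range (fun i => (g (e i))%:E)).
Proof.
move=> de cg; apply/eqP; rewrite eq_le; apply/andP; split; last first.
  apply: ge_ereal_sup => _ [i _ <-]; apply: ereal_sup_ubound => /=.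
  by exists (g (e i)) => //; exists (e i) => //; exact: de.1.
apply: ge_ereal_sup => _ [_ [y Ay <-] <-].
have H i : ((g (e i))%:E <= ereal_sup (range (fun i => (g (e i))%:E)))%E.
  by apply: ereal_sup_ubound; exists i.
move: H; case: (ereal_sup _) => [b H|_|/(_ 0%N)]//; last exact: leey.
by rewrite lee_fin; apply: (dense_le de cg) => // i; rewrite -lee_fin.
Qed.

Lemma dense_sup A e g : dense_in A e -> {within A, continuous g} ->
  sup (g @` A) = fine (esups (fun i => (g (e i))%:E) 0).
Proof.
move=> de cg; rewrite sup_fine; last by exists (g (e 0%N)), (e 0%N) => //; exact: de.1.
rewrite (dense_ereal_sup de cg) /esups; congr (fine (ereal_sup _)).
by apply/seteqP; split => [_ [i _ <-]|_ [i _ <-]]; exists i.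
Qed.

Lemma dense_sup_le A e g b : dense_in A e -> {within A, continuous g} ->
  has_ubound (g @` A) -> sup (g @` A) <= b <-> forall i, g (e i) <= b.
Proof.
move=> de cg ug; have S0 : g @` A !=set0 by exists (g (e 0%N)), (e 0%N) => //; exact: de.1.
split=> [h i|h].
  by apply: le_trans h; apply: ub_le_sup => //; exists (e i) => //; exact: de.1.
by apply: ge_sup => // _ [y Ay <-]; exact: (dense_le de cg).
Qed.

End dense_suprema.

Section same_cdf.
Context d (T : measurableType d) (R : realType) (P : probability T R).
Implicit Types X Y : T -> R.

(** Half-lines generate the Borel sets and are stable under intersection. *)
Lemma same_cdf_integral X Y : measurable_fun setT X -> measurable_fun setT Y ->
  (forall b, P [set w | X w <= b] = P [set w | Y w <= b]) ->
  forall f : R -> \bar R, measurable_fun setT f -> (forall x, 0 <= f x)%E ->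
  (\int[P]_w f (X w) = \int[P]_w f (Y w))%E.
Proof.
move=> mX mY XY f mf f0.
rewrite -(@ge0_integral_pushforward _ _ _ _ _ X mX P setT)//.
rewrite -(@ge0_integral_pushforward _ _ _ _ _ Y mY P setT)//.
have gtE (Z : T -> R) b : measurable_fun setT Z ->
    P (Z @^-1` `]b, +oo[%classic) = (1 - P [set w | (Z w <= b)%R])%E.
  move=> mZ; rewrite (_ : Z @^-1` _ = ~` [set w | Z w <= b]); last first.
    by apply/seteqP; split=> w /=; rewrite in_itv/= andbT ltNge => /negP.
  rewrite probability_setC//.
  rewrite (_ : [set w | _] = Z @^-1` `]-oo, b]%classic).
    by rewrite -[X in measurable X]setTI; exact: mZ.
  by apply/seteqP; split=> w /=; rewrite in_itv.
apply: eq_measure_integral => A mA _.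
pose G : set (set R) := [set B | exists x, B = `]x, +oo[%classic].
apply: (@measure_unique _ R _ G (fun n => `]- n%:R, +oo[%classic)) => //.
- exact: RGenOInfty.measurableE.
- move=> _ _ [x ->] [y ->]; exists (Num.max x y).
  by apply/seteqP; split=> z /=; rewrite !in_itv/= !andbT gt_max; [move=> [-> ->]|move/andP].
- by move=> n; exists (- n%:R).
- apply/seteqP; split=> // x _.
  exists (Num.trunc `|x|).+1 => //=; rewrite in_itv/= andbT.
  have /andP[_ h] := truncn_itv (normr_ge0 x).
  by move: h; rewrite ltr_norml => /andP[].
- move=> _ [x ->].
  have E : P (X @^-1` `]x, +oo[%classic) = P (Y @^-1` `]x, +oo[%classic).
    by rewrite !gtE// XY.
  exact: E.
- move=> k; rewrite /pushforward -ge0_fin_numE// fin_num_measure//.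
  by rewrite -[X in measurable X]setTI; exact: mX.
Qed.

Lemma ae_eq_probability (N A B : set T) : measurable A -> measurable B ->
  measurable N -> P N = 0 -> (forall w, ~ N w -> A w <-> B w) -> P A = P B.
Proof.
move=> mA mB mN PN AB.
rewrite -[A]setIT -[B]setIT -!integral_indic//.
apply: ae_eq_integral => //; try exact/measurable_EFinP/measurable_indic.
exists N; split => // w /= /not_implyP[_ h]; apply: contrapT => /AB H; apply: h.
suff E : (w \in A) = (w \in B) by rewrite !indicE E.
by apply/idP/idP => /set_mem h; apply/mem_set/H.
Qed.

End same_cdf.

(** * The reflected path *)

Section reflected_path.
Context {R : realType}.
Variables (f : R -> R) (u : R).
Hypothesis cf : {within `[0, +oo[, continuous f}.

(** The supremum of f t - f s - u (t - s) over s in [0, t], parametrized by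
s = t - t y so that the index set does not depend on [t]. *)
Definition reflect_path (t : R) : R :=
  sup [set f t - f (t - t * y) - u * (t * y) | y in `[0, 1]].

Definition running_max (t : R) : R := sup [set f (t * y) - u * (t * y) | y in `[0, 1]].

Lemma within_drift : {within `[0, +oo[, continuous (fun s => f s - u * s)}.
Proof.
move/subspace_continuousP : cf => cf'.
apply/subspace_continuousP => x Ax; apply: cvgB; first exact: cf'.
by apply: cvgMr; apply: cvg_within.
Qed.

Lemma within_comp01 (g : R -> R) (k : R -> R) :
  {within `[0, +oo[, continuous g} -> continuous k ->
  (forall y, 0 <= y <= 1 -> 0 <= k y) -> {within `[0, 1], continuous (g \o k)}.
Proof.
move=> /subspace_continuousP cg ck k0; apply/subspace_continuousP => y Ay.
have k0y z : `[0, 1]%classic z -> `[0, +oo[%classic (k z).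
  by rewrite /= !in_itv/= andbT => /k0.
apply: cvg_comp (cg _ (k0y _ Ay)) => U /= AU.
have h : nbhs y (k @^-1` (fun x => `[0, +oo[%classic x -> U x)) := ck y _ AU.
suff : nbhs y (fun z => `[0, 1]%classic z -> U (k z)) by [].
by apply: filterS h => z /= h zA; apply: h; exact: k0y.
Qed.

Lemma within_scaled t : 0 <= t ->
  {within `[0, 1], continuous (fun y => f (t * y) - u * (t * y))}.
Proof.
move=> t0.
apply: (@within_comp01 (fun s => f s - u * s) (fun y => t * y)).
- exact: within_drift.
- by move=> y; apply: cvgMr; exact: cvg_id.
- by move=> y /andP[y0 _]; rewrite mulr_ge0.
Qed.

Lemma within_reversed t : 0 <= t ->
  {within `[0, 1], continuous (fun y => f t - f (t - t * y) - u * (t * y))}.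
Proof.
move=> t0.
have h : {within `[0, 1], continuous (f \o (fun y => t - t * y))}.
  apply: within_comp01 => //.
  - by move=> y; apply: cvgB; [exact: cvg_cst|apply: cvgMr; exact: cvg_id].
  - by move=> y /andP[_ y1]; rewrite subr_ge0 ler_piMr.
move/subspace_continuousP : h => h.
apply/subspace_continuousP => x Ax; apply: cvgB.
  by apply: cvgB; [exact: cvg_cst|exact: h].
by apply: cvgMr; apply: cvgMr; apply: cvg_within.
Qed.

Lemma path_bounded t : 0 <= t -> exists B, forall s, 0 <= s <= t -> `|f s| <= B.
Proof.
move=> t0.
have cft : {within `[0, t], continuous f}.
  apply: continuous_subspaceW cf => s /=.
  by rewrite !in_itv/= andbT => /andP[].
have [c _ hc] := EVT_max t0 cft.
have [c' _ hc'] := EVT_min t0 cft.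
exists (`|f c| + `|f c'|) => s st.
have st' : s \in `[0, t] by rewrite in_itv.
have := hc s st'; have := hc' s st'.
have := ler_norm (f c); have := ler_norm (- f c'); rewrite normrN.
have := normr_ge0 (f c); have := normr_ge0 (f c').
by rewrite ler_norml; lra.
Qed.

Lemma reflect_has_ubound t : 0 <= t ->
  has_ubound [set f t - f (t - t * y) - u * (t * y) | y in `[0, 1]].
Proof.
move=> t0; have [c _ hc] := EVT_max ler01 (within_reversed t0).
by eexists => _ [y Ay <-]; exact: hc.
Qed.

Lemma running_has_ubound t : 0 <= t ->
  has_ubound [set f (t * y) - u * (t * y) | y in `[0, 1]].
Proof.
move=> t0; have [c _ hc] := EVT_max ler01 (within_scaled t0).
by eexists => _ [y Ay <-]; exact: hc.
Qed.

Lemma reflect_ge t s : 0 <= s <= t -> f t - f s - u * (t - s) <= reflect_path t.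
Proof.
move=> /andP[s0 st]; have t0 := le_trans s0 st.
apply: ub_le_sup; first exact: reflect_has_ubound.
have [t_eq0|tn0] := eqVneq t 0.
  exists 0; first by rewrite /= in_itv/= lexx ler01.
  have s_eq0 : s = 0 by apply/eqP; rewrite eq_le s0 -t_eq0 st.
  by rewrite t_eq0 s_eq0 !mul0r !subr0.
have tp : 0 < t by rewrite lt0r tn0.
exists (1 - s / t).
  rewrite /= in_itv/= subr_ge0 ler_pdivrMr// mul1r st/= gerBl.
  by rewrite divr_ge0.
rewrite (_ : t * (1 - s / t) = t - s); last by field.
by rewrite subKr.
Qed.

Lemma reflect_le t b : 0 <= t ->
  (forall s, 0 <= s <= t -> f t - f s - u * (t - s) <= b) -> reflect_path t <= b.
Proof.
move=> t0 h; apply: ge_sup.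
  by exists (f t - f (t - t * 0) - u * (t * 0)), 0 => //=; rewrite in_itv/= lexx ler01.
move=> z [y /=]; rewrite in_itv/= => /andP[y0 y1] <-.
rewrite -{2}(subKr t (t * y)); apply: h.
by rewrite subr_ge0 ler_piMr//= gerBl mulr_ge0.
Qed.

Lemma reflect_ge0 t : 0 <= t -> 0 <= reflect_path t.
Proof.
by move=> t0; have := @reflect_ge t t; rewrite t0 lexx !subrr mulr0 subrr => /(_ isT).
Qed.

(** The infimum of x - u s + f s over [0, t] is x - u t + f t minus the
reflected supremum, and k - min(0, k - r) = max(k, r). *)
Lemma reflected_path_max x t : 0 <= x -> 0 <= t ->
  x - u * t + f t - Num.min 0 (inf [set x - u * s + f s | s in `[0, t]]) =
  Num.max (x - u * t + f t) (reflect_path t).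
Proof.
move=> x0 t0; set S := [set _ | _ in _].
have [B hB] := path_bounded t0.
have S0 : S !=set0 by exists (x - u * 0 + f 0), 0 => //=; rewrite in_itv/= lexx.
have lS : has_lbound S.
  exists (x + f t - u * t - reflect_path t) => z [s /=]; rewrite in_itv/= => st <-.
  by have := reflect_ge st; lra.
have E : inf S = x - u * t + f t - reflect_path t.
  apply/eqP; rewrite eq_le; apply/andP; split.
    suff : reflect_path t <= x - u * t + f t - inf S by lra.
    apply: reflect_le => // s st.
    have : inf S <= x - u * s + f s.
      by apply: ge_inf => //; exists s => //=; rewrite in_itv.
    by lra.
  apply: lb_le_inf => // z [s /=]; rewrite in_itv/= => st <-.
  by have := reflect_ge st; lra.
rewrite E; set k := x - u * t + f t; set r := reflect_path t.
by have [h|h] := leP 0 (k - r); have [h'|h'] := leP k r; lra.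
Qed.

Lemma reflect_bounded t : 0 <= u -> 0 <= t ->
  exists B, forall r, 0 <= r <= t -> reflect_path r <= B.
Proof.
move=> u0 t0; have [B hB] := path_bounded t0; exists (B + B) => r /andP[r0 rt].
apply: reflect_le => // s /andP[s0 sr].
have := hB r; rewrite r0 rt => /(_ isT).
have := hB s; rewrite s0 (le_trans sr rt) => /(_ isT).
have : 0 <= u * (r - s) by rewrite mulr_ge0// subr_ge0.
by rewrite !ler_norml; lra.
Qed.

Lemma running_max_ge t s : 0 <= s <= t -> f s - u * s <= running_max t.
Proof.
move=> /andP[s0 st]; have t0 := le_trans s0 st.
apply: ub_le_sup; first exact: running_has_ubound.
have [t_eq0|tn0] := eqVneq t 0.
  exists 0; first by rewrite /= in_itv/= lexx ler01.
  have s_eq0 : s = 0 by apply/eqP; rewrite eq_le s0 -t_eq0 st.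
  by rewrite t_eq0 s_eq0 !mulr0.
have tp : 0 < t by rewrite lt0r tn0.
exists (s / t); last by rewrite mulrC divfK.
by rewrite /= in_itv/= ler_pdivrMr// mul1r st divr_ge0.
Qed.

Lemma running_max_le t b : 0 <= t ->
  (forall s, 0 <= s <= t -> f s - u * s <= b) -> running_max t <= b.
Proof.
move=> t0 h; apply: ge_sup.
  by exists (f (t * 0) - u * (t * 0)), 0 => //=; rewrite in_itv/= lexx ler01.
move=> z [y /=]; rewrite in_itv/= => /andP[y0 y1] <-.
by apply: h; rewrite mulr_ge0//= ler_piMr.
Qed.

Lemma running_max_nd s t : 0 <= s -> s <= t -> running_max s <= running_max t.
Proof.
move=> s0 st; apply: running_max_le => // r /andP[r0 rs].
by apply: running_max_ge; rewrite r0 (le_trans rs).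
Qed.

Lemma running_max_cvg : has_ubound [set f s - u * s | s in `[0, +oo[] ->
  running_max n%:R @[n --> \oo] --> sup [set f s - u * s | s in `[0, +oo[].
Proof.
move=> uS; set S := [set _ | _ in _].
have S0 : S !=set0 by exists (f 0 - u * 0), 0 => //=; rewrite in_itv/= lexx.
have le_sup n : running_max n%:R <= sup S.
  apply: running_max_le => // s /andP[s0 _]; apply: ub_le_sup => //.
  by exists s => //=; rewrite in_itv/= s0.
apply/cvgrPdist_le => e e0.
have [_ [s /=] + <- hs] := sup_adherent e0 (conj S0 uS).
rewrite in_itv/= andbT => s0.
near=> n.
have sn : s <= n%:R by near: n; exact: nbhs_infty_ger.
have := @running_max_ge n%:R s; rewrite s0 sn => /(_ isT).
have := le_sup n.
by rewrite ler_norml; lra.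
Unshelve. all: by end_near. Qed.

End reflected_path.

(** * Laws of the suprema *)

Section measurable_suprema.
Context {R : realType}.

(** For continuous paths the supremum is taken over a sequence, and [sup_fine]
makes this valid for unbounded paths too. *)
Lemma measurable_dense_sup d (T : measurableType d) (A : set R) e (g : T -> R -> R) :
  dense_in A e -> (forall z, {within A, continuous (g z)}) ->
  (forall i, measurable_fun setT (fun z => g z (e i))) ->
  measurable_fun setT (fun z => sup (g z @` A)).
Proof.
move=> de cg mg.
rewrite (_ : (fun z => _) = fine \o (fun z => esups (fun i => (g z (e i))%:E) 0)); last first.
  by apply/funext => z; rewrite (dense_sup de).
apply: measurableT_comp; first exact: fine_measurable.
apply: (@measurable_fun_esups _ _ _ setT (fun i z => (g z (e i))%:E)) => i.
exact/measurable_EFinP/mg.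
Qed.

(** Joint measurability, needed to exchange the integrals in time and in the
sample: a continuous process is the limit of its dyadic discretizations in
time.  The truncation at 0 makes the process total in time. *)
Lemma measurable_continuous_process d (T : measurableType d) (X : R -> T -> R) :
  (forall t, 0 <= t -> measurable_fun setT (X t)) ->
  (forall w, {within `[0, +oo[, continuous (X ^~ w)}) ->
  measurable_fun setT (fun z : T * R => X (Num.max 0 z.2) z.1).
Proof.
move=> mX cX.
have m0 (z : T * R) : 0 <= Num.max 0 z.2 by rewrite le_max lexx.
have A0 x : 0 <= x -> `[0, +oo[%classic x by rewrite /= in_itv/= andbT.
apply: (@measurable_fun_cvg _ _ _ setT
    (fun n (z : T * R) => X (dyadic_floor n (Num.max 0 z.2)) z.1)); last first.
  move=> z _; apply: (within_cvg (cX z.1)).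
  - exact: A0.
  - by move=> n; apply: A0; exact: dyadic_floor_ge0.
  - exact: cvg_dyadic_floor.
move=> n _ B mB; rewrite setTI.
have p2 : 0 < 2 ^+ n :> R by rewrite exprn_gt0.
(* the times whose dyadic approximation of level n is k / 2^n *)
pose I k := [set r : R | k%:R <= 2 ^+ n * Num.max 0 r < k.+1%:R].
rewrite (_ : _ @^-1` B =
    \bigcup_k ((X (k%:R / 2 ^+ n) @^-1` B) `*` I k)); last first.
  apply/seteqP; split=> [z /= Bz|z [k _ [/= Bz kz]]]; last first.
    rewrite /dyadic_floor (_ : Num.trunc _ = k)//.
    by apply/eqP; rewrite truncn_eq// mulr_ge0// ltW.
  exists (Num.trunc (2 ^+ n * Num.max 0 z.2)) => //; split => //.
  by rewrite /I/=; apply: truncn_itv; rewrite mulr_ge0// ltW.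
apply: bigcup_measurable => k _; apply: measurableX.
  rewrite -[X in measurable X]setTI; exact: mX.
rewrite (_ : I k = (fun r => 2 ^+ n * Num.max 0 r) @^-1` `[k%:R, k.+1%:R[%classic); last first.
  by apply/seteqP; split => r /=; rewrite in_itv.
rewrite -[X in measurable X]setTI.
have : measurable_fun setT (fun r : R => 2 ^+ n * Num.max 0 r).
  by apply: measurable_funM => //; apply: measurable_maxr.
by apply.
Qed.

End measurable_suprema.

Section fBm_suprema.
Context d (T : measurableType d) (R : realType) (P : probability T R).
Variables (H : R) (W : R -> {RV P >-> R}).
Hypotheses (H_range : 2^-1 <= H < 1) (W_fBm : is_fBm H W).

Let cW w : {within `[0, +oo[, continuous (fun t => W t w)}.
Proof. by case: W_fBm => + _ _ _ _; apply. Qed.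

Let W0 w : W 0 w = 0. Proof. by case: W_fBm => _ + _ _ _; apply. Qed.

Lemma state_reflect u x t w : 0 <= x -> 0 <= t ->
  state W u x t w =
  Num.max (x - u * t + W t w) (reflect_path (fun s => W s w) u t).
Proof.
by move=> x0 t0; rewrite /state /regulator -(reflected_path_max u (@cW w) x0 t0).
Qed.

Lemma measurable_path : measurable_fun setT (fun z : T * R => W (Num.max 0 z.2) z.1).
Proof. by apply: (@measurable_continuous_process _ _ _ (fun t => W t : T -> R)). Qed.

Lemma measurable_path_comp d' (T' : measurableType d') (h : T' -> T) (k : T' -> R) :
  measurable_fun setT h -> measurable_fun setT k -> (forall z, 0 <= k z) ->
  measurable_fun setT (fun z => W (k z) (h z)).
Proof.
move=> mh mk k0.
rewrite (_ : (fun z => _) = (fun z => W (Num.max 0 z.2) z.1) \o (fun z => (h z, k z))).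
  apply: measurableT_comp; first exact: measurable_path.
  exact: measurable_fun_pair.
by apply/funext => z /=; rewrite max_r.
Qed.

Lemma measurable_reflect u :
  measurable_fun setT (fun z : T * R => reflect_path (fun s => W s z.1) u (Num.max 0 z.2)).
Proof.
have m0 (z : T * R) : 0 <= Num.max 0 z.2 by rewrite le_max lexx.
have mm : measurable_fun setT (fun z : T * R => Num.max 0 z.2).
  by apply: measurable_maxr.
apply: (@measurable_dense_sup _ _ (T * R)%type _ _
    (fun z y => W (Num.max 0 z.2) z.1 - W (Num.max 0 z.2 - Num.max 0 z.2 * y) z.1
      - u * (Num.max 0 z.2 * y)) dense_dyadic01) => [z|i].
  exact: (within_reversed (@cW z.1) (m0 z)).
apply: measurable_funB; first apply: measurable_funB.
- exact: measurable_path.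
- apply: measurable_path_comp => //.
    by apply: measurable_funB => //; exact: measurable_funM.
  by move=> z; have /andP[i0 i1] := dyadic01_itv (R := R) i; rewrite subr_ge0 ler_piMr.
- by apply: measurable_funM => //; exact: measurable_funM.
Qed.

Lemma measurable_reflect_at u t : 0 <= t ->
  measurable_fun setT (fun w => reflect_path (fun s => W s w) u t).
Proof.
move=> t0; rewrite (_ : (fun w => _) =
  (fun z : T * R => reflect_path (fun s => W s z.1) u (Num.max 0 z.2)) \o (fun w => (w, t))).
  by apply: measurableT_comp; [exact: measurable_reflect|exact: measurable_pair2].
by apply/funext => w /=; rewrite max_r.
Qed.

Lemma measurable_running u t : 0 <= t ->
  measurable_fun setT (fun w => running_max (fun s => W s w) u t).
Proof.
move=> t0; apply: (measurable_dense_sup dense_dyadic01) => [w|i].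
  exact: (within_scaled (@cW w) t0).
by apply: measurable_funB => //; exact: measurable_funPT.
Qed.

Lemma measurable_max_process u : measurable_fun setT (max_process W u).
Proof.
apply: (@measurable_dense_sup _ _ _ _ _ (fun w s => W s w - u * s) dense_dyadic) => [w|i].
  exact: (within_drift (@cW w)).
by apply: measurable_funB => //; exact: measurable_funPT.
Qed.

(** Both suprema are over the same dyadic points, where the finite-dimensional
laws agree by reversal of the increments. *)
Lemma reflect_law u t b : 0 <= t ->
  P [set w | reflect_path (fun s => W s w) u t <= b] =
  P [set w | running_max (fun s => W s w) u t <= b].
Proof.
move=> t0.
(* the dyadic points of [0, t] *)
pose q i : R := t * dyadic01 i.
have q_itv i : 0 <= q i <= t.
  have /andP[i0 i1] := dyadic01_itv (R := R) i.
  by rewrite mulr_ge0//= ler_piMr.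
have -> : [set w | reflect_path (fun s => W s w) u t <= b] =
    [set w | forall i, W t w - W (t - q i) w <= b + u * q i].
  apply/seteqP; split=> w /=.
    move=> /(dense_sup_le _ dense_dyadic01 (within_reversed (@cW w) t0)
      (reflect_has_ubound u (@cW w) t0)) h i; have := h i.
    by rewrite /q; lra.
  move=> h; apply/(dense_sup_le _ dense_dyadic01 (within_reversed (@cW w) t0)
      (reflect_has_ubound u (@cW w) t0)) => i; have := h i.
  by rewrite /q; lra.
have -> : [set w | running_max (fun s => W s w) u t <= b] =
    [set w | forall i, W (q i) w <= b + u * q i].
  apply/seteqP; split=> w /=.
    move=> /(dense_sup_le _ dense_dyadic01 (within_scaled (@cW w) t0)
      (running_has_ubound u (@cW w) t0)) h i; have := h i.
    by rewrite /q; lra.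
  move=> h; apply/(dense_sup_le _ dense_dyadic01 (within_scaled (@cW w) t0)
      (running_has_ubound u (@cW w) t0)) => i; have := h i.
  by rewrite /q; lra.
apply: (@countable_orthant _ _ _ P (fun i w => W t w - W (t - q i) w) (fun i => W (q i))) => //.
  by move=> i; exact: measurable_funB.
by move=> n b'; exact: (fBm_reversal H_range W_fBm).
Qed.

Lemma drift_bounded u : 0 < u -> exists N : set T, [/\ measurable N, P N = 0%E &
  forall w, ~ N w -> has_ubound [set W s w - u * s | s in `[0, +oo[]].
Proof.
move=> u0; have [D [mD D1 iD DW]] := fBm_drift_moment H_range W_fBm u0 (ltn0Sn 0).
have intD : P.-integrable setT D.
  apply/integrableP; split => //.
  rewrite (eq_integral D)// => w _; rewrite gee0_abs//.
  by rewrite (le_trans _ (D1 w)).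
have := integrable_ae measurableT intD => -[N [mN N0 hN]].
exists N; split => // w Nw.
have Df : D w \is a fin_num by apply: contrapT => h; apply: Nw; apply: hN => /= /(_ I).
exists (fine (D w)) => z [s /=]; rewrite in_itv/= andbT => s0 <-.
have := DW w s s0; rewrite expr1 -{1}(fineK Df) lee_fin; apply: le_trans.
by rewrite le_max lexx orbT.
Qed.

Lemma max_process_ge0 u w : 0 <= max_process W u w.
Proof.
rewrite /max_process; set S := [set _ | _ in _].
have [uS|uS] := pselect (has_ubound S).
  apply: ub_le_sup => //; exists 0; first by rewrite /= in_itv/= lexx.
  by rewrite W0 mulr0 subrr.
by rewrite sup_out// => -[].
Qed.

Lemma running_le_max_process u t w : 0 <= t ->
  has_ubound [set W s w - u * s | s in `[0, +oo[] ->
  running_max (fun s => W s w) u t <= max_process W u w.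
Proof.
move=> t0 uS; apply: running_max_le => // s /andP[s0 _].
by apply: ub_le_sup => //; exists s => //=; rewrite in_itv/= s0.
Qed.

Lemma max_process_cdf u e b : 0 < u -> dense_in `[0, +oo[ e ->
  P [set w | max_process W u w <= b] =
  P [set w | forall i, W (e i) w - u * e i <= b].
Proof.
move=> u0 de; have [N [mN N0 hN]] := drift_bounded u0.
apply: (ae_eq_probability _ _ mN N0).
- exact/measurable_sublevel/measurable_max_process.
- rewrite (_ : [set w | _] = \bigcap_i [set w | W (e i) w - u * e i <= b]).
    apply: bigcapT_measurable => i; apply: measurable_sublevel.
    by apply: measurable_funB => //; exact: measurable_funPT.
  by apply/seteqP; split=> [w /= h i _|w h i]; [exact: h|exact: (h i I)].
- by move=> w /hN uS; exact: (dense_sup_le b de (within_drift (@cW w)) uS).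
Qed.

(** With c = u^(-1/(1-H)), time scaled by [c] multiplies W by c^H and the
drift u s by u c = c^H. *)
Lemma max_process_scaling u b : 0 < u ->
  P [set w | max_process W u w <= b] =
  P [set w | u `^ (- (H / (1 - H))) * max_process W 1 w <= b].
Proof.
move=> u0; have /andP[H2 H1] := H_range.
have h1 : 0 < 1 - H by rewrite subr_gt0.
pose c := u `^ (- (1 - H)^-1).
have c0 : 0 < c by exact: powR_gt0.
pose k := c `^ H.
have kE : u `^ (- (H / (1 - H))) = k.
  by rewrite /k /c -powRrM; congr (_ `^ _); rewrite mulNr mulrC.
have k0 : 0 < k by exact: powR_gt0.
have uc : u * c = k.
  rewrite /k /c -powRrM -[X in X * _]powRr1 ?(ltW u0)// -powRD; last first.
    by rewrite (gt_eqF u0) implybT.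
  by congr (_ `^ _); field; rewrite gt_eqF.
rewrite kE (max_process_cdf _ u0 (dense_scale c0 dense_dyadic)).
have -> : [set w | k * max_process W 1 w <= b] = [set w | max_process W 1 w <= b / k].
  by apply/seteqP; split=> w /=; rewrite ler_pdivlMr// mulrC.
rewrite (max_process_cdf _ ltr01 dense_dyadic).
have -> : [set w | forall i, W (dyadic i) w - 1 * dyadic i <= b / k] =
    [set w | forall i, k * W (dyadic i) w <= b + u * (c * dyadic i)].
  apply/seteqP; split=> w /= h i; have := h i.
    by rewrite ler_pdivlMr// mul1r mulrA uc; lra.
  by rewrite ler_pdivlMr// mul1r mulrA uc; lra.
have -> : [set w | forall i, W (c * dyadic i) w - u * (c * dyadic i) <= b] =
    [set w | forall i, W (c * dyadic i) w <= b + u * (c * dyadic i)].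
  by apply/seteqP; split=> w /= h i; have := h i; lra.
apply: (@countable_orthant _ _ _ P (fun i => W (c * dyadic i)) (fun i w => k * W (dyadic i) w)) => //.
- by move=> i; exact: measurable_funM.
- move=> n b'; apply: (fBm_scaling H_range W_fBm (r := fun i => dyadic i)) => //.
  by move=> i; exact: dyadic_ge0.
Qed.

End fBm_suprema.

(** * The long-run average cost *)

Section cost_function.
Context {R : realType}.
Variable C : R -> R.
Hypotheses (C_ge0 : forall y : R, 0 <= y -> 0 <= C y)
  (C_cont : {within `[0, +oo[, continuous C})
  (C_ndecr : forall y z : R, 0 <= y -> y <= z -> C y <= C z).

(** Extending [C] by its value at 0 gives a continuous function on the whole
line, hence a measurable one. *)
Definition pos_ext (y : R) := C (Num.max 0 y).

Lemma pos_extE y : 0 <= y -> pos_ext y = C y.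
Proof. by move=> y0; rewrite /pos_ext max_r. Qed.

Lemma pos_ext_ge0 y : 0 <= pos_ext y.
Proof. by apply: C_ge0; rewrite le_max lexx. Qed.

Lemma pos_ext_nd y z : y <= z -> pos_ext y <= pos_ext z.
Proof.
move=> yz; apply: C_ndecr; first by rewrite le_max lexx.
by rewrite ge_max !le_max lexx/= yz orbT.
Qed.

Lemma pos_ext_continuous : continuous pos_ext.
Proof.
move=> y; have A0 (x : R) : 0 <= x -> `[0, +oo[%classic x by rewrite /= in_itv/= andbT.
move/subspace_continuousP : C_cont => cC.
have m0 (z : R) : `[0, +oo[%classic (Num.max 0 z) by apply: A0; rewrite le_max lexx.
suff : C (Num.max 0 z) @[z --> y] --> C (Num.max 0 y) by [].
apply: cvg_comp (cC _ (m0 y)) => U /= AU.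
have cm : {for y, continuous (fun z : R => Num.max 0 z)}.
  by apply: (@continuous_max _ _ (cst 0) id) => //; exact: cst_continuous.
have h : nbhs y ((fun z : R => Num.max 0 z) @^-1` (fun x => `[0, +oo[%classic x -> U x)) := cm _ AU.
suff : nbhs y (fun z => U (Num.max 0 z)) by [].
by apply: filterS h => z /=; apply; exact: m0.
Qed.

Lemma measurable_pos_ext : measurable_fun setT pos_ext.
Proof. by apply: continuous_measurable_fun; exact: pos_ext_continuous. Qed.

Hypothesis C_growth : exists K gamma : R, [/\ 0 < K, 0 < gamma &
  forall y : R, 0 <= y -> C y <= K * (1 + y `^ gamma)].

(** Integer powers are what [max_process_moment] controls.  The factor x + z
comes from the length of the transient period. *)
Lemma cost_polynomial_growth (x : R) : 0 <= x -> exists (c : R) (m : nat), [/\ 0 <= c, (0 < m)%N &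
  forall z : R, 0 <= z -> C (x + z) * (x + z) <= c * (1 + z ^+ m)].
Proof.
move=> x0; have [K [g [K0 g0 CK]]] := C_growth.
pose k := (Num.trunc g).+1.
have gk : g <= k%:R.
  by have /andP[_ h] := truncn_itv (ltW g0); exact: ltW.
exists (2 * K * 2 ^+ k.+1 * ((1 + x) ^+ k.+1 + 1)), k.+1; split=> // [|z z0].
  apply: mulr_ge0; last by rewrite addr_ge0// exprn_ge0// addr_ge0.
  apply: mulr_ge0; last exact: exprn_ge0.
  by apply: mulr_ge0 => //; exact: ltW.
pose v := 1 + x + z.
have v1 : 1 <= v by rewrite /v; lra.
have v0 : 0 <= v by lra.
have xz0 : 0 <= x + z by lra.
have vk1 : 1 <= v ^+ k by rewrite exprn_ege1.
have xzg : (x + z) `^ g <= v ^+ k.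
  apply: (@le_trans _ _ (v `^ g)).
    by apply: ge0_ler_powR; rewrite ?nnegrE ?(ltW g0)// /v; lra.
  by rewrite -powR_mulrn//; apply: ler_powR.
have h1 : C (x + z) <= 2 * K * v ^+ k.
  by apply: (le_trans (CK _ xz0)); nra.
have h2 : C (x + z) * (x + z) <= 2 * K * v ^+ k.+1.
  rewrite exprSr mulrA; apply: ler_pM => //; first exact: C_ge0.
  by rewrite /v; lra.
apply: (le_trans h2).
have h3 : v ^+ k.+1 <= 2 ^+ k.+1 * ((1 + x) ^+ k.+1 + z ^+ k.+1).
  pose b := Num.max (1 + x) z.
  have b0 : 0 <= b by rewrite le_max z0 orbT.
  have hv : v <= 2 * b.
    have hb1 : 1 + x <= b by rewrite le_max lexx.
    have hb2 : z <= b by rewrite le_max lexx orbT.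
    by rewrite /v; lra.
  apply: (@le_trans _ _ ((2 * b) ^+ k.+1)); first by apply: lerXn2r; rewrite ?nnegrE ?mulr_ge0.
  have p1 : 0 <= (1 + x) ^+ k.+1 by rewrite exprn_ge0// addr_ge0.
  have p2 : 0 <= z ^+ k.+1 by rewrite exprn_ge0.
  have p3 : 0 <= 2 ^+ k.+1 :> R by rewrite exprn_ge0.
  rewrite exprMn ler_wpM2l//.
  have [h|h] := leP (1 + x) z.
    by rewrite (_ : b = z) ?lerDr// /b max_r.
  by rewrite (_ : b = 1 + x) ?lerDl// /b max_l// ltW.
have p1 : 0 <= (1 + x) ^+ k.+1 by rewrite exprn_ge0// addr_ge0.
have p2 : 0 <= z ^+ k.+1 by rewrite exprn_ge0.
have p3 : 0 <= 2 ^+ k.+1 :> R by rewrite exprn_ge0.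
apply: (@le_trans _ _ (2 * K * (2 ^+ k.+1 * ((1 + x) ^+ k.+1 + z ^+ k.+1)))).
  by rewrite ler_wpM2l// mulr_ge0// ltW.
rewrite [leLHS]mulrA -[leRHS]mulrA ler_wpM2l//.
  apply: mulr_ge0; last exact: exprn_ge0.
  by apply: mulr_ge0 => //; exact: ltW.
by have := mulr_ge0 p1 p2; nra.
Qed.

End cost_function.

Section average.
Context {R : realType}.

(** The lower bound says that a non-decreasing quantity is at least [g r] after
time [r], the upper bound that the transient effect is at most K in total. *)
Lemma limf_esup_average (a : R -> \bar R) (G K : R) (g : R -> R) :
  (forall t, 0 < t -> (a t <= (G + K / t)%:E)%E) ->
  (forall r t, 0 <= r -> r < t -> (((t - r) / t * g r)%:E <= a t)%E) ->
  (forall e, 0 < e -> exists2 r, 0 <= r & G - e <= g r) ->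
  limf_esup a (pinfty_nbhs R) = G%:E.
Proof.
move=> aG ga gG; apply/eqP; rewrite eq_le; apply/andP; split.
  apply/lee_addgt0Pr => e e0.
  apply: (@le_trans _ _ (ereal_sup (a @` [set t | Num.max 0 (`|K| / e) < t]))).
    apply: ereal_inf_lbound; exists [set t | Num.max 0 (`|K| / e) < t] => //.
    by exists (Num.max 0 (`|K| / e)); split; first exact: num_real.
  apply: ge_ereal_sup => z [t /=]; rewrite gt_max => /andP[t0 tK] <-.
  apply: (le_trans (aG t t0)); rewrite lee_fin lerD2l ler_pdivrMr//.
  rewrite (le_trans (ler_norm _))// ltW// mulrC -ltr_pdivrMr//.
apply: le_ereal_inf_tmp => z [V [M [_ hM]] <-].
apply/lee_addgt0Pr => e e0.
have e2 : 0 < e / 2 by rewrite divr_gt0.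
have [r r0 gr] := gG _ e2.
(* late enough to lie beyond M, and for the loss r / t * g r to be at most e / 2 *)
pose t := `|M| + r + 1 + 2 * r * `|g r| / e.
have rg : 0 <= 2 * r * `|g r| / e by rewrite divr_ge0 ?mulr_ge0// ltW.
have nM := normr_ge0 M.
have tM : M < t by have := ler_norm M; rewrite /t; lra.
have rt : r < t by rewrite /t; lra.
have t0 : 0 < t by exact: le_lt_trans rt.
have : (a t <= ereal_sup (a @` V))%E by apply: ereal_sup_ubound; exists t => //; exact: hM.
move=> h; apply: (@le_trans _ _ (a t + e%:E)%E); last by rewrite leeD2r.
apply: (@le_trans _ _ (((t - r) / t * g r)%:E + e%:E)%E); last by rewrite leeD2r// ga.
rewrite -EFinD lee_fin.
have : r / t * g r <= e / 2.
  apply: (@le_trans _ _ (r / t * `|g r|)).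
    by rewrite ler_wpM2l ?ler_norm// divr_ge0// ltW.
  rewrite mulrAC ler_pdivrMr// (mulrC (e / 2)) -ler_pdivrMr//.
  have -> : r * `|g r| / (e / 2) = 2 * r * `|g r| / e by field; rewrite gt_eqF.
  by rewrite /t; lra.
rewrite mulrBl divff ?gt_eqF// mulrBl mul1r; lra.
Qed.

End average.

Section joint_integration.
Context d (T : measurableType d) (R : realType) (P : probability T R).
Local Open Scope ereal_scope.

Let mu := @lebesgue_measure R.

(** A time integral over [0, t] is rewritten over the whole line, where the
theorem of Tonelli applies. *)
Let cut (F : T * R -> \bar R) (t : R) (z : T * R) := F z * (\1_(`[0%R, t]%classic : set R) z.2)%:E.

Let measurable_cut F t : measurable_fun setT F -> measurable_fun setT (cut F t).
Proof.
move=> mF; apply: emeasurable_funM => //; apply/measurable_EFinP.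
have mI : measurable_fun setT (\1_(`[0%R, t]%classic : set R) : R -> R) by [].
exact: (measurableT_comp mI measurable_snd).
Qed.

Let cut_ge0 F t : (forall z, 0 <= F z) -> forall z, 0 <= cut F t z.
Proof. by move=> F0 z; rewrite mule_ge0// lee_fin. Qed.

Let int_cut F t w : \int[mu]_r cut F t (w, r) = \int[mu]_(r in `[0%R, t]) F (w, r).
Proof.
rewrite [RHS]integral_mkcond; apply: eq_integral => r _.
by rewrite /cut patchE indicE; case: ifPn => _; rewrite ?mule1 ?mule0.
Qed.

Lemma measurable_time_integral (F : T * R -> \bar R) t : measurable_fun setT F ->
  (forall z, 0 <= F z) ->
  measurable_fun setT (fun w => \int[mu]_(r in `[0%R, t]) F (w, r)).
Proof.
move=> mF F0; under eq_fun do rewrite -int_cut.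
apply: (@measurable_fun_fubini_tonelli_F _ _ T (measurableTypeR R) R mu (cut F t)).
- exact: measurable_cut.
- exact: cut_ge0.
Qed.

Lemma time_integral_swap (F : T * R -> \bar R) t : measurable_fun setT F ->
  (forall z, 0 <= F z) ->
  \int[P]_w \int[mu]_(r in `[0%R, t]) F (w, r) =
  \int[mu]_(r in `[0%R, t]) \int[P]_w F (w, r).
Proof.
move=> mF F0; under eq_integral do rewrite -int_cut.
rewrite (@fubini_tonelli _ _ T (measurableTypeR R) R P mu (cut F t)); last 2 first.
- exact: measurable_cut.
- exact: cut_ge0.
rewrite [RHS]integral_mkcond; apply: eq_integral => r _.
rewrite /cut patchE /=; case: ifPn => rt.
  by apply: eq_integral => w _; rewrite indicE rt mule1.
by apply: integral0_eq => w _; rewrite indicE (negbTE rt) mule0.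
Qed.

End joint_integration.

Section long_run_average.
Context d (T : measurableType d) (R : realType) (P : probability T R).
Variables (H : R) (W : R -> {RV P >-> R}) (C : R -> R).
Hypotheses (H_range : 2^-1 <= H < 1) (W_fBm : is_fBm H W)
  (C_ge0 : forall y : R, 0 <= y -> 0 <= C y)
  (C_cont : {within `[0, +oo[, continuous C})
  (C_ndecr : forall y z : R, 0 <= y -> y <= z -> C y <= C z)
  (C_growth : exists K gamma : R, [/\ 0 < K, 0 < gamma &
     forall y : R, 0 <= y -> C y <= K * (1 + y `^ gamma)]).

Let mu := @lebesgue_measure R.
Let Cx := pos_ext C.
Let Z u w := max_process W u w.
Let refl u t w := reflect_path (fun s => W s w) u t.

Let cW w : {within `[0, +oo[, continuous (fun t => W t w)}.
Proof. by case: W_fBm => + _ _ _ _; apply. Qed.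

Let mCx : measurable_fun setT Cx. Proof. exact: measurable_pos_ext. Qed.

Let Cx0 y : 0 <= Cx y. Proof. exact: pos_ext_ge0. Qed.

Let Cxnd y z : y <= z -> Cx y <= Cx z. Proof. exact: pos_ext_nd. Qed.

Let mZ u : measurable_fun setT (Z u).
Proof. exact: (measurable_max_process W_fBm). Qed.

Let Z0 u w : 0 <= Z u w. Proof. exact: (max_process_ge0 W_fBm). Qed.

(** The bound of [fBm_drift_moment] is uniform in [s]; it passes to the supremum
after taking a root of order [m]. *)
Lemma max_process_moment u m : 0 < u -> (0 < m)%N ->
  exists D : T -> \bar R, [/\ measurable_fun setT D, forall w, (1 <= D w)%E,
    (\int[P]_w D w < +oo)%E & forall w, ((max_process W u w ^+ m)%:E <= D w)%E].
Proof.
move=> u0 m0; have [D [mD D1 iD DW]] := fBm_drift_moment H_range W_fBm u0 m0.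
exists D; split => // w.
have := D1 w; have := DW w.
case: (D w) => [r h r1| |] //; last by move=> _ _; rewrite leey.
rewrite lee_fin in r1.
have r0 : 0 <= r by lra.
pose z := r `^ m%:R^-1.
have z0 : 0 <= z by exact: powR_ge0.
have zm : z ^+ m = r.
  by rewrite -powR_mulrn// -powRrM mulVf ?powRr1// pnatr_eq0 -lt0n.
rewrite lee_fin -zm; apply: lerXn2r; rewrite ?nnegrE//.
apply: ge_sup.
  by exists (W 0 w - u * 0), 0 => //=; rewrite in_itv/= lexx.
move=> y [s /=]; rewrite in_itv/= andbT => s0 <-.
rewrite leNgt; apply/negP => zy.
have := h s s0; rewrite lee_fin -zm leNgt => /negP; apply.
by rewrite ltrXn2r ?nnegrE -?lt0n// ?lt_max ?zy ?orbT// le_max lexx.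
Qed.

Lemma cost_moment u x : 0 < u -> 0 <= x ->
  (\int[P]_w (Cx (x + Z u w) * (x + Z u w))%:E < +oo)%E.
Proof.
move=> u0 x0; have [c [m [c0 m0 hc]]] := cost_polynomial_growth C_ge0 C_growth x0.
have [D [mD D1 iD DZ]] := max_process_moment u0 m0.
have xZ0 w : 0 <= x + Z u w by rewrite addr_ge0.
have D0 w : (0 <= D w)%E by exact: le_trans (D1 w).
apply: (@le_lt_trans _ _ (\int[P]_w ((2 * c)%:E * D w))%E); last first.
  rewrite ge0_integralZl_EFin//; last by rewrite mulr_ge0.
  by rewrite lte_mul_pinfty// ?integral_ge0// ?lee_fin ?mulr_ge0.
apply: ge0_le_integral => //.
- by move=> w _; rewrite lee_fin mulr_ge0.
- apply/measurable_EFinP; apply: measurable_funM; last exact: measurable_funD.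
  by apply: measurableT_comp => //; exact: measurable_funD.
- exact: measurable_funeM.
- move=> w _; rewrite /Cx pos_extE//.
  apply: (@le_trans _ _ (c * (1 + Z u w ^+ m))%:E); first by rewrite lee_fin hc.
  have := D1 w; have := DZ w.
  case: (D w) => [r h r1| |] //.
    rewrite !lee_fin in h r1 *; rewrite (mulrC 2) -mulrA ler_wpM2l//.
    by rewrite /Z; move: h; set zm := _ ^+ m; lra.
  have [->|cn0] := eqVneq c 0; first by rewrite !mul0r mulr0 mul0e.
  by rewrite gt0_muley ?leey// lte_fin mulr_gt0// lt0r cn0.
Qed.

Lemma stationary_lty u : 0 < u -> (\int[P]_w (Cx (Z u w))%:E < +oo)%E.
Proof.
move=> u0; apply: le_lt_trans (cost_moment u0 ler01).
apply: ge0_le_integral => //.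
- by move=> w _; rewrite lee_fin.
- by apply/measurable_EFinP; exact: measurableT_comp.
- apply/measurable_EFinP; apply: measurable_funM; last exact: measurable_funD.
  by apply: measurableT_comp => //; exact: measurable_funD.
- move=> w _; rewrite lee_fin; apply: (@le_trans _ _ (Cx (1 + Z u w))).
    by apply: Cxnd; rewrite lerDr.
  by rewrite ler_peMr// lerDl.
Qed.

Definition stationary_mean u : R := fine (\int[P]_w (Cx (Z u w))%:E)%E.

Lemma stationary_meanE u : 0 < u ->
  (\int[P]_w (Cx (Z u w))%:E)%E = (stationary_mean u)%:E.
Proof.
move=> u0; rewrite fineK// ge0_fin_numE ?stationary_lty//.
by apply: integral_ge0 => w _; rewrite lee_fin.
Qed.

Lemma expectation_stationary u :
  ('E_P[fun w => C (max_process W u w)] = \int[P]_w (Cx (Z u w))%:E)%E.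
Proof.
by rewrite unlock; apply: eq_integral => w _; rewrite /Cx pos_extE.
Qed.

(** The mean cost at time [r] of the path started at 0. *)
Let mean0 u r : \bar R := (\int[P]_w (Cx (refl u r w))%:E)%E.

Let mean0E u r : 0 <= r ->
  mean0 u r = (\int[P]_w (Cx (running_max (fun s => W s w) u r))%:E)%E.
Proof.
move=> r0; apply: (@same_cdf_integral _ _ _ P (refl u r)
  (fun w => running_max (fun s => W s w) u r) _ _ _ (fun y => (Cx y)%:E)).
- exact: (measurable_reflect_at W_fBm).
- exact: (measurable_running W_fBm).
- by move=> b; exact: (reflect_law H_range W_fBm).
- exact/measurable_EFinP.
- by move=> y; rewrite lee_fin.
Qed.

Let mean0_nd u r s : 0 <= r -> r <= s -> (mean0 u r <= mean0 u s)%E.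
Proof.
move=> r0 rs; have s0 := le_trans r0 rs; rewrite !mean0E//.
apply: ge0_le_integral => //.
- by move=> w _; rewrite lee_fin.
- apply/measurable_EFinP; apply: measurableT_comp => //.
  exact: (measurable_running W_fBm).
- apply/measurable_EFinP; apply: measurableT_comp => //.
  exact: (measurable_running W_fBm).
- by move=> w _; rewrite lee_fin; apply: Cxnd; exact: running_max_nd.
Qed.

Let mean0_le u r : 0 < u -> 0 <= r -> (mean0 u r <= (stationary_mean u)%:E)%E.
Proof.
move=> u0 r0; rewrite mean0E// -stationary_meanE//.
have [N [mN N0 hN]] := drift_bounded H_range W_fBm u0.
apply: ae_ge0_le_integral => //.
- by move=> w _; rewrite lee_fin.
- apply/measurable_EFinP; apply: measurableT_comp => //.
  exact: (measurable_running W_fBm).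
- by move=> w _; rewrite lee_fin.
- by apply/measurable_EFinP; exact: measurableT_comp.
- exists N; split => // w /= /not_implyP[_ h]; apply: contrapT => /hN uS; apply: h.
  by rewrite lee_fin; apply: Cxnd; exact: running_le_max_process.
Qed.

Let mean0_fin u r : 0 < u -> 0 <= r -> mean0 u r = (fine (mean0 u r))%:E.
Proof.
move=> u0 r0; rewrite fineK// ge0_fin_numE.
  by rewrite (le_lt_trans (mean0_le u0 r0))// ltry.
by apply: integral_ge0 => w _; rewrite lee_fin.
Qed.

Let mean0_cvg u : 0 < u -> mean0 u n%:R @[n --> \oo] --> (stationary_mean u)%:E.
Proof.
move=> u0; have [N [mN N0 hN]] := drift_bounded H_range W_fBm u0.
rewrite -stationary_meanE//.
rewrite (_ : (fun n : nat => mean0 u n%:R) =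
  (fun n => \int[P]_w (Cx (running_max (fun s => W s w) u n%:R))%:E)%E); last first.
  by apply/funext => n; rewrite mean0E.
have [|||||_ _] := @dominated_convergence _ _ _ P setT measurableT
  (fun n w => (Cx (running_max (fun s => W s w) u n%:R))%:E)
  (fun w => (Cx (Z u w))%:E) (fun w => (Cx (Z u w))%:E); last exact.
- move=> n; apply/measurable_EFinP; apply: measurableT_comp => //.
  exact: (measurable_running W_fBm).
- by apply/measurable_EFinP; exact: measurableT_comp.
- exists N; split => // w /= /not_implyP[_ h]; apply: contrapT => /hN uS; apply: h.
  apply: cvg_EFin; first by near=> n.
  have := running_max_cvg (@cW w) uS.
  by apply: continuous_cvg; exact: pos_ext_continuous.
- apply/integrableP; split; first by apply/measurable_EFinP; exact: measurableT_comp.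
  rewrite (eq_integral (fun w => (Cx (Z u w))%:E)); first exact: stationary_lty.
  by move=> w _; rewrite gee0_abs// lee_fin.
- exists N; split => // w /= h; apply: contrapT => /hN uS; apply: h => n _.
  by rewrite lee_fin ger0_norm//; apply: Cxnd; exact: running_le_max_process.
Unshelve. all: by end_near. Qed.

(** [F0] and [Fx] are the running costs of the paths started at 0 and at x, as
functions on the product space. *)
Let F0 u (z : T * R) : \bar R := (Cx (refl u (Num.max 0 z.2) z.1))%:E.
Let Fx u x (z : T * R) : \bar R :=
  (Cx (Num.max (x - u * Num.max 0 z.2 + W (Num.max 0 z.2) z.1)
               (refl u (Num.max 0 z.2) z.1)))%:E.

Let mF0 u : measurable_fun setT (F0 u).
Proof.
apply/measurable_EFinP; apply: measurableT_comp => //.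
exact: (measurable_reflect W_fBm).
Qed.

Let mFx u x : measurable_fun setT (Fx u x).
Proof.
apply/measurable_EFinP; apply: measurableT_comp => //.
apply: measurable_maxr; last exact: (measurable_reflect W_fBm).
apply: measurable_funD; last exact: (measurable_path W_fBm).
apply: measurable_funB => //; apply: measurable_funM => //.
by apply: measurable_maxr.
Qed.

Let F0_ge0 u z : (0 <= F0 u z)%E. Proof. by rewrite lee_fin. Qed.
Let Fx_ge0 u x z : (0 <= Fx u x z)%E. Proof. by rewrite lee_fin. Qed.

Let F0E u w r : 0 <= r -> F0 u (w, r) = (Cx (refl u r w))%:E.
Proof. by move=> r0; rewrite /F0/= (max_r r0). Qed.

Let FxE u x w r : 0 <= r ->
  Fx u x (w, r) = (Cx (Num.max (x - u * r + W r w) (refl u r w)))%:E.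
Proof. by move=> r0; rewrite /Fx/= !(max_r r0). Qed.

Let mF0w u w : measurable_fun setT (fun r => F0 u (w, r)).
Proof. by apply: (measurableT_comp (mF0 u)); exact: measurable_pair1. Qed.
Let mFxw u x w : measurable_fun setT (fun r => Fx u x (w, r)).
Proof. by apply: (measurableT_comp (mFx u x)); exact: measurable_pair1. Qed.

(** The inner time integral is a real number because paths are bounded on
[0, t], so that no value is lost when it is converted to an extended real. *)
Let cost_integral u x t w : 0 < u -> 0 <= x -> 0 < t ->
  ((\int[mu]_(r in `[0, t]) C (state W u x r w))%R)%:E =
  (\int[mu]_(r in `[0%R, t]) Fx u x (w, r))%E.
Proof.
move=> u0 x0 t0; rewrite /Rintegral.
have -> : (\int[mu]_(r in `[0%R, t]) (C (state W u x r w))%:E =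
    \int[mu]_(r in `[0%R, t]) Fx u x (w, r))%E.
  apply: eq_integral => r; rewrite inE/= in_itv/= => /andP[r0 rt].
  rewrite FxE// (state_reflect W_fBm)// /Cx pos_extE//.
  by rewrite le_max (reflect_ge0 u (@cW w) r0) orbT.
rewrite fineK// ge0_fin_numE; last by apply: integral_ge0.
have [B hB] := reflect_bounded (@cW w) (ltW u0) (ltW t0).
have [B' hB'] := path_bounded (@cW w) (ltW t0).
have : (\int[mu]_(r in `[0%R, t]) Fx u x (w, r) <=
    \int[mu]_(r in `[0%R, t]) (cst (Cx (Num.max (x + B') B))%:E) r)%E.
  apply: ge0_le_integral => //.
  - exact: measurable_funTS (mFxw u x w).
  - move=> r /=; rewrite in_itv/= => rt; have /andP[r0 _] := rt.
    rewrite FxE// lee_fin; apply: Cxnd.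
    have h1 := hB _ rt; have := hB' _ rt; rewrite ler_norml => /andP[_ h2].
    have ur : 0 <= u * r by rewrite mulr_ge0// ltW.
    rewrite ge_max !le_max h1 orbT andbT; apply/orP; left; lra.
move=> /le_lt_trans; apply.
rewrite integral_cst//= lebesgue_measure_itv/= lte_fin t0 -EFinD -EFinM.
exact: ltry.
Qed.

Let expected_cost u x t : 0 < u -> 0 <= x -> 0 < t ->
  ('E_P[fun w => (\int[mu]_(r in `[0, t]) C (state W u x r w))%R] =
  \int[P]_w \int[mu]_(r in `[0%R, t]) Fx u x (w, r))%E.
Proof.
move=> u0 x0 t0; rewrite unlock; apply: eq_integral => w _.
exact: cost_integral.
Qed.

Let F0_meanE u r : 0 <= r -> (\int[P]_w F0 u (w, r))%E = mean0 u r.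
Proof. by move=> r0; apply: eq_integral => w _; rewrite F0E. Qed.

Let measurable_mean0 u : measurable_fun setT (fun r => \int[P]_w F0 u (w, r))%E.
Proof.
apply: (@measurable_fun_fubini_tonelli_G _ _ T (measurableTypeR R) R P (F0 u)).
- exact: mF0.
- exact: F0_ge0.
Qed.

Lemma expected_cost_ge u x r t : 0 < u -> 0 <= r -> r < t ->
  (((t - r) * fine (mean0 u r))%:E <=
    \int[P]_w \int[mu]_(r in `[0%R, t]) Fx u x (w, r))%E.
Proof.
move=> u0 r0 rt; have t0 := le_lt_trans r0 rt.
apply: (@le_trans _ _ (\int[P]_w \int[mu]_(r in `[0%R, t]) F0 u (w, r))%E); last first.
  apply: ge0_le_integral => //.
  - by move=> w _; exact: integral_ge0.
  - exact: measurable_time_integral.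
  - exact: measurable_time_integral.
  - move=> w _; apply: ge0_le_integral => //.
    + exact: measurable_funTS (mF0w u w).
    + exact: measurable_funTS (mFxw u x w).
    + by move=> s _; rewrite lee_fin; apply: Cxnd; rewrite le_max lexx orbT.
rewrite time_integral_swap//.
apply: (@le_trans _ _ (\int[mu]_(s in `[r, t]) \int[P]_w F0 u (w, s))%E); last first.
  apply: ge0_subset_integral => //.
  - exact: measurable_funTS (measurable_mean0 u).
  - by move=> s _; exact: integral_ge0.
  - by move=> s /=; rewrite !in_itv/= => /andP[rs ->]; rewrite (le_trans r0).
apply: (@le_trans _ _ (\int[mu]_(s in `[r, t]) (cst (mean0 u r)) s)%E).
  rewrite integral_cst//= lebesgue_measure_itv/= lte_fin rt -EFinD.
  by rewrite {2}mean0_fin// -EFinM mulrC.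
apply: ge0_le_integral => //.
- by move=> s _; apply: integral_ge0 => w _; rewrite lee_fin.
- exact: measurable_funTS (measurable_mean0 u).
- move=> s /=; rewrite in_itv/= => /andP[rs st].
  by rewrite F0_meanE ?(le_trans r0)//; exact: mean0_nd.
Qed.

(** A bound for the total cost due to the initial state: the largest cost
during the transient period, times a bound of the length of this period. *)
Let transient u x w := Cx (x + Z (u / 2) w) * (x + Z (u / 2) w) * (2 / u).

Let measurable_transient u x : measurable_fun setT (transient u x).
Proof.
apply: measurable_funM => //; apply: measurable_funM; last exact: measurable_funD.
by apply: measurableT_comp => //; exact: measurable_funD.
Qed.

Let transient_ge0 u x w : 0 < u -> 0 <= x -> 0 <= transient u x w.
Proof. by move=> u0 x0; rewrite /transient !mulr_ge0 ?addr_ge0// ltW// invr_gt0. Qed.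

(** At a time r where the free path x - u r + W r exceeds the reflected
supremum, it is positive; as W r - (u/2) r <= Z_(u/2), this forces
r < 2 (x + Z_(u/2)) / u, and the state is at most x + Z_(u/2). *)
Let transient_bound u x t w : 0 < u -> 0 <= x -> 0 < t ->
  has_ubound [set W s w - u / 2 * s | s in `[0, +oo[] ->
  (\int[mu]_(r in `[0%R, t]) Fx u x (w, r) <=
   \int[mu]_(r in `[0%R, t]) F0 u (w, r) + (transient u x w)%:E)%E.
Proof.
move=> u0 x0 t0 uS.
pose z := x + Z (u / 2) w.
have z0 : 0 <= z by rewrite addr_ge0.
pose b := z * (2 / u).
have b0 : 0 <= b by rewrite mulr_ge0// divr_ge0// ltW.
have mI : measurable_fun setT (fun r : R => (Cx z * \1_(`[0, b]) r)%:E).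
  by apply/measurable_EFinP; apply: measurable_funM.
have I0 (r : R) : (0 <= (Cx z * \1_(`[0%R, b]) r)%:E)%E by rewrite lee_fin mulr_ge0.
apply: (@le_trans _ _ (\int[mu]_(r in `[0%R, t])
    (F0 u (w, r) + (Cx z * \1_(`[0%R, b]) r)%:E))%E).
  apply: ge0_le_integral => //.
  - exact: measurable_funTS (mFxw u x w).
  - by apply: measurable_funTS; apply: emeasurable_funD => //; exact: mF0w.
  - move=> r /=; rewrite in_itv/= => /andP[r0 rt].
    rewrite FxE// F0E// -EFinD lee_fin.
    have W_le : W r w - u / 2 * r <= Z (u / 2) w.
      by apply: ub_le_sup => //; exists r => //=; rewrite in_itv/= r0.
    set y := x - u * r + W r w.
    have [yr|ry] := leP y (refl u r w); first by rewrite lerDl mulr_ge0.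
    have rz : y <= z - u / 2 * r by rewrite /y /z; lra.
    have y0 : 0 < y by apply: le_lt_trans ry; exact: (reflect_ge0 u (@cW w) r0).
    have ur0 : 0 <= u / 2 * r by rewrite mulr_ge0// divr_ge0// ltW.
    rewrite indicE mem_set/=; last first.
      rewrite in_itv/= r0/= /b mulrA ler_pdivlMr// -ler_pdivrMr//.
      by move: y0 rz; rewrite -mulrA mulrC; lra.
    rewrite mulr1 (@le_trans _ _ (Cx z))//; last by rewrite lerDr.
    by apply: Cxnd; lra.
rewrite ge0_integralD//; last 2 first.
- exact: measurable_funTS (mF0w u w).
- exact: measurable_funTS.
rewrite leeD2l//.
under eq_integral do rewrite EFinM.
rewrite ge0_integralZl_EFin//; last first.
  by apply: measurable_funTS; apply/measurable_EFinP.
rewrite integral_indic// /transient -/z -mulrA -/b EFinM lee_wpmul2l ?lee_fin//.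
apply: (@le_trans _ _ (mu `[0, b]%classic)).
  by apply: le_measure; rewrite ?inE//=; exact: measurableI.
rewrite /mu lebesgue_measure_itv/= lte_fin; case: ifPn => _; last by rewrite lee_fin.
by rewrite -EFinD subr0.
Qed.

Let transient_mean u x := fine (\int[P]_w (transient u x w)%:E)%E.

Let transient_meanE u x : 0 < u -> 0 <= x ->
  (\int[P]_w (transient u x w)%:E)%E = (transient_mean u x)%:E.
Proof.
move=> u0 x0; rewrite fineK// ge0_fin_numE; last first.
  by apply: integral_ge0 => w _; rewrite lee_fin transient_ge0.
rewrite (eq_integral (fun w => ((2 / u)%:E * (Cx (x + Z (u / 2) w) * (x + Z (u / 2) w))%:E)%E)); last first.
  by move=> w _; rewrite -EFinM mulrC.
rewrite ge0_integralZl_EFin//.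
- rewrite lte_mul_pinfty ?lee_fin ?divr_ge0// ?ltW//.
  by apply: cost_moment => //; rewrite divr_gt0.
- by move=> w _; rewrite lee_fin mulr_ge0// addr_ge0.
- apply/measurable_EFinP; apply: measurable_funM; last exact: measurable_funD.
  by apply: measurableT_comp => //; exact: measurable_funD.
- by rewrite divr_ge0// ltW.
Qed.

Lemma expected_cost_le u x t : 0 < u -> 0 <= x -> 0 < t ->
  (\int[P]_w \int[mu]_(r in `[0%R, t]) Fx u x (w, r) <=
   (t * stationary_mean u + transient_mean u x)%:E)%E.
Proof.
move=> u0 x0 t0; have u20 : 0 < u / 2 by rewrite divr_gt0.
have [N [mN N0 hN]] := drift_bounded H_range W_fBm u20.
apply: (@le_trans _ _ (\int[P]_w
    (\int[mu]_(r in `[0%R, t]) F0 u (w, r) + (transient u x w)%:E))%E).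
  apply: ae_ge0_le_integral => //.
  - by move=> w _; exact: integral_ge0.
  - exact: measurable_time_integral.
  - by move=> w _; rewrite adde_ge0 ?integral_ge0// lee_fin transient_ge0.
  - apply: emeasurable_funD; first exact: measurable_time_integral.
    exact/measurable_EFinP.
  - exists N; split => // w /= /not_implyP[_ h]; apply: contrapT => /hN uS; apply: h.
    exact: transient_bound.
rewrite ge0_integralD//; last 4 first.
- by move=> w _; exact: integral_ge0.
- exact: measurable_time_integral.
- by move=> w _; rewrite lee_fin transient_ge0.
- exact/measurable_EFinP.
rewrite transient_meanE// EFinD leeD2r// time_integral_swap//.
apply: (@le_trans _ _ (\int[mu]_(s in `[0%R, t]) (cst (stationary_mean u)%:E) s)%E).
  apply: ge0_le_integral => //.
  - by move=> s _; exact: integral_ge0.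
  - exact: measurable_funTS (measurable_mean0 u).
  - move=> s /=; rewrite in_itv/= => /andP[s0 _].
    by rewrite F0_meanE//; exact: mean0_le.
by rewrite integral_cst//= lebesgue_measure_itv/= lte_fin t0 -EFinD subr0 -EFinM mulrC.
Qed.

Theorem cost_stationary p h u x : 0 < u -> 0 <= x ->
  cost W p h C u x = stationary_cost W p h C u.
Proof.
move=> u0 x0; rewrite /cost /stationary_cost expectation_stationary stationary_meanE//.
congr (_ + _)%E.
apply: (@limf_esup_average _ _ _ (transient_mean u x) (fun r => fine (mean0 u r))).
- move=> t t0; rewrite expected_cost// lee_pdivrMl//.
  apply: (le_trans (expected_cost_le u0 x0 t0)).
  by rewrite -EFinM lee_fin mulrDr mulrCA divff ?gt_eqF// mulr1.
- move=> r t r0 rt; have t0 := le_lt_trans r0 rt.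
  rewrite expected_cost// lee_pdivlMl// -EFinM.
  apply: le_trans (expected_cost_ge x u0 r0 rt).
  by rewrite lee_fin mulrA mulrCA divff ?gt_eqF// mulr1.
- move=> e e0; have := mean0_cvg u0.
  move=> /fine_cvgP[_ /cvgrPdist_le /(_ e e0)[n _ hn]].
  exists n%:R => //; have := hn n (leqnn n).
  by rewrite /= ler_norml; lra.
Qed.

End long_run_average.

(** * Minimization of the mean cost *)

Section convex_monotone.
Context {R : realType}.

Lemma convex_comb (f : R -> R) : @convex_function R R^o `[0, +oo[%classic f ->
  forall x y t : R, 0 <= x -> 0 <= y -> 0 <= t -> t <= 1 ->
  f (t * x + (1 - t) * y) <= t * f x + (1 - t) * f y.
Proof.
move=> cf x y t x0 y0 t0 t1.
have := cf (Itv01 t0 t1) x y.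
by rewrite !convRE; apply; rewrite mem_set//= in_itv/= andbT.
Qed.

Lemma convex_mid (f : R -> R) : @convex_function R R^o `[0, +oo[%classic f ->
  forall x y : R, 0 <= x -> 0 <= y -> f ((x + y) / 2) <= (f x + f y) / 2.
Proof.
move=> cf x y x0 y0; have h0 : 0 <= 2^-1 :> R by rewrite invr_ge0.
have h1 : 2^-1 <= 1 :> R by rewrite invf_le1// ler1n.
have := convex_comb cf x0 y0 h0 h1.
rewrite (_ : 2^-1 * x + (1 - 2^-1) * y = (x + y) / 2); last by field.
by rewrite (_ : 2^-1 * f x + (1 - 2^-1) * f y = (f x + f y) / 2)//; field.
Qed.

Lemma strictly_convex_mid (f : R -> R) : @strictly_convex_function R `[0, +oo[%classic f ->
  forall x y : R, 0 <= x -> 0 <= y -> x != y -> f ((x + y) / 2) < (f x + f y) / 2.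
Proof.
move=> cf x y x0 y0 xy; have h0 : 0 <= 2^-1 :> R by rewrite invr_ge0.
have h1 : 2^-1 <= 1 :> R by rewrite invf_le1// ler1n.
have h2 : 0 < (Itv01 h0 h1)%:num < 1 by rewrite /= invr_gt0 ltr0n invf_lt1// ltr1n.
have := cf (Itv01 h0 h1) h2 x y.
rewrite !convRE => lt_xy.
have : f (2^-1 * x + (1 - 2^-1) * y) < 2^-1 * f x + (1 - 2^-1) * f y.
  by apply: lt_xy => //; rewrite mem_set//= in_itv/= andbT.
rewrite (_ : 2^-1 * x + (1 - 2^-1) * y = (x + y) / 2); last by field.
by rewrite (_ : 2^-1 * f x + (1 - 2^-1) * f y = (f x + f y) / 2)//; field.
Qed.

Variable f : R -> R.
Hypotheses (cf : @convex_function R R^o `[0, +oo[%classic f)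
  (nf : forall y z : R, 0 <= y -> y <= z -> f y <= f z).

Lemma convex_nd_le a b m : 0 <= m -> 0 <= a -> 0 <= b -> m <= (a + b) / 2 ->
  f m <= (f a + f b) / 2.
Proof.
move=> m0 a0 b0 mab; apply: le_trans (convex_mid cf a0 b0).
exact: nf.
Qed.

(** Equality makes f constant between m and the midpoint of a and b; by
convexity f cannot increase between b and m, and it is non-decreasing, so f b
equals f m, the mean of f a and f b. *)
Lemma convex_nd_eq a b m : 0 <= b -> b < m -> m < (a + b) / 2 ->
  f m = (f a + f b) / 2 -> f a = f b.
Proof.
move=> b0 bm mab E.
have m0 : 0 <= m by exact: le_trans (ltW bm).
pose M := (a + b) / 2.
have M0 : 0 <= M by exact: le_trans (ltW mab).
have ba : b < a by rewrite /M in mab; lra.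
have a0 : 0 <= a by lra.
have fM : f M = f m.
  apply/eqP; rewrite eq_le [f m <= _](nf m0 (ltW mab)) andbT E.
  exact: convex_mid.
have fb : f b <= f m by apply: nf => //; exact: ltW.
have bM : 0 < M - b by rewrite /M; lra.
(* m as a convex combination of b and of the midpoint M *)
pose t := (M - m) / (M - b).
have t0 : 0 < t by rewrite divr_gt0// subr_gt0.
have t1 : t <= 1 by rewrite ler_pdivrMr// mul1r; lra.
have := convex_comb cf b0 M0 (ltW t0) t1.
rewrite (_ : t * b + (1 - t) * M = m); last first.
  rewrite (_ : t * b + (1 - t) * M = M - t * (M - b)); last by ring.
  by rewrite divfK ?gt_eqF// subKr.
by rewrite fM => h; nra.
Qed.

End convex_monotone.

Section negative_power.
Context {R : realType}.
Variable k : R.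
Hypothesis k0 : 0 < k.

Lemma npowR_lt u v : 0 < u -> u < v -> v `^ (- k) < u `^ (- k) :> R.
Proof.
move=> u0 uv; have v0 := lt_trans u0 uv; rewrite !powRN ltf_pV2 ?posrE ?powR_gt0//.
by apply: gt0_ltr_powR => //; rewrite nnegrE ltW.
Qed.

Lemma npowR_le u v : 0 < u -> u <= v -> v `^ (- k) <= u `^ (- k) :> R.
Proof.
move=> u0; rewrite le_eqVlt => /predU1P[->//|uv]; exact/ltW/npowR_lt.
Qed.

(** The value at the arithmetic mean is at most the geometric mean of the values,
because the arithmetic mean of [u] and [v] exceeds their geometric mean; and the
values differ. *)
Lemma npowR_mid u v : 0 < u -> u < v ->
  ((u + v) / 2) `^ (- k) < (u `^ (- k) + v `^ (- k)) / 2 :> R.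
Proof.
move=> u0 uv; have v0 := lt_trans u0 uv.
have s0 : 0 < (u + v) / 2 by rewrite divr_gt0// addr_gt0.
have h : ((u + v) / 2) `^ (- k) * ((u + v) / 2) `^ (- k) <= u `^ (- k) * v `^ (- k).
  rewrite -powRM ?(ltW s0)// -powRM ?(ltW u0) ?(ltW v0)//.
  apply: npowR_le; first exact: mulr_gt0.
  by have := sqr_ge0 (u - v); rewrite expr2; nra.
have ba := npowR_lt u0 uv.
have := powR_gt0 (- k) s0; have := powR_gt0 (- k) v0.
move: h ba; set m := _ `^ _; set b := v `^ _; set a := u `^ _ => h ba b0 m0.
by rewrite ltNge; apply/negP => h2; nra.
Qed.

Lemma npowR_ge y u : 0 < y -> 0 < u -> u <= y `^ (- k^-1) -> y <= u `^ (- k) :> R.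
Proof.
move=> y0 u0 uy; have := npowR_le u0 uy.
rewrite -powRrM mulrNN mulVf ?gt_eqF// powRr1 ?(ltW y0)//.
Qed.

Lemma npowR_continuous u : 0 < u -> {for u, continuous (fun v : R => v `^ (- k))}.
Proof.
move=> u0; apply/differentiable_continuous/derivable1_diffP.
by apply: derivable_powR; rewrite in_itv/= u0.
Qed.

End negative_power.

Section optimization.
Context d (T : measurableType d) (R : realType) (P : probability T R).
Variables (H : R) (W : R -> {RV P >-> R}) (p : R) (h C : R -> R).
Hypotheses (H_range : 2^-1 <= H < 1)
    (W_fBm : is_fBm H W)
    (p_ge0 : 0 <= p)
    (h_ge0 : forall u : R, 0 <= u -> 0 <= h u)
    (h_cont : {within `[0, +oo[, continuous h})
    (h_ndecr : forall u v : R, 0 <= u -> u <= v -> h u <= h v)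
    (C_ge0 : forall y : R, 0 <= y -> 0 <= C y)
    (C_cont : {within `[0, +oo[, continuous C})
    (C_ndecr : forall y z : R, 0 <= y -> y <= z -> C y <= C z)
    (C_growth : exists K gamma : R, [/\ 0 < K, 0 < gamma &
       forall y : R, 0 <= y -> C y <= K * (1 + y `^ gamma)]).

Let Cx := pos_ext C.
Let Z w := max_process W 1 w.
Let k := H / (1 - H).
Let E u := stationary_mean W C u.

Let k_gt0 : 0 < k.
Proof. by have /andP[H2 H1] := H_range; apply: divr_gt0; lra. Qed.

Let mCx : measurable_fun setT Cx. Proof. exact: measurable_pos_ext. Qed.
Let Cx0 y : 0 <= Cx y. Proof. exact: pos_ext_ge0. Qed.
Let Cxnd y z : y <= z -> Cx y <= Cx z. Proof. exact: pos_ext_nd. Qed.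
Let mZ : measurable_fun setT Z. Proof. exact: (measurable_max_process W_fBm). Qed.
Let Z0 w : 0 <= Z w. Proof. exact: (max_process_ge0 W_fBm). Qed.

Let mCZ u : measurable_fun setT (fun w => Cx (u `^ (- k) * Z w)).
Proof. by apply: measurableT_comp => //; exact: measurable_funM. Qed.

Lemma stationary_mean_scaling u : 0 < u ->
  (\int[P]_w (Cx (u `^ (- k) * Z w))%:E)%E = (E u)%:E.
Proof.
move=> u0; rewrite /E -(stationary_meanE H_range W_fBm)//.
apply: (@same_cdf_integral _ _ _ P (fun w => u `^ (- k) * Z w)
  (max_process W u) _ _ _ (fun y => (Cx y)%:E)).
- exact: measurable_funM.
- exact: (measurable_max_process W_fBm).
- by move=> b; rewrite (max_process_scaling H_range W_fBm).
- exact/measurable_EFinP.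
- by move=> y; rewrite lee_fin.
Qed.

Lemma integrable_scaling u : 0 < u ->
  P.-integrable setT (fun w => (Cx (u `^ (- k) * Z w))%:E).
Proof.
move=> u0; apply/integrableP; split; first exact/measurable_EFinP.
rewrite (eq_integral (fun w => (Cx (u `^ (- k) * Z w))%:E)).
  by rewrite stationary_mean_scaling// ltry.
by move=> w _; rewrite gee0_abs// lee_fin.
Qed.

(** On ]u/2, 2u[ the integrands are dominated by the one at u/2. *)
Lemma stationary_mean_continuous u : 0 < u -> {for u, continuous E}.
Proof.
move=> u0.
have u20 : 0 < u / 2 by rewrite divr_gt0.
have E_eq v : 0 < v -> (\int[P]_w Cx (v `^ (- k) * Z w))%R = E v.
  by move=> v0; rewrite /Rintegral stationary_mean_scaling.
have itv0 v : `]u / 2, 2 * u[%classic v -> 0 < v.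
  by rewrite /= in_itv/= => /andP[/(lt_trans u20)].
have uI : u \in `]u / 2, 2 * u[%classic by rewrite mem_set//= in_itv/=; lra.
have := @continuity_under_integral R d T P (fun v w => Cx (v `^ (- k) * Z w)) setT
  measurableT (u / 2) (2 * u).
move=> /(_ _ _ (fun w => Cx ((u / 2) `^ (- k) * Z w))) => K.
have : {for u, continuous (fun v => (\int[P]_w Cx (v `^ (- k) * Z w))%R)}.
  apply: K => //.
  - by move=> v /itv0 v0; exact: integrable_scaling.
  - apply: aeW => w _ v /set_mem/itv0 v0.
    apply: (@continuous_comp _ _ _ (fun v => v `^ (- k) * Z w) Cx).
      by apply: cvgMl; exact: npowR_continuous.
    exact: pos_ext_continuous.
  - exact: integrable_scaling.
  - move=> v Iv; have v0 := itv0 _ Iv; apply: aeW => w _.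
    rewrite ger0_norm//; apply: Cxnd; rewrite ler_wpM2r//; apply: npowR_le => //.
    by move: Iv; rewrite /= in_itv/= => /andP[/ltW].
move=> cE; rewrite /prop_for /continuous_at -(E_eq _ u0); apply: cvg_trans cE.
apply: near_eq_cvg; near=> v; rewrite E_eq//.
near: v; exact: lt_nbhsr.
Unshelve. all: by end_near. Qed.

(** The mass that forces the cost of small controls up: on 1 <= Z_1 the cost
is at least C(u^(-k)). *)
Let q := fine (P [set w | 1 <= Z w]).

Let m1 : measurable [set w | 1 <= Z w]. Proof. exact: measurable_superlevel. Qed.

Let qE : P [set w | 1 <= Z w] = q%:E.
Proof. by rewrite /q fineK// fin_num_measure. Qed.

(** Outside a null set Z_1 is at least W 1 - 1. *)
Let q_gt0 : 0 < q.
Proof.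
rewrite -lte_fin -qE; apply: (lt_le_trans (fBm_tail H_range W_fBm)).
have [N [mN N0 hN]] := drift_bounded H_range W_fBm ltr01.
have m2 : measurable [set w | 2 <= W 1 w] by exact: measurable_superlevel.
rewrite (measureDI P m2 mN) [X in (_ + X)%E](_ : _ = 0%E) ?adde0.
  apply: le_measure; rewrite ?inE//; first exact: measurableD.
  move=> w [/= w2 /hN uS]; apply: (@le_trans _ _ (W 1 w - 1 * 1)); first lra.
  by apply: ub_le_sup => //; exists 1 => //=; rewrite in_itv/= ler01.
apply/eqP; rewrite eq_le measure_ge0 andbT -N0 le_measure ?inE//.
exact: measurableI.
Qed.

Lemma stationary_mean_ge u : 0 < u -> C (u `^ (- k)) * q <= E u.
Proof.
move=> u0; rewrite -lee_fin -stationary_mean_scaling// EFinM -qE.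
rewrite -[X in P X]setIT -integral_indic// -ge0_integralZl_EFin//; last 2 first.
- exact/measurable_EFinP.
- exact/C_ge0/powR_ge0.
apply: ge0_le_integral => //.
- by move=> w _; rewrite -EFinM lee_fin mulr_ge0//; exact/C_ge0/powR_ge0.
- by apply: measurable_funeM; exact/measurable_EFinP.
- exact/measurable_EFinP.
- move=> w _; rewrite -EFinM lee_fin indicE.
  have [w1|_] := boolP (w \in _); last by rewrite mulr0.
  rewrite mulr1 -(pos_extE C (powR_ge0 _ _)); apply: Cxnd.
  by rewrite ler_peMr ?powR_ge0//; move/set_mem : w1.
Qed.

Definition mean_cost u := h u + p * u + stationary_mean W C u.

Let J u := mean_cost u.

Lemma stationary_costE u : 0 < u -> stationary_cost W p h C u = (mean_cost u)%:E.
Proof.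
move=> u0; rewrite /stationary_cost (expectation_stationary C W_fBm).
by rewrite (stationary_meanE H_range W_fBm).
Qed.

Let E_ge0 u : 0 <= E u.
Proof. by apply: fine_ge0; apply: integral_ge0 => w _; rewrite lee_fin. Qed.

Let costE u x : 0 < u -> 0 <= x -> cost W p h C u x = (mean_cost u)%:E.
Proof.
by move=> u0 x0; rewrite (cost_stationary H_range W_fBm)// stationary_costE.
Qed.

Lemma optimal_controlP u :
  optimal_control W p h C u <-> 0 < u /\ forall v, 0 < v -> mean_cost u <= mean_cost v.
Proof.
split=> [[u0 hu]|[u0 hu]]; split=> //; [move=> v v0|move=> x x0].
  have [_ /(_ (cost W p h C v 0))] := hu 0 (lexx 0).
  rewrite stationary_costE// costE// lee_fin; apply.
  by exists v => //; rewrite costE.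
rewrite stationary_costE//; split; first by exists u => //; rewrite costE.
by move=> _ [v v0 <-]; rewrite costE// lee_fin hu.
Qed.

Lemma mean_cost_within a b : 0 < a -> {within `[a, b], continuous mean_cost}.
Proof.
move=> a0.
have hc : {within `[a, b], continuous h}.
  apply: continuous_subspaceW h_cont => s /=.
  by rewrite !in_itv/= andbT => /andP[/(le_trans (ltW a0))].
move/subspace_continuousP : hc => hc.
apply/subspace_continuousP => x Ax.
have x0 : 0 < x by move: Ax; rewrite /= in_itv/= => /andP[/(lt_le_trans a0)].
apply: cvgD.
  apply: cvgD; first exact: hc.
  by apply: cvgMr; apply: cvg_within.
apply: cvg_trans (stationary_mean_continuous x0).
by apply: cvg_app; exact: cvg_within.
Qed.

(** J is at least J 1 outside a compact interval of positive controls. *)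
Lemma optimal_control_exists : h u @[u --> +oo] --> +oo ->
  C y @[y --> +oo] --> +oo -> exists u, optimal_control W p h C u.
Proof.
move=> /cvgryPge h_lim /cvgryPge C_lim.
have [b [_ hb]] := h_lim (J 1).
have [y [_ hy]] := C_lim (J 1 / q).
pose b1 := Num.max 1 (b + 1).
pose y1 := Num.max 1 (y + 1).
have y10 : 0 < y1 by rewrite lt_max ltr01.
(* below a1 the scaled cost C(u^(-k)) q is at least J 1; above b1 the term h u is *)
pose a1 := Num.min 1 (y1 `^ (- k^-1)).
have a10 : 0 < a1 by rewrite lt_min ltr01 powR_gt0.
have a11 : a1 <= 1 by rewrite ge_min lexx.
have b11 : 1 <= b1 by rewrite le_max lexx.
have [c cab cmin] := EVT_min (le_trans a11 b11) (@mean_cost_within a1 b1 a10).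
have c0 : 0 < c by move: cab; rewrite in_itv/= => /andP[/(lt_le_trans a10)].
have c1 : J c <= J 1 by apply: cmin; rewrite in_itv/= a11.
exists c; apply/optimal_controlP; split => // v v0.
have [va|av] := leP v a1.
  apply: (le_trans c1).
  have vy : y1 <= v `^ (- k).
    by apply: npowR_ge => //; apply: (le_trans va); rewrite ge_min lexx orbT.
  have : J 1 / q <= C (v `^ (- k)).
    by apply: hy; apply: lt_le_trans vy; rewrite lt_max ltrDl ltr01 orbT.
  rewrite ler_pdivrMr// => /le_trans; apply.
  apply: (le_trans (stationary_mean_ge v0)).
  by rewrite /mean_cost lerDr addr_ge0 ?h_ge0 ?mulr_ge0// ltW.
have [bv|vb] := leP b1 v.
  apply: (le_trans c1).
  have : J 1 <= h v.
    by apply: hb; apply: lt_le_trans bv; rewrite lt_max ltrDl ltr01 orbT.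
  move=> /le_trans; apply; rewrite /mean_cost -addrA lerDl addr_ge0 ?E_ge0//.
  by rewrite mulr_ge0// ltW.
by apply: cmin; rewrite in_itv/= (ltW av) (ltW vb).
Qed.

Section uniqueness.
Hypothesis C_convex : @convex_function R R^o `[0, +oo[%classic C.

Let EM u v w := (Cx (u `^ (- k) * Z w) + Cx (v `^ (- k) * Z w)) / 2.

Let EM_ge u v w : 0 < u -> u < v -> Cx (((u + v) / 2) `^ (- k) * Z w) <= EM u v w.
Proof.
move=> u0 uv; rewrite /EM /Cx !pos_extE ?mulr_ge0 ?powR_ge0//.
apply: convex_nd_le; rewrite ?mulr_ge0 ?powR_ge0//.
rewrite -mulrDl mulrAC ler_wpM2r//.
by apply: ltW; exact: npowR_mid.
Qed.

Let EM_int u v : 0 < u -> 0 < v ->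
  (\int[P]_w (EM u v w)%:E)%E = ((E u + E v) / 2)%:E.
Proof.
move=> u0 v0.
under eq_integral do rewrite /EM mulrC EFinM EFinD.
rewrite ge0_integralZl_EFin//.
- rewrite ge0_integralD//; try by [move=> w _; rewrite lee_fin|exact/measurable_EFinP].
  by rewrite !stationary_mean_scaling// -EFinD -EFinM mulrC.
- by move=> w _; rewrite -EFinD lee_fin addr_ge0.
- by apply: emeasurable_funD; exact/measurable_EFinP.
Qed.

Lemma stationary_mean_mid u v : 0 < u -> u < v -> E ((u + v) / 2) <= (E u + E v) / 2.
Proof.
move=> u0 uv; have v0 := lt_trans u0 uv.
have s0 : 0 < (u + v) / 2 by rewrite divr_gt0// addr_gt0.
rewrite -lee_fin -EM_int// -stationary_mean_scaling//.
apply: ge0_le_integral => //.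
- by move=> w _; rewrite lee_fin.
- exact/measurable_EFinP.
- by apply/measurable_EFinP; apply: measurable_funM => //; exact: measurable_funD.
- by move=> w _; rewrite lee_fin EM_ge.
Qed.

(** The midpoint inequality holds under the integral sign, so equality of the
integrals makes it an equality almost everywhere, and [convex_nd_eq] applies at
each point where Z_1 > 0. *)
Lemma stationary_mean_mid_eq u v : 0 < u -> u < v ->
  E ((u + v) / 2) = (E u + E v) / 2 -> E u = E v.
Proof.
move=> u0 uv Emid; have v0 := lt_trans u0 uv.
have s0 : 0 < (u + v) / 2 by rewrite divr_gt0// addr_gt0.
pose s := (u + v) / 2.
pose D w := EM u v w - Cx (s `^ (- k) * Z w).
have D0 w : 0 <= D w by rewrite subr_ge0; exact: EM_ge.
have mD : measurable_fun setT D.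
  apply: measurable_funB => //.
  by apply: measurable_funM => //; exact: measurable_funD.
have iD : (\int[P]_w (D w)%:E = 0)%E.
  have : (\int[P]_w (D w + Cx (s `^ (- k) * Z w))%:E = (E s)%:E)%E.
    rewrite Emid -EM_int//; apply: eq_integral => w _.
    by rewrite /D subrK.
  under eq_integral do rewrite EFinD.
  rewrite ge0_integralD//; try by [move=> w _; rewrite lee_fin|exact/measurable_EFinP].
  rewrite stationary_mean_scaling//.
  by case: (\int[P]_w _)%E => [x| |]//= []; rewrite -/(E s) => xE; congr EFin; lra.
have [N [mN N0 hN]] : {ae P, forall w, Cx (u `^ (- k) * Z w) = Cx (v `^ (- k) * Z w)}.
  have mDE : measurable_fun setT (EFin \o D) by exact/measurable_EFinP.
  have : (\int[P]_w `|(EFin \o D) w| = 0)%E.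
    by rewrite -[RHS]iD; apply: eq_integral => w _; rewrite gee0_abs// lee_fin.
  move=> /(ae_eq_integral_abs P measurableT mDE); apply: filterS => w /(_ I)[Dw].
  have [Zw0|Zn0] := eqVneq (Z w) 0; first by rewrite Zw0 !mulr0.
  have Zp : 0 < Z w by rewrite lt0r Zn0 Z0.
  have EMw : Cx (s `^ (- k) * Z w) = EM u v w by move: Dw; rewrite /D; lra.
  move: EMw; rewrite /EM /Cx !pos_extE ?mulr_ge0 ?powR_ge0//.
  apply: convex_nd_eq => //.
  - by rewrite mulr_ge0 ?powR_ge0.
  - by rewrite ltr_pM2r//; apply: npowR_lt => //; rewrite /s; lra.
  - by rewrite -mulrDl mulrAC ltr_pM2r//; exact: npowR_mid.
apply: EFin_inj; rewrite -(stationary_mean_scaling u0) -(stationary_mean_scaling v0).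
apply: ae_eq_integral => //; try exact/measurable_EFinP.
exists N; split => // w /= /not_implyP[_ nw]; apply: hN => /= e.
by apply: nw; rewrite e.
Qed.

Lemma optimal_unique :
  (forall u v, 0 < u -> u < v ->
     (forall s, 0 < s -> mean_cost u <= mean_cost s) ->
     (forall s, 0 < s -> mean_cost v <= mean_cost s) -> False) ->
  forall u1 u2, optimal_control W p h C u1 -> optimal_control W p h C u2 -> u1 = u2.
Proof.
move=> hF u1 u2 /optimal_controlP[u10 m1'] /optimal_controlP[u20 m2].
by have [lt12|lt21|//] := ltgtP u1 u2; [have := hF _ _ u10 lt12|have := hF _ _ u20 lt21];
  move=> /(_ _ _)[].
Qed.

(** Two minimizers force equality in the midpoint inequality, hence equal mean
holding costs at both, while h u + p u is strictly increasing. *)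
Lemma optimal_unique_price : 0 < p -> @convex_function R R^o `[0, +oo[%classic h ->
  forall u1 u2, optimal_control W p h C u1 -> optimal_control W p h C u2 -> u1 = u2.
Proof.
move=> p0 ch; apply: optimal_unique => u v u0 uv mu mv.
have v0 := lt_trans u0 uv.
have s0 : 0 < (u + v) / 2 by rewrite divr_gt0// addr_gt0.
have Juv : mean_cost u = mean_cost v by apply/eqP; rewrite eq_le mu// mv.
have hs := convex_mid ch (ltW u0) (ltW v0).
have Es := stationary_mean_mid u0 uv.
have Js := mu _ s0.
have /(stationary_mean_mid_eq u0 uv) Euv : E ((u + v) / 2) = (E u + E v) / 2.
  apply/eqP; rewrite eq_le Es/=.
  by move: Juv Js; rewrite /mean_cost -/(E u) -/(E v) -/(E _); lra.
have huv := h_ndecr (ltW u0) (ltW uv).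
have puv : p * u < p * v by rewrite ltr_pM2l.
by move: Juv; rewrite /mean_cost -/(E u) -/(E v); lra.
Qed.

Lemma optimal_unique_strict : @strictly_convex_function R `[0, +oo[%classic h ->
  forall u1 u2, optimal_control W p h C u1 -> optimal_control W p h C u2 -> u1 = u2.
Proof.
move=> ch; apply: optimal_unique => u v u0 uv mu mv.
have v0 := lt_trans u0 uv.
have s0 : 0 < (u + v) / 2 by rewrite divr_gt0// addr_gt0.
have uv' : u != v by rewrite lt_eqF.
have hs := strictly_convex_mid ch (ltW u0) (ltW v0) uv'.
have Es := stationary_mean_mid u0 uv.
have Js := mu _ s0; have Js' := mv _ s0.
by move: Js Js'; rewrite /mean_cost -/(E u) -/(E v) -/(E _); lra.
Qed.

End uniqueness.

End optimization.

Theorem theorem3p5 (R : realType) (d : measure_display)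
    (Omega : measurableType d) (P : probability Omega R)
    (H : R) (W : R -> {RV P >-> R}) (p : R) (h C : R -> R)
    (H_range : 2^-1 <= H < 1)
    (W_fBm : is_fBm H W)
    (p_ge0 : 0 <= p)
    (h_ge0 : forall u : R, 0 <= u -> 0 <= h u)
    (h_cont : {within `[0, +oo[, continuous h})
    (h_ndecr : forall u v : R, 0 <= u -> u <= v -> h u <= h v)
    (h_lim : h u @[u --> +oo] --> +oo)
    (C_ge0 : forall y : R, 0 <= y -> 0 <= C y)
    (C_cont : {within `[0, +oo[, continuous C})
    (C_ndecr : forall y z : R, 0 <= y -> y <= z -> C y <= C z)
    (C_growth : exists K gamma : R, [/\ 0 < K, 0 < gamma &
       forall y : R, 0 <= y -> C y <= K * (1 + y `^ gamma)]) :
  [/\ forall u x : R, 0 < u -> 0 <= x ->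
        cost W p h C u x = stationary_cost W p h C u,
      C y @[y --> +oo] --> +oo ->
        exists ustar, optimal_control W p h C ustar,
      0 < p -> @convex_function R R^o `[0, +oo[%classic h ->
        @convex_function R R^o `[0, +oo[%classic C ->
        forall u1 u2, optimal_control W p h C u1 ->
          optimal_control W p h C u2 -> u1 = u2
    & p = 0 -> @strictly_convex_function R `[0, +oo[%classic h ->
        @convex_function R R^o `[0, +oo[%classic C ->
        forall u1 u2, optimal_control W p h C u1 ->
          optimal_control W p h C u2 -> u1 = u2].
Proof.
split.
- by move=> u x u0 x0; exact: (cost_stationary H_range W_fBm).
- exact: (optimal_control_exists H_range W_fBm).
- by move=> p0 ch cC; exact: (optimal_unique_price H_range W_fBm).
- by move=> _ ch cC; exact: (optimal_unique_strict H_range W_fBm).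
Qed.
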